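(* Consider the model described in the context with the additional hypothesis that $u'_{l,\lambda_0}\ne0$ for $l=1,2$. Then for $l=1,2$ and any fixed $h\in\mathbb{R}$, $$\lim_{\alpha\to\alpha_0}R^{(\alpha)}_{\lambda_l^h(\alpha)}=-2i\,\frac{\|a_{ll}\phi_l\|^2}{h+i\|a_{ll}\phi_l\|^2}\Big\langle\cdot,\frac{\psi_{l,\lambda_0}}{\|\psi_{l,\lambda_0}\|}\Big\rangle\frac{\psi_{l,\lambda_0}}{\|\psi_{l,\lambda_0}\|}$$ in the Hilbert–Schmidt norm on $L^2(S^2)$. Consequently, for any fixed $h\in\mathbb{R}$, $$\lim_{\alpha\to\alpha_0}\sigma_\alpha(\lambda_l^h(\alpha))=\frac{4\pi}{\lambda_0}\,\frac{\|a_{ll}\phi_l\|^4}{h^2+\|a_{ll}\phi_l\|^4}.$$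
   Context: Inner products are linear in the first argument. On $\mathbb{R}^3$, $\widehat f(\xi)=(2\pi)^{-3/2}\int f(x)e^{-i\xi\cdot x}\,dx$. $H_0$ is the self-adjoint realization of $-\Delta$ on $L^2(\mathbb{R}^3)$. For $v\in L^2(\mathbb{R}^3)$, $\lambda\ge 0$, let $v_\lambda\in L^2(S^2)$, $v_\lambda(\omega)=2^{-1/2}\lambda^{1/4}\widehat v(\sqrt\lambda\,\omega)$; $v\mapsto(v_\lambda)_\lambda$ is unitary onto $L^2([0,\infty);L^2(S^2))$ and $(H_0v)_\lambda=\lambda v_\lambda$. $\mathcal{E}$ is the set of $v\in L^2(\mathbb{R}^3)$ such that $\lambda\mapsto v_\lambda$ is strongly smooth on $[0,\infty)$ and decays rapidly as $\lambda\to0$ and $\lambda\to\infty$ (for all $k,N\ge0$ the $k$-th strong derivative $v^{(k)}_\lambda$ satisfies $\lambda^{-N}\|v^{(k)}_\lambda\|\to0$ as $\lambda\to0$ and $\lambda^{N}\|v^{(k)}_\lambda\|\to0$ as $\lambda\to\infty$); $v'_\lambda$ is the first derivative. For $v,w\in\mathcal{E}$, $\eta_{v,w}(\lambda)=\langle v_\lambda,w_\lambda\rangle$ for $\lambda\ge0$ and $0$ for $\lambda<0$. For $f\in\mathcal{S}(\mathbb{R})$, $\gamma(f,\lambda)=\lim_{\epsilon\to0^+}\int_{\mathbb{R}\setminus(\lambda-\epsilon,\lambda+\epsilon)}\frac{f(x)}{x-\lambda}\,dx$. For $v\in\mathcal{E}$ with $v_a=0$ ($a\ge0$), $\Phi_{v,a}\in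 L^2(\mathbb{R}^3)$ is given by $(\Phi_{v,a})_\lambda=v_\lambda/(\lambda-a)$ for $\lambda\ne a$ and $(\Phi_{v,a})_a=v'_a$. Perturbation: $u_1,u_2\in\mathcal{E}$, $u_1\perp u_2$, $V=\sum_{j=1}^2\langle\cdot,u_j\rangle u_j$, $H_\alpha=H_0+\alpha V$ ($\alpha\in\mathbb{R}$). Write $u_{j,\lambda}=(u_j)_\lambda$, $u'_{j,\lambda}=(u_j)'_\lambda$, $\eta_{jk}=\eta_{u_j,u_k}$. For real $\alpha,\lambda$, $B(\alpha,\lambda+i0)=C(\alpha,\lambda)+iD(\alpha,\lambda)$ is the $2\times2$ matrix with $c_{jk}(\alpha,\lambda)=\delta_{jk}+\alpha\gamma(\eta_{kj},\lambda)$, $d_{jk}(\alpha,\lambda)=\alpha\pi\eta_{kj}(\lambda)$; $\tilde c_{jk}(\alpha,\lambda)$ and $\tilde b_{jk}(\alpha,\lambda+i0)$ are the $(j,k)$ cofactors of $C(\alpha,\lambda)$ and $B(\alpha,\lambda+i0)$; $F=\det B(\alpha,\lambda+i0)=F_1+iF_2$ with $F_1,F_2$ real. Model: $\alpha_0\in\mathbb{R}$ and $\lambda_0>0$ are fixed, and (b) $u_{1,\lambda_0}=u_{2,\lambda_0}=0$ and $\delta_{jk}+\alpha_0\gamma(\eta_{jk},\lambda_0)=0$ for $j,k\in\{1,2\}$ (equivalently $B(\alpha_0,\lambda_0+i0)=0$); put $\phi_j=\Phi_{u_j,\lambda_0}$; (c) $\langle\phi_1,\phi_2\rangle\ne0$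 or $\|\phi_1\|\ne\|\phi_2\|$; the labelling is such that $\|\phi_1\|\le\|\phi_2\|$. Put $d=\sqrt{(\|\phi_1\|^2-\|\phi_2\|^2)^2+4|\langle\phi_1,\phi_2\rangle|^2}$. Paths: $I\ni\alpha_0$ and $J\ni\lambda_0$ are bounded open intervals with $\overline J\subset(0,\infty)$, and $\lambda_1,\lambda_2:I\to J$ are distinct smooth functions with $\lambda_j(\alpha_0)=\lambda_0$, $F_1(\alpha,\lambda_j(\alpha))=0$ for $\alpha\in I$, and $\lambda_j'(\alpha_0)=\frac{\|\phi_1\|^2+\|\phi_2\|^2+(-1)^{j+1}d}{2\alpha_0^2(\|\phi_1\|^2\|\phi_2\|^2-|\langle\phi_1,\phi_2\rangle|^2)}$; $I,J$ are small enough that for each $\alpha\in I$ the zeros of $F_1(\alpha,\cdot)$ in $\overline J$ are exactly $\lambda_1(\alpha),\lambda_2(\alpha)$. (d) $F_2(\alpha,\lambda_j(\alpha))\ne0$ for all $\alpha\in I\setminus\{\alpha_0\}$, $j=1,2$. Canonical eigenbasis: $\psi_1=a_{11}\phi_1+a_{12}\phi_2$, $\psi_2=a_{21}\phi_1+a_{22}\phi_2$, where, with $q(z)=z/|z|$ for $z\neq 0$ and $q(0)=1$, $a_{11}=\sqrt{(-1+\alpha_0^2\|\phi_2\|^2\lambda_1'(\alpha_0))/d}$, $a_{12}=-q(\langle\phi_1,\phi_2\rangle)\sqrt{(-1+\alpha_0^2\|\phi_1\|^2\lambda_1'(\alpha_0))/d}$, $a_{21}=\sqrt{(1-\alpha_0^2\|\phi_2\|^2\lambda_2'(\alpha_0))/d}$,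 $a_{22}=q(\langle\phi_1,\phi_2\rangle)\sqrt{(1-\alpha_0^2\|\phi_1\|^2\lambda_2'(\alpha_0))/d}$; $\psi_{l,\lambda}=(\psi_l)_\lambda$. For $\alpha\ne\alpha_0$ in $I$ close to $\alpha_0$ (so that the denominator is nonzero), $\kappa_l(\alpha)=\frac{F_2(\alpha,\lambda_l(\alpha))}{\alpha\,\tilde c_{ll}(\alpha,\lambda_l(\alpha))\|\phi_l\|^2}$, and $\lambda_l^h(\alpha)=\lambda_l(\alpha)+h\kappa_l(\alpha)$. Scattering: the wave operators $\Omega^{(\alpha)}_\pm=\mathrm{s\text{-}lim}_{t\to\pm\infty}e^{itH_\alpha}e^{-itH_0}$ exist and are complete; $S^{(\alpha)}=\Omega_+^{(\alpha)*}\Omega_-^{(\alpha)}$ is unitary and commutes with $H_0$, so $(S^{(\alpha)}v)_\lambda=S^{(\alpha)}_\lambda v_\lambda$ with unitary $S^{(\alpha)}_\lambda$ on $L^2(S^2)$. For $\alpha\in I\setminus\{\alpha_0\}$, $\lambda\in J$ the scattering matrix is $S^{(\alpha)}_\lambda=I-\frac{2\pi i\alpha}{F(\alpha,\lambda)}\sum_{j,k=1}^2\tilde b_{jk}(\alpha,\lambda+i0)\langle\cdot,u_{j,\lambda}\rangle u_{k,\lambda}$. The scattering amplitude operator is $R^{(\alpha)}_\lambda=S^{(\alpha)}_\lambda-I$, and the total scattering cross-section is $\sigma_\alpha(\lambda)=\pi\lambda^{-1}\|R^{(\alpha)}_\lambda\|_2^2$ with $\|\cdot\|_2$ the Hilbert–Schmidt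 norm.
   Formalization: The first limit is stated under the extra condition that ψ_{l,λ0} is non-zero: it can vanish when u'_{1,λ0} and u'_{2,λ0} are linearly dependent, and then ψ_{l,λ0}/‖ψ_{l,λ0}‖ is undefined. The cross-section limit is stated without it. *)

(* Defs.v *)
From HB Require Import structures.
From mathcomp Require Import all_boot all_order all_algebra.
From mathcomp Require Import complex.
From mathcomp Require Import all_classical all_reals all_analysis.
From mathcomp Require Import measurable_realfun.

Set Implicit Arguments.
Unset Strict Implicit.
Unset Printing Implicit Defensive.

Import Order.TTheory GRing.Theory Num.Theory numFieldNormedType.Exports.

Local Open Scope classical_set_scope.
Local Open Scope ring_scope.
Local Open Scope complex_scope.

(* Elements of L^2(mu; C) are represented by square-integrable functions
   X -> R[i]; two representatives denote the same element when they agree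
   mu-almost everywhere, and operators act on representatives. *)
Section ComplexL2.
Context {R : realType} {d : measure_display} {X : measurableType d}.
Variable mu : {measure set X -> \bar R}.
Implicit Types f g : X -> R[i].

Definition cmeasurable f : Prop :=
  measurable_fun [set: X] (fun x => complex.Re (f x)) /\
  measurable_fun [set: X] (fun x => complex.Im (f x)).

Definition cintegral f : R[i] :=
  (\int[mu]_x complex.Re (f x)) +i* (\int[mu]_x complex.Im (f x)).

Definition L1 f : Prop :=
  cmeasurable f /\ (\int[mu]_x (Normc.normc (f x))%:E < +oo)%E.

Definition normsq f : \bar R := (\int[mu]_x ((Normc.normc (f x)) ^+ 2)%:E)%E.

Definition L2 f : Prop := cmeasurable f /\ (normsq f < +oo)%E.

Definition inner f g : R[i] := cintegral (fun x => f x * (g x)^*%C).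

Definition norm2 f : R := Num.sqrt (fine (normsq f)).

Definition unitary_op (T : (X -> R[i]) -> (X -> R[i])) : Prop :=
  [/\ forall f, L2 f -> L2 (T f),
      forall (a : R[i]) f g, L2 f -> L2 g ->
        T (a *: f + g) = a *: T f + T g %[ae mu],
      forall f g, L2 f -> L2 g -> inner (T f) (T g) = inner f g &
      forall g, L2 g -> exists2 f, L2 f & T f = g %[ae mu] ].

Definition orthonormal_basis (e : nat -> X -> R[i]) : Prop :=
  [/\ forall n, L2 (e n),
      forall m n, inner (e m) (e n) = (m == n)%:R &
      forall f, L2 f ->
        norm2 (f - \sum_(k < n) inner f (e k) *: e k) @[n --> \oo] --> 0 ].

(* The Hilbert-Schmidt norm (sum_n ||T e_n||^2)^(1/2), which does not depend
   on the orthonormal basis e. *)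
Definition hs_norm (e : nat -> X -> R[i])
    (T : (X -> R[i]) -> (X -> R[i])) : \bar R :=
  ((\sum_(0 <= n <oo) normsq (T (e n))) `^ (2^-1))%E.

End ComplexL2.

(* The unitary group t |-> e^{itH} of a self-adjoint operator H given by its
   graph: by Stone's theorem it is the only strongly continuous unitary group
   whose generator is iH. *)
Definition exp_itH (R : realType) (d : measure_display) (X : measurableType d)
    (mu : {measure set X -> \bar R}) (H : (X -> R[i]) -> (X -> R[i]) -> Prop)
    (U : R -> (X -> R[i]) -> (X -> R[i])) : Prop :=
  [/\ forall t, unitary_op mu (U t),
      forall s t f, L2 mu f -> U (s + t) f = U s (U t f) %[ae mu],
      forall f, L2 mu f -> norm2 mu (U t f - f) @[t --> (0 : R)] --> (0 : R) &
      forall f g, L2 mu f -> L2 mu g ->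
        (H f g <->
         norm2 mu ((t^-1)%:C *: (U t f - f) - 'i%C *: g)
           @[t --> (0 : R)^'] --> (0 : R)) ].

Notation R3 R :=
  (measurableTypeR R * measurableTypeR R * measurableTypeR R)%type.

Section Sphere.
Variable R : realType.

Definition leb3 : {measure set (R3 R) -> \bar R} :=
  ((@lebesgue_measure R \x @lebesgue_measure R) \x @lebesgue_measure R)%E.

Definition dot3 (x y : R3 R) : R := x.1.1 * y.1.1 + x.1.2 * y.1.2 + x.2 * y.2.
Definition norm3 (x : R3 R) : R := Num.sqrt (dot3 x x).
Definition scale3 (r : R) (x : R3 R) : R3 R := (r * x.1.1, r * x.1.2, r * x.2).

Definition direction (x : R3 R) : R3 R := scale3 (norm3 x)^-1 x.
Definition unit_ball : set (R3 R) := [set x | 0 < norm3 x <= 1].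

Let measurable_x1 : measurable_fun [set: R3 R] (fun x => x.1.1 : R).
Proof. exact: (measurableT_comp measurable_fst measurable_fst). Qed.

Let measurable_x2 : measurable_fun [set: R3 R] (fun x => x.1.2 : R).
Proof. exact: (measurableT_comp measurable_snd measurable_fst). Qed.

Let measurable_x3 : measurable_fun [set: R3 R] (fun x => x.2 : R).
Proof. exact: measurable_snd. Qed.

Let measurable_dot3 : measurable_fun [set: R3 R] (fun x => dot3 x x).
Proof.
by apply: measurable_funD; [apply: measurable_funD|]; exact: measurable_funM.
Qed.

Let dot3_ge0 x : 0 <= dot3 x x.
Proof. by rewrite /dot3 !addr_ge0// -expr2 sqr_ge0. Qed.

Let measurable_norm3 : measurable_fun [set: R3 R] norm3.
Proof.
rewrite (_ : norm3 = (fun r : R => r `^ 2^-1) \o (fun x => dot3 x x)).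
  exact: (measurableT_comp (measurable_powR _) measurable_dot3).
by apply/funext => x /=; rewrite powR12_sqrt.
Qed.

Let measurable_norm3V : measurable_fun [set: R3 R] (fun x => (norm3 x)^-1).
Proof.
rewrite (_ : (fun x => _) =
    (fun r : R => r `^ (- 2^-1)) \o (fun x => dot3 x x)).
  exact: (measurableT_comp (measurable_powR _) measurable_dot3).
by apply/funext => x /=; rewrite powRN powR12_sqrt.
Qed.

Lemma measurable_direction : measurable_fun [set: R3 R] direction.
Proof.
by apply: measurable_fun_pair; [apply: measurable_fun_pair|];
  apply: (measurable_funM measurable_norm3V).
Qed.

Lemma measurable_unit_ball : measurable unit_ball.
Proof.
rewrite /unit_ball (_ : [set x | _] = norm3 @^-1` `]0, 1]); last first.
  by apply/seteqP; split => x /=; rewrite in_itv.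
by rewrite -[X in measurable X]setTI; exact: measurable_norm3.
Qed.

(* The surface measure of the unit sphere S^2, as a measure on R^3 carried by
   S^2 (so that L^2(S^2) is [L2 surface]): the measure of A is three times
   the volume of the cone {r w : 0 < r <= 1, w in A}. *)
Definition surface (A : set (R3 R)) : \bar R :=
  (3%:E * leb3 (direction @^-1` A `&` unit_ball))%E.

Let cone_measure : {measure set (R3 R) -> \bar R} :=
  mscale 3%:nng
    (measure_function_pushforward__canonical__measure_function_Measure
      (mrestr leb3 measurable_unit_ball) measurable_direction).

Let surface0 : surface set0 = 0%E.
Proof. exact: (measure0 cone_measure). Qed.

Let surface_ge0 A : (0 <= surface A)%E.
Proof. exact: (measure_ge0 cone_measure). Qed.

Let surface_sigma_additive : semi_sigma_additive surface.
Proof. exact: (@measure_semi_sigma_additive _ _ _ cone_measure). Qed.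

HB.instance Definition _ := isMeasure.Build _ _ _ surface
  surface0 surface_ge0 surface_sigma_additive.
End Sphere.
Arguments surface : clear implicits.

Section SpectralRepresentation.
Variable R : realType.
Implicit Types (v w : R3 R -> R[i]) (FT : (R3 R -> R[i]) -> (R3 R -> R[i])).

Definition cis (t : R) : R[i] := cos t +i* sin t.

Definition fourier_integral v (xi : R3 R) : R[i] :=
  ((2 * pi) `^ (- (3 / 2)))%:C *
  cintegral (leb3 R) (fun x => v x * cis (- dot3 xi x)).

(* The Fourier transform on L^2(R^3): the unitary operator which is given by
   the integral formula on the dense subspace of integrable elements. *)
Definition fourier_transform FT : Prop :=
  unitary_op (leb3 R) FT /\
  (forall v, L1 (leb3 R) v -> L2 (leb3 R) v ->
     FT v = fourier_integral v %[ae leb3 R]).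

Definition fiber0 FT v (lam : R) (om : R3 R) : R[i] :=
  (2 `^ (- 2^-1) * lam `^ (4^-1))%:C * FT v (scale3 (Num.sqrt lam) om).

(* [g'] is the strong derivative of [g] on [0, +oo) (one-sided at 0). *)
Definition strong_derivative (g g' : R -> R3 R -> R[i]) : Prop :=
  forall lam : R, 0 <= lam ->
    norm2 (surface R) ((t^-1)%:C *: (g (lam + t) - g lam) - g' lam)
      @[t --> within [set t : R | 0 <= lam + t] (0 : R)^'] --> (0 : R).

(* [G k lam] is the k-th strong derivative of lam |-> v_lam, for the
   smooth representative G 0 of the family (v_lam), which is a priori defined
   for almost every lam only. *)
Definition smooth_fibers FT v (G : nat -> R -> R3 R -> R[i]) : Prop :=
  [/\ forall k (lam : R), 0 <= lam -> L2 (surface R) (G k lam),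
      \forall lam \ae @lebesgue_measure R,
        0 < lam -> G 0%N lam = fiber0 FT v lam %[ae surface R],
      forall k, strong_derivative (G k) (G k.+1),
      forall k N : nat, lam ^- N * norm2 (surface R) (G k lam)
        @[lam --> (0 : R)^'+] --> (0 : R) &
      forall k N : nat, lam ^+ N * norm2 (surface R) (G k lam)
        @[lam --> +oo] --> (0 : R)].

Definition classE FT v : Prop := L2 (leb3 R) v /\ exists G, smooth_fibers FT v G.

(* For v in E, [fiberD FT v k lam] is the k-th derivative of the fiber v_lam;
   it is unique up to equality almost everywhere on S^2. *)
Definition fiberD FT v : nat -> R -> R3 R -> R[i] :=
  xget (fun _ _ _ => 0) [set G | smooth_fibers FT v G].

Definition fiber FT v : R -> R3 R -> R[i] := fiberD FT v 0.
Definition fiber' FT v : R -> R3 R -> R[i] := fiberD FT v 1.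

Definition eta FT v w (lam : R) : R[i] :=
  if 0 <= lam then inner (surface R) (fiber FT v lam) (fiber FT w lam)
  else 0.

Definition pv (f : R -> R) (lam : R) : R :=
  lim ((\int[@lebesgue_measure R]_(x in [set x : R | (eps <= `|x - lam|)%R])
          (f x / (x - lam))) @[eps --> (0 : R)^'+]).

Definition gamma (f : R -> R[i]) (lam : R) : R[i] :=
  pv (fun x => complex.Re (f x)) lam +i* pv (fun x => complex.Im (f x)) lam.

Definition is_Phi FT v (a : R) w : Prop :=
  [/\ classE FT w,
      forall lam : R, 0 <= lam -> lam != a ->
        fiber FT w lam = ((lam - a)^-1)%:C *: fiber FT v lam
          %[ae surface R] &
      fiber FT w a = fiber' FT v a %[ae surface R] ].

End SpectralRepresentation.

Section Model.
Variable R : realType.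
Variable FT : (R3 R -> R[i]) -> (R3 R -> R[i]).
Variable u : 'I_2 -> R3 R -> R[i].

(* w = H_0 v, H_0 being multiplication by |xi|^2 in Fourier space. *)
Definition free_graph (v w : R3 R -> R[i]) : Prop :=
  [/\ L2 (leb3 R) v, L2 (leb3 R) w &
      FT w = (fun xi => (norm3 xi ^+ 2)%:C * FT v xi) %[ae leb3 R]].

Definition Vpert (v : R3 R -> R[i]) : R3 R -> R[i] :=
  \sum_(j < 2) inner (leb3 R) v (u j) *: u j.

(* w = H_alpha v, that is w - alpha V v = H_0 v. *)
Definition perturbed_graph (alpha : R) (v w : R3 R -> R[i]) : Prop :=
  free_graph v (w - alpha%:C *: Vpert v).

(* W is the strong limit of e^{itH_alpha} e^{-itH_0} along T. *)
Definition wave_operator (T : set_system R)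
    (U U0 : R -> (R3 R -> R[i]) -> (R3 R -> R[i]))
    (W : (R3 R -> R[i]) -> (R3 R -> R[i])) : Prop :=
  forall v, L2 (leb3 R) v ->
    L2 (leb3 R) (W v) /\
    norm2 (leb3 R) (U t (U0 (- t) v) - W v) @[t --> T] --> (0 : R).

(* S = Omega_+^* Omega_-. *)
Definition scattering_operator (alpha : R)
    (S : (R3 R -> R[i]) -> (R3 R -> R[i])) : Prop :=
  exists U0 U Wp Wm,
    [/\ exp_itH (leb3 R) free_graph U0,
        exp_itH (leb3 R) (perturbed_graph alpha) U,
        wave_operator +oo U U0 Wp,
        wave_operator -oo U U0 Wm &
        forall v w, L2 (leb3 R) v -> L2 (leb3 R) w ->
          L2 (leb3 R) (S v) /\
          inner (leb3 R) (S v) w = inner (leb3 R) (Wm v) (Wp w)].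

(* (S v)_lam = S_lam v_lam, with S_lam unitary on L^2(S^2). *)
Definition scattering_matrix (alpha : R)
    (Slam : R -> (R3 R -> R[i]) -> (R3 R -> R[i])) : Prop :=
  exists2 S, scattering_operator alpha S &
    (\forall lam \ae @lebesgue_measure R,
       0 < lam -> unitary_op (surface R) (Slam lam)) /\
    (forall v, L2 (leb3 R) v ->
       \forall lam \ae @lebesgue_measure R, 0 < lam ->
         fiber0 FT (S v) lam = Slam lam (fiber0 FT v lam)
           %[ae surface R]).

Definition Cmx (alpha lam : R) : 'M[R[i]]_2 :=
  \matrix_(j, k) ((j == k)%:R + alpha%:C * gamma (eta FT (u k) (u j)) lam).

Definition Dmx (alpha lam : R) : 'M[R[i]]_2 :=
  \matrix_(j, k) ((alpha * pi)%:C * eta FT (u k) (u j) lam).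

(* B(alpha, lam + i0) *)
Definition Bmx (alpha lam : R) : 'M[R[i]]_2 :=
  Cmx alpha lam + 'i%C *: Dmx alpha lam.

Definition Fdet (alpha lam : R) : R[i] := \det (Bmx alpha lam).
Definition F1 (alpha lam : R) : R := complex.Re (Fdet alpha lam).
Definition F2 (alpha lam : R) : R := complex.Im (Fdet alpha lam).

Definition stationary_scattering (alpha lam : R) (f : R3 R -> R[i]) :
    R3 R -> R[i] :=
  f - ((2 * pi * alpha)%:C * 'i%C / Fdet alpha lam) *:
    \sum_(j < 2) \sum_(k < 2)
      (cofactor (Bmx alpha lam) j k *
         inner (surface R) f (fiber FT (u j) lam)) *: fiber FT (u k) lam.

Variable phi : 'I_2 -> R3 R -> R[i].

Definition gap : R :=
  Num.sqrt ((norm2 (leb3 R) (phi 0) ^+ 2 - norm2 (leb3 R) (phi 1) ^+ 2) ^+ 2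
    + 4 * Normc.normc (inner (leb3 R) (phi 0) (phi 1)) ^+ 2).

(* lambda_j'(alpha0); the exponent (-1)^(j+1) becomes (-1)^j because the
   labels j = 1, 2 are the elements 0, 1 of 'I_2. *)
Definition slope (alpha0 : R) (j : 'I_2) : R :=
  (norm2 (leb3 R) (phi 0) ^+ 2 + norm2 (leb3 R) (phi 1) ^+ 2
     + (-1) ^+ j * gap)
  / (2 * alpha0 ^+ 2 *
      (norm2 (leb3 R) (phi 0) ^+ 2 * norm2 (leb3 R) (phi 1) ^+ 2
       - Normc.normc (inner (leb3 R) (phi 0) (phi 1)) ^+ 2)).

Definition phase (z : R[i]) : R[i] :=
  if z == 0 then 1 else z / (Normc.normc z)%:C.

Variables (alpha0 : R) (dlam : 'I_2 -> R).

(* The coefficients a_11, a_12, a_21, a_22, with dlam j = lambda_j'(alpha0). *)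
Definition eigcoef (l k : 'I_2) : R[i] :=
  let n1 := norm2 (leb3 R) (phi 0) ^+ 2 in
  let n2 := norm2 (leb3 R) (phi 1) ^+ 2 in
  let q := phase (inner (leb3 R) (phi 0) (phi 1)) in
  if l == 0 then
    if k == 0 then (Num.sqrt ((-1 + alpha0 ^+ 2 * n2 * dlam 0) / gap))%:C
    else - q * (Num.sqrt ((-1 + alpha0 ^+ 2 * n1 * dlam 0) / gap))%:C
  else
    if k == 0 then (Num.sqrt ((1 - alpha0 ^+ 2 * n2 * dlam 1) / gap))%:C
    else q * (Num.sqrt ((1 - alpha0 ^+ 2 * n1 * dlam 1) / gap))%:C.

Definition eigvec (l : 'I_2) : R3 R -> R[i] :=
  \sum_(k < 2) eigcoef l k *: phi k.

(* kappa_l(alpha), with lam = lambda_l(alpha); the diagonal cofactors of the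
   Hermitian matrix C are real. *)
Definition kappa (l : 'I_2) (alpha lam : R) : R :=
  F2 alpha lam /
    (alpha * complex.Re (cofactor (Cmx alpha lam) l l)
       * norm2 (leb3 R) (phi l) ^+ 2).

End Model.

Section CrossSection.
Variable R : realType.

Definition amplitude (Slam : (R3 R -> R[i]) -> (R3 R -> R[i]))
    (f : R3 R -> R[i]) : R3 R -> R[i] := Slam f - f.

Definition cross_section (e : nat -> R3 R -> R[i])
    (Slam : (R3 R -> R[i]) -> (R3 R -> R[i])) (lam : R) : \bar R :=
  ((pi / lam)%:E * hs_norm (surface R) e (amplitude Slam) ^+ 2)%E.

(* -2i s / (h + i s) <., psi/||psi||> psi/||psi||  on L^2(S^2) *)
Definition breit_wigner (h s : R) (psi : R3 R -> R[i]) (f : R3 R -> R[i]) :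
    R3 R -> R[i] :=
  let psin := ((norm2 (surface R) psi)^-1)%:C *: psi in
  (- (2%:R * 'i%C) * (s%:C / (h%:C + 'i%C * s%:C)) *
     inner (surface R) f psin) *: psin.

End CrossSection.

(* Main.v *)
From HB Require Import structures.
Require Import Defs.
From mathcomp Require Import all_boot all_order all_algebra.
From mathcomp Require Import complex.
From mathcomp Require Import all_classical all_reals all_analysis.
From mathcomp Require Import measurable_realfun.
From mathcomp Require Import ring lra.

Import Order.TTheory GRing.Theory Num.Theory numFieldNormedType.Exports.

Set Implicit Arguments.
Unset Strict Implicit.
Unset Printing Implicit Defensive.

Local Open Scope classical_set_scope.
Local Open Scope ring_scope.
Local Open Scope complex_scope.

Local Notation Re := complex.Re.
Local Notation Im := complex.Im.
Local Notation normc := Normc.normc.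

(** Put [x = lam - lam0], [tau = alpha - alpha0] and [s = ||a_ll phi_l||^2]. The
    fibers of [u j] are [x] times those of the eigenfunction [phi j], so the
    densities [eta] have a double zero at [lam0] ([eta_Phi]). Expanding this
    square in the principal value gives
      [gamma = m + x <phi, phi> + x^2 p(lam)]
    ([pv_double_zero]), where [p] is a principal value of the densities of the
    eigenfunctions and is Lipschitz because these are regular ([eta_tame],
    [pvE_lip]); the first moments [m] are known because [B] vanishes at
    [(alpha0, lam0)]. Hence ([Cmx_pencil], [Dmx_pencil])
      [C = (1 - alpha / alpha0) + alpha (x G + x^2 P(lam))],
      [D = alpha x^2 Z(lam)],
    with [G] the Gram matrix of the eigenfunctions, [Z] the positive matrix [pi]
    times the Gram matrix of their fibers, and [P], [Z] Lipschitz.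

    Along a branch of slope [L], [B / tau] tends to [M = - 1 / alpha0 + alpha0 L G].
    The slopes are the values of [L] for which [M] is singular, and the cofactor
    matrix of [M] is then of rank one, with the coefficients of the eigenvector
    [psi_l] as factors ([cofactor_slope]). This uses that [G] is nonsingular: a
    linear relation between the eigenfunctions would be one between the first
    moments [m], which form an invertible matrix ([Gram_pos]).

    For Hermitian [C] and [D] one has [F1 = det C - det D], and [F2] is the polar
    form of the determinant at [C] and [D]. On the branch [det C = det D], and
    since [D] is a real multiple of a positive matrix and of smaller order than
    [C], the theorem of Cayley and Hamilton yields [det D = o(F2)]
    ([det_le_polar_det]). A shift of [lam] by [h kappa_l] changes [det B] by
    [(h / s) F2] to leading order and keeps [det D] negligible, so that
    [F / F2(alpha, lam_l(alpha))] tends to [h / s + i] ([resonance_limits]).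

    The amplitude has finite rank, so Parseval's identity expresses its
    Hilbert-Schmidt norm by its coefficients and the entries of [D]
    ([hs_norm_finite_rank]); its square is [4 (F2^2 - 2 F1 det D) / |F|^2]
    ([cofactor_quartic]), which tends to [4 s^2 / (h^2 + s^2)] whatever the order
    to which [F2] vanishes. If the fiber of [psi_l] at [lam0] is not zero, that
    order is three, with a leading coefficient proportional to the square of the
    norm of this fiber; then the coefficients of the amplitude relative to the
    fibers of the [phi j] converge to those of the Breit-Wigner operator, and
    these fibers converge in [L^2(S^2)] ([amplitude_cvg]). *)

(** * Complex numbers *)

Section ComplexNumbers.
Variable R : realType.
Implicit Types z w : R[i].

Lemma ReD z w : Re (z + w) = Re z + Re w. Proof. by case: z w => ? ? []. Qed.
Lemma ImD z w : Im (z + w) = Im z + Im w. Proof. by case: z w => ? ? []. Qed.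
Lemma ReN z : Re (- z) = - Re z. Proof. by case: z. Qed.
Lemma ImN z : Im (- z) = - Im z. Proof. by case: z. Qed.
Lemma ReM z w : Re (z * w) = Re z * Re w - Im z * Im w.
Proof. by case: z w => ? ? []. Qed.
Lemma ImM z w : Im (z * w) = Re z * Im w + Im z * Re w.
Proof. by case: z w => a b [c d] /=; rewrite (addrC (a * d)). Qed.
Lemma Re_conj z : Re z^*%C = Re z. Proof. by case: z. Qed.
Lemma Im_conj z : Im z^*%C = - Im z. Proof. by case: z. Qed.
Lemma ReZ (a : R) : Re a%:C = a. Proof. by []. Qed.
Lemma ImZ (a : R) : Im a%:C = 0. Proof. by []. Qed.

Definition reimE := (ReD, ImD, ReN, ImN, ReM, ImM, Re_conj, Im_conj, ReZ, ImZ).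

Lemma complex_ext z w : Re z = Re w -> Im z = Im w -> z = w.
Proof. by case: z w => ? ? [? ?] /= -> ->. Qed.

Lemma normc_sqr z : normc z ^+ 2 = Re z ^+ 2 + Im z ^+ 2.
Proof. by case: z => a b /=; rewrite sqr_sqrtr// addr_ge0// sqr_ge0. Qed.

Lemma normc_ge0 z : 0 <= normc z.
Proof. by case: z => a b; exact: sqrtr_ge0. Qed.

Lemma normc_real (a : R) : normc a%:C = `|a|.
Proof. by rewrite /normc /= expr0n addr0 sqrtr_sqr. Qed.

Lemma normc_i : normc ('i%C : R[i]) = 1.
Proof. by rewrite /normc /= expr0n expr1n add0r sqrtr1. Qed.

Lemma normcN z : normc (- z) = normc z.
Proof.
apply/eqP; rewrite -(@eqrXn2 _ 2)// ?normc_ge0//.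
by rewrite !normc_sqr !reimE !sqrrN.
Qed.

Lemma Re_sum (I : Type) (r : seq I) (P : pred I) (f : I -> R[i]) :
  Re (\sum_(i <- r | P i) f i) = \sum_(i <- r | P i) Re (f i).
Proof. exact: (big_morph (fun z : R[i] => Re z) ReD). Qed.

Lemma conjcD z w : (z + w)^*%C = z^*%C + w^*%C. Proof. exact: rmorphD. Qed.
Lemma conjcB z w : (z - w)^*%C = z^*%C - w^*%C. Proof. exact: rmorphB. Qed.
Lemma conjcM z w : (z * w)^*%C = z^*%C * w^*%C. Proof. exact: rmorphM. Qed.

Lemma conjc_sum (I : Type) (r : seq I) (P : pred I) (f : I -> R[i]) :
  (\sum_(i <- r | P i) f i)^*%C = \sum_(i <- r | P i) (f i)^*%C.
Proof. exact: (raddf_sum (@conjc R)). Qed.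

Lemma Re_le_normc z : `|Re z| <= normc z.
Proof.
rewrite -(@ler_pXn2r _ 2)// ?nnegrE ?normr_ge0 ?normc_ge0//.
by rewrite real_normK ?num_real// normc_sqr lerDl sqr_ge0.
Qed.

Lemma Im_le_normc z : `|Im z| <= normc z.
Proof.
rewrite -(@ler_pXn2r _ 2)// ?nnegrE ?normr_ge0 ?normc_ge0//.
by rewrite real_normK ?num_real// normc_sqr lerDr sqr_ge0.
Qed.

End ComplexNumbers.

Section Pointwise.
Variables (R : realType) (X : Type).
Implicit Types f g : X -> R[i].

Lemma fun_addE f g x : (f + g) x = f x + g x. Proof. by []. Qed.
Lemma fun_subE f g x : (f - g) x = f x - g x. Proof. by []. Qed.
Lemma fun_scaleE (a : R[i]) f x : (a *: f) x = a * f x. Proof. by []. Qed.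
Lemma fun_zeroE x : (0 : X -> R[i]) x = 0. Proof. by []. Qed.

Definition ptE := (fun_subE, fun_addE, fun_scaleE, fun_zeroE).

End Pointwise.

(** Componentwise, since only the compatibility of limits with the field
    operations and with conjugation is used. *)
Definition ccvg (R : realType) (T : Type) (F : set_system T) (f : T -> R[i])
    (z : R[i]) : Prop :=
  Re (f t) @[t --> F] --> Re z /\ Im (f t) @[t --> F] --> Im z.

Section ComplexConvergence.
Variables (R : realType) (T : Type) (F : set_system T).
Context {FF : Filter F}.
Implicit Types (f g : T -> R[i]) (z w : R[i]).

Lemma ccvg_cst z : ccvg F (fun _ => z) z.
Proof. by split; exact: cvg_cst. Qed.

Lemma ccvgD f g z w : ccvg F f z -> ccvg F g w ->
  ccvg F (fun t => f t + g t) (z + w).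
Proof.
move=> [f1 f2] [g1 g2]; split; rewrite ?reimE.
  by under eq_fun do rewrite ReD; exact: cvgD.
by under eq_fun do rewrite ImD; exact: cvgD.
Qed.

Lemma ccvgM f g z w : ccvg F f z -> ccvg F g w ->
  ccvg F (fun t => f t * g t) (z * w).
Proof.
move=> [f1 f2] [g1 g2]; split; rewrite ?reimE.
  by under eq_fun do rewrite ReM; apply: cvgB; exact: cvgM.
by under eq_fun do rewrite ImM; apply: cvgD; exact: cvgM.
Qed.

Lemma ccvg_conj f z : ccvg F f z -> ccvg F (fun t => (f t)^*%C) z^*%C.
Proof.
move=> [f1 f2]; split; rewrite ?reimE.
  by under eq_fun do rewrite Re_conj.
by under eq_fun do rewrite Im_conj; exact: cvgN.
Qed.

Lemma ccvg_real (f : T -> R) (a : R) : f t @[t --> F] --> a ->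
  ccvg F (fun t => (f t)%:C) a%:C.
Proof. by move=> fa; split => //=; exact: cvg_cst. Qed.

Lemma ccvgV f z : z != 0 -> ccvg F f z -> ccvg F (fun t => (f t)^-1) z^-1.
Proof.
move=> z0 [f1 f2].
have E y : (y^-1 : R[i]) = ((Re y ^+ 2 + Im y ^+ 2)^-1)%:C * y^*%C.
  case: y => a b.
  have -> : ((a +i* b)^-1 : R[i]) =
    (a / (a ^+ 2 + b ^+ 2)) -i* (b / (a ^+ 2 + b ^+ 2)) by [].
  apply: complex_ext => /=; rewrite ?mul0r ?subr0 ?addr0 mulrC//.
  by rewrite mulrN mulrC.
have nz : Re z ^+ 2 + Im z ^+ 2 != 0.
  apply: contra z0 => /eqP zz; apply/eqP; apply: Normc.eq0_normc.
  by apply/eqP; rewrite -sqrf_eq0 normc_sqr zz.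
have -> : (fun t => (f t)^-1) =
    (fun t => ((Re (f t) ^+ 2 + Im (f t) ^+ 2)^-1)%:C * (f t)^*%C).
  by apply/funext => t; exact: E.
rewrite E; apply: ccvgM; last exact: ccvg_conj.
apply: ccvg_real; apply: cvgV => //.
by apply: cvgD; rewrite expr2; under eq_fun do rewrite expr2; exact: cvgM.
Qed.

Lemma ccvg_sum (I : Type) (r : seq I) (P : pred I) (f : I -> T -> R[i])
    (z : I -> R[i]) : (forall i, ccvg F (f i) (z i)) ->
  ccvg F (fun t => \sum_(i <- r | P i) f i t) (\sum_(i <- r | P i) z i).
Proof.
move=> fz; elim: r => [|i r IH].
  under eq_fun do rewrite big_nil.
  by rewrite big_nil; exact: ccvg_cst.
under eq_fun do rewrite big_cons.
by rewrite big_cons; case: (P i) => //; exact: ccvgD.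
Qed.

Lemma ccvg_normc f z : normc (f t - z) @[t --> F] --> (0 : R) -> ccvg F f z.
Proof.
move=> fz; split; apply/cvgrPdist_lt => e e0.
  have /cvgrPdist_lt/(_ e e0) := fz; apply: filterS => t; rewrite sub0r normrN.
  rewrite ger0_norm ?normc_ge0// -normrN opprB -ReN -ReD.
  exact: le_lt_trans (Re_le_normc _).
have /cvgrPdist_lt/(_ e e0) := fz; apply: filterS => t; rewrite sub0r normrN.
rewrite ger0_norm ?normc_ge0// -normrN opprB -ImN -ImD.
exact: le_lt_trans (Im_le_normc _).
Qed.

End ComplexConvergence.

Import HBNNSimple.

(** * The Hilbert space of square-integrable functions *)

Section HilbertSpace.
Context {R : realType} {d : measure_display} {X : measurableType d}.
Variable mu : {measure set X -> \bar R}.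
Implicit Types f g h : X -> R[i].

Local Notation L2 := (L2 mu).
Local Notation inner := (inner mu).
Local Notation norm2 := (norm2 mu).
Local Notation normsq := (normsq mu).
Local Notation intbl p := (mu.-integrable [set: X] (EFin \o p)).

Definition cintegrable f : Prop :=
  intbl (fun x => Re (f x)) /\ intbl (fun x => Im (f x)).

Lemma intblZ (a : R) (p : X -> R) : intbl p -> intbl (fun x => a * p x).
Proof. by move=> /(integrableZl measurableT a); apply: eq_integrable. Qed.

Lemma intblD (p q : X -> R) : intbl p -> intbl q -> intbl (fun x => p x + q x).
Proof. by move=> ip iq; have := integrableD measurableT ip iq; apply: eq_integrable. Qed.

Lemma Re_cintegral f : Re (cintegral mu f) = \int[mu]_x Re (f x).
Proof. by []. Qed.

Lemma Im_cintegral f : Im (cintegral mu f) = \int[mu]_x Im (f x).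
Proof. by []. Qed.

Lemma cintegral_lin (a : R[i]) f g : cintegrable f -> cintegrable g ->
  cintegral mu (fun x => a * f x + g x) = a * cintegral mu f + cintegral mu g.
Proof.
move=> [f1 f2] [g1 g2]; apply: complex_ext.
  rewrite ReD ReM !Re_cintegral Im_cintegral.
  rewrite (@eq_Rintegral _ _ _ mu _ (fun x => Re a * Re (f x) + - Im a * Im (f x)
    + Re (g x))); last by move=> x _; rewrite ReD ReM mulNr.
  rewrite RintegralD//; last by apply: intblD; exact: intblZ.
  by rewrite RintegralD//; [|exact: intblZ..]; rewrite !RintegralZl// mulNr.
rewrite ImD ImM !Im_cintegral Re_cintegral.
rewrite (@eq_Rintegral _ _ _ mu _ (fun x => Re a * Im (f x) + Im a * Re (f x)
    + Im (g x))); last by move=> x _; rewrite ImD ImM.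
rewrite RintegralD//; last by apply: intblD; exact: intblZ.
by rewrite RintegralD//; [|exact: intblZ..]; rewrite !RintegralZl.
Qed.

Lemma normsqE f : normsq f = (\int[mu]_x (Re (f x) ^+ 2 + Im (f x) ^+ 2)%:E)%E.
Proof. by apply: eq_integral => x _; rewrite normc_sqr. Qed.

Lemma normsq_ge0 f : (0 <= normsq f)%E.
Proof. by apply: integral_ge0 => x _; rewrite lee_fin sqr_ge0. Qed.

Lemma measurable_sq f : cmeasurable f ->
  measurable_fun [set: X] (fun x => Re (f x) ^+ 2 + Im (f x) ^+ 2).
Proof.
by move=> [m1 m2]; apply: measurable_funD; exact: measurable_funX.
Qed.

Lemma L2_integrable_sq f : L2 f ->
  intbl (fun x => Re (f x) ^+ 2 + Im (f x) ^+ 2).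
Proof.
move=> [mf nf]; apply/integrableP; split.
  by apply/measurable_EFinP; exact: measurable_sq.
rewrite normsqE in nf; apply: le_lt_trans nf.
apply: ge0_le_integral => //=.
- by apply/measurable_EFinP; apply: measurableT_comp => //; exact: measurable_sq.
- by apply/measurable_EFinP; exact: measurable_sq.
- by move=> x _; rewrite lee_fin ger0_norm// addr_ge0// sqr_ge0.
Qed.

Lemma intblM f g (p q : X -> R) : L2 f -> L2 g ->
  measurable_fun [set: X] p -> measurable_fun [set: X] q ->
  (forall x, p x ^+ 2 <= Re (f x) ^+ 2 + Im (f x) ^+ 2) ->
  (forall x, q x ^+ 2 <= Re (g x) ^+ 2 + Im (g x) ^+ 2) ->
  intbl (fun x => p x * q x).
Proof.
move=> Lf Lg mp mq pf qg.
have fg := intblD (L2_integrable_sq Lf) (L2_integrable_sq Lg).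
apply: (le_integrable measurableT _ _ fg).
  by apply/measurable_EFinP; exact: measurable_funM.
move=> x _ /=; rewrite lee_fin normrM.
have pf' := pf x; have qg' := qg x; rewrite -real_normK ?num_real// in pf'.
rewrite -(@real_normK _ (q x)) ?num_real// in qg'.
rewrite [leRHS]ger0_norm; last by rewrite !addr_ge0// sqr_ge0.
by apply: le_trans (lerD pf' qg'); nra.
Qed.

Lemma L2_cintegrable f g : L2 f -> L2 g ->
  cintegrable (fun x => f x * (g x)^*%C).
Proof.
move=> Lf Lg; have [[f1 f2] _] := Lf; have [[g1 g2] _] := Lg.
have N (p : X -> R) : measurable_fun [set: X] p ->
    measurable_fun [set: X] (fun x => - p x) by exact: measurableT_comp.
have A (x y : R) : x ^+ 2 <= x ^+ 2 + y ^+ 2 by rewrite lerDl sqr_ge0.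
have B (x y : R) : y ^+ 2 <= x ^+ 2 + y ^+ 2 by rewrite lerDr sqr_ge0.
have BN (x y : R) : (- y) ^+ 2 <= x ^+ 2 + y ^+ 2.
  by rewrite sqrrN lerDr sqr_ge0.
split.
  under eq_fun do rewrite ReM Re_conj Im_conj mulrN opprK.
  by apply: intblD; apply: (@intblM f g) => //=.
under eq_fun do rewrite ImM Re_conj Im_conj.
by apply: intblD; apply: (@intblM f g) => //=; exact: N.
Qed.

Lemma L2_lin (a : R[i]) f g : L2 f -> L2 g -> L2 (a *: f + g).
Proof.
move=> Lf Lg; have [[f1 f2] _] := Lf; have [[g1 g2] _] := Lg.
have mfg : cmeasurable (a *: f + g).
  split.
    rewrite [X in measurable_fun _ X](_ : _ = fun x =>
      (Re a * Re (f x) - Im a * Im (f x)) + Re (g x)); last first.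
      by apply/funext => x; rewrite fctE /= !reimE.
    by apply: measurable_funD => //; apply: measurable_funB;
      exact: measurable_funM.
  rewrite [X in measurable_fun _ X](_ : _ = fun x =>
    (Re a * Im (f x) + Im a * Re (f x)) + Im (g x)); last first.
    by apply/funext => x; rewrite fctE /= !reimE.
  by apply: measurable_funD => //; apply: measurable_funD;
    exact: measurable_funM.
split => //; rewrite normsqE.
have := intblD (intblZ (2 * (Re a ^+ 2 + Im a ^+ 2)) (L2_integrable_sq Lf))
  (intblZ 2 (L2_integrable_sq Lg)) => /integrableP[mi].
apply: le_lt_trans; apply: ge0_le_integral => //=.
- by move=> x _; rewrite lee_fin addr_ge0// sqr_ge0.
- by apply/measurable_EFinP; exact: measurable_sq.
- by apply/measurable_EFinP; apply: measurableT_comp => //; exact/measurable_EFinP.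
- move=> x _; rewrite lee_fin fctE; apply: le_trans (ler_norm _).
  rewrite /= !reimE.
  move: (Re a) (Im a) (Re (f x)) (Im (f x)) (Re (g x)) (Im (g x)) => *.
  rewrite -subr_ge0.
  match goal with |- is_true (0 <= 2 * (?a ^+ 2 + ?b ^+ 2) * (?u ^+ 2 + ?v ^+ 2)
     + 2 * (?p ^+ 2 + ?q ^+ 2) - _) =>
     have -> : 2 * (a ^+ 2 + b ^+ 2) * (u ^+ 2 + v ^+ 2)
     + 2 * (p ^+ 2 + q ^+ 2) - ((a * u - b * v + p) ^+ 2 + (a * v + b * u + q) ^+ 2) =
     (a * u - b * v - p) ^+ 2 + (a * v + b * u - q) ^+ 2 by ring end.
  by rewrite addr_ge0// sqr_ge0.
Qed.

Lemma L20 : L2 0.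
Proof.
split; first by split; exact: measurable_cst.
rewrite normsqE (eq_integral (cst 0%E)) ?integral0//.
by move=> x _ /=; rewrite expr0n addr0.
Qed.

Lemma L2Z (a : R[i]) f : L2 f -> L2 (a *: f).
Proof. by move=> Lf; rewrite -[_ *: _]addr0; exact: L2_lin Lf L20. Qed.

Lemma L2D f g : L2 f -> L2 g -> L2 (f + g).
Proof. by move=> Lf Lg; rewrite -[f]scale1r; exact: L2_lin. Qed.

Lemma L2B f g : L2 f -> L2 g -> L2 (f - g).
Proof. by move=> Lf Lg; rewrite addrC -scaleN1r; exact: L2_lin. Qed.

Lemma L2_sum (I : Type) (r : seq I) (P : pred I) (f : I -> X -> R[i]) :
  (forall i, P i -> L2 (f i)) -> L2 (\sum_(i <- r | P i) f i).
Proof. by move=> Lf; apply: big_ind => //; [exact: L20|exact: L2D]. Qed.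

Lemma inner_lin (a : R[i]) f g h : L2 f -> L2 g -> L2 h ->
  inner (a *: f + g) h = a * inner f h + inner g h.
Proof.
move=> Lf Lg Lh; rewrite /inner.
rewrite -(cintegral_lin a (L2_cintegrable Lf Lh) (L2_cintegrable Lg Lh)).
by congr cintegral; apply/funext => x; rewrite fctE /= mulrDl mulrA.
Qed.

Lemma inner_conj f g : L2 f -> L2 g -> inner g f = (inner f g)^*%C.
Proof.
move=> Lf Lg; have [i1 i2] := L2_cintegrable Lf Lg.
apply: complex_ext; rewrite ?reimE /inner /cintegral /=.
  by apply: eq_Rintegral => x _; rewrite !reimE; ring.
rewrite -mulN1r -RintegralZl//.
by apply: eq_Rintegral => x _; rewrite !reimE; ring.
Qed.

Lemma inner0l f : inner 0 f = 0.
Proof.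
apply: complex_ext; rewrite /inner /cintegral /=;
  rewrite (@eq_Rintegral _ _ _ mu _ (cst 0)) ?Rintegral_cst ?mul0r// => x _;
  by rewrite mul0r.
Qed.

Lemma innerZl (a : R[i]) f g : L2 f -> L2 g -> inner (a *: f) g = a * inner f g.
Proof.
move=> Lf Lg; rewrite -[a *: f]addr0 inner_lin//; last exact: L20.
by rewrite inner0l addr0.
Qed.

Lemma innerDl f g h : L2 f -> L2 g -> L2 h ->
  inner (f + g) h = inner f h + inner g h.
Proof. by move=> Lf Lg Lh; rewrite -[f in LHS]scale1r inner_lin// mul1r. Qed.

Lemma innerBl f g h : L2 f -> L2 g -> L2 h ->
  inner (f - g) h = inner f h - inner g h.
Proof. by move=> Lf Lg Lh; rewrite addrC -scaleN1r inner_lin// mulN1r addrC. Qed.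

Lemma inner_suml (I : Type) (r : seq I) (P : pred I) (f : I -> X -> R[i]) g :
  (forall i, L2 (f i)) -> L2 g ->
  inner (\sum_(i <- r | P i) f i) g = \sum_(i <- r | P i) inner (f i) g.
Proof.
move=> Lf Lg; elim: r => [|i r IH]; first by rewrite !big_nil inner0l.
rewrite !big_cons; case: (P i) => //.
by rewrite innerDl// ?IH//; exact: L2_sum.
Qed.

Lemma innerZr (a : R[i]) f g : L2 f -> L2 g ->
  inner f (a *: g) = a^*%C * inner f g.
Proof.
move=> Lf Lg; rewrite (inner_conj (L2Z a Lg) Lf) innerZl// conjcM.
by rewrite -(inner_conj Lg Lf).
Qed.

Lemma innerDr f g h : L2 f -> L2 g -> L2 h ->
  inner h (f + g) = inner h f + inner h g.
Proof.
move=> Lf Lg Lh; rewrite (inner_conj (L2D Lf Lg) Lh) innerDl// conjcD.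
by rewrite -(inner_conj Lf Lh) -(inner_conj Lg Lh).
Qed.

Lemma innerBr f g h : L2 f -> L2 g -> L2 h ->
  inner h (f - g) = inner h f - inner h g.
Proof.
move=> Lf Lg Lh; rewrite (inner_conj (L2B Lf Lg) Lh) innerBl// conjcB.
by rewrite -(inner_conj Lf Lh) -(inner_conj Lg Lh).
Qed.

Lemma inner_sumr (I : Type) (r : seq I) (P : pred I) (f : I -> X -> R[i]) g :
  (forall i, L2 (f i)) -> L2 g ->
  inner g (\sum_(i <- r | P i) f i) = \sum_(i <- r | P i) inner g (f i).
Proof.
move=> Lf Lg; rewrite (inner_conj (L2_sum _ (fun i _ => Lf i)) Lg).
rewrite inner_suml// conjc_sum; apply: eq_bigr => i _.
by rewrite -(inner_conj (Lf i) Lg).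
Qed.

Lemma norm2_ge0 f : 0 <= norm2 f. Proof. exact: sqrtr_ge0. Qed.

Lemma norm2_sqr f : norm2 f ^+ 2 = fine (normsq f).
Proof. by rewrite sqr_sqrtr// fine_ge0// normsq_ge0. Qed.

Lemma normsq_norm2 f : L2 f -> normsq f = (norm2 f ^+ 2)%:E.
Proof.
by move=> [_ nf]; rewrite norm2_sqr fineK// ge0_fin_numE// normsq_ge0.
Qed.

Lemma inner_norm2 f : L2 f -> inner f f = (norm2 f ^+ 2)%:C.
Proof.
move=> Lf; rewrite norm2_sqr normsqE.
apply: complex_ext; rewrite ?ImZ; last first.
  rewrite /inner /cintegral /= (@eq_Rintegral _ _ _ mu _ (cst 0)) ?Rintegral_cst ?mul0r//.
  by move=> x _ /=; rewrite !reimE; ring.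
rewrite /inner /cintegral /=.
by apply: eq_Rintegral => x _; rewrite !reimE; ring.
Qed.

Lemma Re_inner f : L2 f -> Re (inner f f) = norm2 f ^+ 2.
Proof. by move=> Lf; rewrite inner_norm2. Qed.

Lemma norm2D_sqr f g : L2 f -> L2 g ->
  norm2 (f + g) ^+ 2 = norm2 f ^+ 2 + norm2 g ^+ 2 + 2 * Re (inner f g).
Proof.
move=> Lf Lg; have Lfg := L2D Lf Lg.
rewrite -!Re_inner// innerDl// !innerDr// (inner_conj Lf Lg) !reimE; ring.
Qed.

Lemma norm2Z (a : R[i]) f : L2 f -> norm2 (a *: f) = normc a * norm2 f.
Proof.
move=> Lf; apply/eqP; rewrite -(@eqrXn2 _ 2)//; last 2 first.
- exact: norm2_ge0.
- by rewrite mulr_ge0// ?normc_ge0// norm2_ge0.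
rewrite -Re_inner; last exact: L2Z.
rewrite innerZl//; last exact: L2Z.
rewrite innerZr// inner_norm2// exprMn normc_sqr.
by apply/eqP; rewrite !reimE; ring.
Qed.

(** Nonnegativity of the norm of [f - r <f, g> g] for all real [r] forces the
    discriminant of this quadratic polynomial in [r] to be nonpositive. *)
Lemma cauchy_schwarz f g : L2 f -> L2 g -> normc (inner f g) <= norm2 f * norm2 g.
Proof.
move=> Lf Lg; set c := inner f g.
have Q r : 0 <= norm2 f ^+ 2 - 2 * r * normc c ^+ 2
    + r ^+ 2 * normc c ^+ 2 * norm2 g ^+ 2.
  have Lcg := L2Z (- (r%:C * c)) Lg.
  have := sqr_ge0 (norm2 (f + (- (r%:C * c)) *: g)).
  rewrite norm2D_sqr// norm2Z// innerZr// -/c.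
  rewrite exprMn !normc_sqr !reimE; congr (0 <= _); ring.
rewrite -(@ler_pXn2r _ 2)// ?nnegrE ?normc_ge0//; last first.
  by rewrite mulr_ge0// norm2_ge0.
rewrite exprMn; move: Q; move: (sqr_ge0 (norm2 f)) (sqr_ge0 (norm2 g)).
move: (sqr_ge0 (normc c)) => /=.
move: (normc c ^+ 2) (norm2 f ^+ 2) (norm2 g ^+ 2) => C F G C0 F0 G0 Q.
have [->|C1] := eqVneq C 0; first by rewrite mulr_ge0.
have Cp : 0 < C by rewrite lt_def C1.
have [G1|G1] := eqVneq G 0.
  have := Q ((F + 1) / (2 * C)); rewrite G1 !mulr0 addr0.
  suff -> : F - 2 * ((F + 1) / (2 * C)) * C = -1 by lra.
  by field; rewrite C1.
have Gp : 0 < G by rewrite lt_def G1.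
have := Q G^-1; suff -> : F - 2 * G^-1 * C + G^-1 ^+ 2 * C * G = F - C / G.
  by rewrite subr_ge0 ler_pdivrMr.
by field.
Qed.

Lemma le_norm2D f g : L2 f -> L2 g -> norm2 (f + g) <= norm2 f + norm2 g.
Proof.
move=> Lf Lg; rewrite -(@ler_pXn2r _ 2)// ?nnegrE ?norm2_ge0//; last first.
  by rewrite addr_ge0// norm2_ge0.
rewrite norm2D_sqr// sqrrD -mulr_natr.
have := cauchy_schwarz Lf Lg; have := Re_le_normc (inner f g).
have := ler_norm (Re (inner f g)); lra.
Qed.

Lemma le_norm2B f g : L2 f -> L2 g -> `|norm2 f - norm2 g| <= norm2 (f - g).
Proof.
move=> Lf Lg; have Lfg := L2B Lf Lg.
have A := le_norm2D Lfg Lg; rewrite subrK in A.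
have B := le_norm2D (L2Z (-1) Lfg) Lf.
rewrite scaleN1r opprB subrK -opprB -scaleN1r norm2Z// in B.
have E : normc (-1 : R[i]) = 1 by rewrite normcN (normc_real 1) normr1.
rewrite E mul1r in B; rewrite ler_norml; lra.
Qed.

Lemma inner_norm0l f g : L2 f -> L2 g -> norm2 f = 0 -> inner f g = 0.
Proof.
move=> Lf Lg f0; have := cauchy_schwarz Lf Lg; rewrite f0 mul0r => c0.
by apply: Normc.eq0_normc; apply/eqP; rewrite eq_le c0 normc_ge0.
Qed.

(** ** Functions which agree almost everywhere *)

(** The functions need not be measurable: a simple function below [p] is compared
    with [q] after it has been cut off on the exceptional set. *)
Lemma ge0_ae_le_integral (p q : X -> \bar R) :
  (forall x, 0 <= p x)%E -> (forall x, 0 <= q x)%E ->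
  p = q %[ae mu] -> (\int[mu]_x p x <= \int[mu]_x q x)%E.
Proof.
move=> p0 q0 [N [mN N0 pqN]].
rewrite ge0_integralTE// ge0_integralTE//.
apply: ge_ereal_sup => _ /= [k kp <-].
pose k' := proj_nnsfun k (measurableC mN).
have k'E x : k' x = k x * \1_(~` N) x by [].
have -> : sintegral mu k = sintegral mu k'.
  rewrite -!integralT_nnsfun; apply: ge0_ae_eq_integral => //.
  - by apply/measurable_EFinP.
  - by apply/measurable_EFinP.
  - by move=> x _; rewrite lee_fin.
  - by move=> x _; rewrite lee_fin.
  exists N; split => // x /= h; apply: contrapT => Nx; apply: h => _.
  by rewrite /= /mindic indicE mem_set// mulr1.
apply: ereal_sup_ubound; exists k' => // x /=; rewrite /mindic indicE.
have [Nx|Nx] := pselect (N x).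
  by rewrite memNset//= ?mulr0//; apply.
rewrite mem_set//= mulr1; apply: le_trans (kp x) _.
have [->//|pq] := eqVneq (p x) (q x).
by exfalso; apply: Nx; apply: pqN => /= /(_ I) /eqP; rewrite (negPf pq).
Qed.

Lemma normsq_ae f g : f = g %[ae mu] -> normsq f = normsq g.
Proof.
move=> fg; apply/eqP; rewrite eq_le.
by apply/andP; split; apply: ge0_ae_le_integral => [x|x|];
  rewrite ?lee_fin ?sqr_ge0//; apply: filterS fg => x /[apply] ->.
Qed.

Lemma norm2_ae f g : f = g %[ae mu] -> norm2 f = norm2 g.
Proof. by move=> /normsq_ae fg; rewrite /Defs.norm2 fg. Qed.

Lemma norm2_eq0_ae f : L2 f -> norm2 f = 0 -> f = 0 %[ae mu].
Proof.
move=> Lf f0; have := normsq_norm2 Lf; rewrite f0 expr0n /= normsqE.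
have [mf _] := Lf.
move=> I0; have : ae_eq mu setT
    (fun x => (Re (f x) ^+ 2 + Im (f x) ^+ 2)%:E) (cst 0%E).
  apply/(ae_eq_integral_abs mu measurableT).
    by apply/measurable_EFinP; exact: measurable_sq.
  etransitivity; last exact: I0.
  apply: eq_integral => x _.
  by rewrite gee0_abs// lee_fin addr_ge0// sqr_ge0.
apply: filterS => x /[apply] /= [[]] /eqP.
rewrite paddr_eq0 ?sqr_ge0// !sqrf_eq0 => /andP[/eqP a /eqP b].
exact: complex_ext.
Qed.

Lemma norm2_sub_ae f g : L2 f -> L2 g -> norm2 (f - g) = 0 -> f = g %[ae mu].
Proof.
move=> Lf Lg /(norm2_eq0_ae (L2B Lf Lg)); apply: filterS => x /[apply] /eqP.
by rewrite fctE /= subr_eq0 => /eqP.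
Qed.

Lemma norm2_0 : norm2 0 = 0.
Proof. by apply/eqP; rewrite -sqrf_eq0 -(Re_inner L20) inner0l. Qed.

Lemma inner_ae_l f f' g : L2 f -> L2 f' -> L2 g ->
  f = f' %[ae mu] -> inner f g = inner f' g.
Proof.
move=> Lf Lf' Lg ff; apply/eqP; rewrite -subr_eq0 -innerBl//; apply/eqP.
apply: inner_norm0l => //; first exact: L2B.
rewrite -[RHS]norm2_0; apply: norm2_ae; apply: filterS ff => x /[apply].
by rewrite fctE /= => ->; rewrite subrr.
Qed.

Lemma inner_ae_r f g g' : L2 f -> L2 g -> L2 g' ->
  g = g' %[ae mu] -> inner f g = inner f g'.
Proof.
move=> Lf Lg Lg' gg; rewrite (inner_conj Lg Lf) (inner_conj Lg' Lf).
by rewrite (inner_ae_l _ _ _ gg).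
Qed.

Lemma inner_ae f f' g g' : L2 f -> L2 f' -> L2 g -> L2 g' ->
  f = f' %[ae mu] -> g = g' %[ae mu] -> inner f g = inner f' g'.
Proof.
by move=> Lf Lf' Lg Lg' ff gg; rewrite (inner_ae_l _ _ _ ff)// (inner_ae_r _ _ _ gg).
Qed.

(** ** Hilbert-Schmidt norms of operators of finite rank *)

Section HilbertSchmidt.
Variable e : nat -> X -> R[i].
Hypothesis e_basis : orthonormal_basis mu e.

Let Le n : L2 (e n). Proof. by have [] := e_basis. Qed.

(** The partial sums are the inner products of [g] with the partial expansions of
    [f] in the basis. *)
Lemma parseval f g : L2 f -> L2 g ->
  ccvg \oo (fun n => \sum_(k < n) inner f (e k) * inner (e k) g) (inner f g).
Proof.
move=> Lf Lg; apply: ccvg_normc.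
have [_ _ /(_ _ Lf) cvf] := e_basis.
have Ls n : L2 (\sum_(k < n) inner f (e k) *: e k).
  by apply: L2_sum => k _; exact: L2Z.
apply: (@squeeze_cvgr _ _ _ _ (fun=> 0)
  (fun n => norm2 (f - \sum_(k < n) inner f (e k) *: e k) * norm2 g)).
- apply: nearW => n; rewrite normc_ge0/=.
  have -> : \sum_(k < n) inner f (e k) * inner (e k) g =
      inner (\sum_(k < n) inner f (e k) *: e k) g.
    rewrite inner_suml//; last by move=> k; exact: L2Z.
    by apply: eq_bigr => k _; rewrite innerZl.
  rewrite -[X in normc X]opprB (normcN) -innerBl//.
  by apply: cauchy_schwarz => //; exact: L2B.
- exact: cvg_cst.
- rewrite -[X in _ --> X](mul0r (norm2 g)).
  by apply: cvgM => //; exact: cvg_cst.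
Qed.

(** The trace of [T^* T] for [T = \sum_a c a <., x a> y a]. *)
Definition hs_sqr (I : finType) (c : I -> R[i]) (x y : I -> X -> R[i]) : R[i] :=
  \sum_(a : I) \sum_(b : I)
    c a * (c b)^*%C * inner (y a) (y b) * inner (x b) (x a).

(** Each [||T e_n||^2] is a finite combination of products
    [<x b, e_n> <e_n, x a>], which Parseval's identity sums over [n]. *)
Lemma hs_norm_finite_rank (I : finType) (c : I -> R[i]) (x y : I -> X -> R[i])
    (T : (X -> R[i]) -> X -> R[i]) :
  (forall a, L2 (x a)) -> (forall a, L2 (y a)) ->
  (forall n, T (e n) = \sum_(a : I) (c a * inner (e n) (x a)) *: y a %[ae mu]) ->
  hs_norm mu e T = (Num.sqrt (Re (hs_sqr c x y)))%:E.
Proof.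
move=> Lx Ly TE.
pose t n := \sum_(a : I) \sum_(b : I)
  c a * (c b)^*%C * inner (y a) (y b) * (inner (x b) (e n) * inner (e n) (x a)).
have nE n : normsq (T (e n)) = (Re (t n))%:E.
  rewrite (normsq_ae (TE n)).
  have LT : L2 (\sum_(a : I) (c a * inner (e n) (x a)) *: y a).
    by apply: L2_sum => a _; exact: L2Z.
  rewrite (normsq_norm2 LT) -(Re_inner LT); congr ((Re _)%:E).
  rewrite inner_suml//; last by move=> a; exact: L2Z.
  apply: eq_bigr => a _; rewrite inner_sumr//; last 2 first.
  - by move=> b; exact: L2Z.
  - exact: L2Z.
  apply: eq_bigr => b _; rewrite innerZr//; last exact: L2Z.
  rewrite innerZl// conjcM -(inner_conj (Le n) (Lx b)); ring.
have sE N : (\sum_(0 <= n < N) normsq (T (e n)))%E = (Re (\sum_(n < N) t n))%:E.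
  rewrite Re_sum -sumEFin big_mkord; apply: eq_bigr => n _; exact: nE.
have lims : (\sum_(0 <= n <oo) normsq (T (e n)))%E = (Re (hs_sqr c x y))%:E.
  apply/cvg_lim => //.
  rewrite (_ : (fun N => _) = EFin \o (fun N => Re (\sum_(n < N) t n))); last first.
    by apply/funext => N /=; rewrite sE.
  apply: cvg_EFin; first by apply: nearW.
  suff : ccvg \oo (fun N => \sum_(n < N) t n) (hs_sqr c x y) by case.
  have -> : (fun N => \sum_(n < N) t n) = fun N => \sum_(a : I) \sum_(b : I)
      c a * (c b)^*%C * inner (y a) (y b)
      * \sum_(n < N) inner (x b) (e n) * inner (e n) (x a).
    apply/funext => N; rewrite exchange_big; apply: eq_bigr => a _.
    rewrite exchange_big; apply: eq_bigr => b _.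
    by rewrite mulr_sumr.
  apply: ccvg_sum => a; apply: ccvg_sum => b; apply: ccvgM; first exact: ccvg_cst.
  exact: parseval.
rewrite /hs_norm lims poweR_EFin powR12_sqrt//.
rewrite -lee_fin -lims; apply: nneseries_ge0 => n _ _; exact: normsq_ge0.
Qed.

End HilbertSchmidt.
End HilbertSpace.

(** * Integration in polar coordinates *)

Section SigmaFiniteProduct.
Context d1 d2 (T1 : measurableType d1) (T2 : measurableType d2) (R : realType).
Variables (m1 : {sigma_finite_measure set T1 -> \bar R})
  (m2 : {sigma_finite_measure set T2 -> \bar R}).

(** A name for the product measure to which the structure of a sigma-finite
    measure is attached, so that Tonelli's theorem can be applied to it again. *)
Definition sfprod : set (T1 * T2) -> \bar R := (m1 \x m2)%E.

HB.instance Definition _ := Measure.on sfprod.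

Let sfprod_sigma_finite : sigma_finite [set: T1 * T2] sfprod.
Proof.
have /sigma_finiteP[F [TF ndF Foo]] := sigma_finiteT m1.
have /sigma_finiteP[G [TG ndG Goo]] := sigma_finiteT m2.
exists (fun n => F n `*` G n).
  rewrite -setXTT TF TG predeqE => -[x y]; split => [[[n _ Fx] [k _ Gy]]|].
    exists (maxn n k) => //; split.
      exact: (subsetPset _ _ (ndF _ _ (leq_maxl n k))).
    exact: (subsetPset _ _ (ndG _ _ (leq_maxr n k))).
  by move=> [n _ [/= Fx Gy]]; split; exists n.
move=> k; have [mF Fk] := Foo k; have [mG Gk] := Goo k.
split; first exact: measurableX.
rewrite /sfprod product_measure1E// lte_mul_pinfty//.
by rewrite ge0_fin_numE.
Qed.

HB.instance Definition _ := Measure_isSigmaFinite.Build _ _ _ sfprod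
  sfprod_sigma_finite.

End SigmaFiniteProduct.

Lemma integral_mrestr d (T : measurableType d) (R : realType)
    (mu : {measure set T -> \bar R}) (D : set T) (mD : measurable D)
    (f : T -> \bar R) :
  measurable_fun [set: T] f -> (forall x, 0 <= f x)%E ->
  (\int[mrestr mu mD]_x f x = \int[mu]_x ((\1_D x)%:E * f x))%E.
Proof.
move=> mf f0.
rewrite [LHS](@ge0_negligible_integral _ _ _ _ setT (~` D))//; last 2 first.
- exact: measurableC.
- by rewrite /= /mrestr setICl measure0.
rewrite setTD setCK (eq_measure_integral mu); last first.
  by move=> A mA AB; rewrite /= /mrestr setIidl.
rewrite integral_mkcond; apply: eq_integral => x _.
by rewrite patchE indicE; case: ifPn => xB; rewrite ?mul1e ?mul0e.
Qed.

Section Scaling.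
Variable R : realType.
Local Notation mu1 := (@lebesgue_measure R).

(** Lebesgue measure agrees on intervals with [c] times its image under the
    dilation by [c]. *)
Lemma integral_scale1 (c : R) (f : R -> \bar R) : 0 < c ->
  measurable_fun [set: R] f -> (forall x, 0 <= f x)%E ->
  (\int[mu1]_x f x = c%:E * \int[mu1]_x f (c * x)%R)%E.
Proof.
move=> c0 mf f0.
have mc : measurable_fun [set: measurableTypeR R]
    (fun x : measurableTypeR R => c * x : measurableTypeR R).
  exact: measurable_funM.
pose m : {measure set (measurableTypeR R) -> \bar R} :=
  mscale (NngNum (ltW c0))
    (measure_function_pushforward__canonical__measure_function_Measure mu1 mc).
have mE A : measurable A -> mu1 A = m A.
  apply: lebesgue_measure_unique => _ [[a b]] _ <-.
  change (mu1 `]a, b] = c%:E * mu1 ((fun x : R => (c * x)%R) @^-1` `]a, b]))%E.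
  rewrite [X in (_ * mu1 X)%E](_ : _ = `](a / c), (b / c)]%classic); last first.
    apply/seteqP; split => x /=; rewrite !in_itv/=;
      by rewrite ltr_pdivrMr// ler_pdivlMr// mulrC.
  rewrite !lebesgue_measure_itv/= !lte_fin ltr_pM2r ?invr_gt0//.
  case: ifPn => _; last by rewrite mule0.
  by rewrite -!EFinB -EFinM -mulrBl mulrCA divff ?mulr1// gt_eqF.
rewrite (eq_measure_integral m) => [|A mA _]; last exact: mE.
rewrite /m ge0_integral_mscale//=.
by rewrite ge0_integral_pushforward.
Qed.

Lemma integral_scale_prod d1 d2 (T1 : measurableType d1) (T2 : measurableType d2)
    (m1 : {sigma_finite_measure set T1 -> \bar R})
    (m2 : {sigma_finite_measure set T2 -> \bar R})
    (h1 : T1 -> T1) (h2 : T2 -> T2) (c1 c2 : R) :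
  0 <= c1 -> 0 <= c2 ->
  measurable_fun [set: T1] h1 -> measurable_fun [set: T2] h2 ->
  (forall f, measurable_fun [set: T1] f -> (forall x, 0 <= f x)%E ->
    (\int[m1]_x f x = c1%:E * \int[m1]_x f (h1 x))%E) ->
  (forall f, measurable_fun [set: T2] f -> (forall x, 0 <= f x)%E ->
    (\int[m2]_x f x = c2%:E * \int[m2]_x f (h2 x))%E) ->
  forall f, measurable_fun [set: T1 * T2] f -> (forall x, 0 <= f x)%E ->
  (\int[m1 \x m2]_x f x =
     (c1 * c2)%:E * \int[m1 \x m2]_x f (h1 x.1, h2 x.2))%E.
Proof.
move=> c10 c20 mh1 mh2 H1 H2 f mf f0.
have m12 : measurable_fun [set: T1 * T2] (fun x => f (x.1, h2 x.2)).
  apply: (measurableT_comp mf); apply: measurable_fun_pair => //.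
  exact: (measurableT_comp mh2).
have m12' : measurable_fun [set: T1 * T2] (fun x => f (h1 x.1, h2 x.2)).
  apply: (measurableT_comp mf); apply: measurable_fun_pair => //.
    exact: (measurableT_comp mh1).
  exact: (measurableT_comp mh2).
rewrite fubini_tonelli1// fubini_tonelli1//= /fubini_F.
rewrite (eq_integral (fun x => c2%:E * \int[m2]_y f (x, h2 y))%E); last first.
  move=> x _; rewrite (H2 (fun y => f (x, y)))//.
  exact: measurableT_comp mf (measurable_fun_pair _ _).
rewrite ge0_integralZl_EFin//; last 2 first.
- by move=> x _; apply: integral_ge0.
- exact: (measurable_fun_fubini_tonelli_F (fun x => f (x.1, h2 x.2))).
rewrite (H1 (fun x => \int[m2]_y f (x, h2 y))%E); last 2 first.
- exact: (measurable_fun_fubini_tonelli_F (fun x => f (x.1, h2 x.2))).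
- by move=> x; apply: integral_ge0.
by rewrite muleA -EFinM mulrC.
Qed.

End Scaling.

Section Polar.
Variable R : realType.
Local Notation mu1 := (@lebesgue_measure R).
Local Notation E3 := (R3 R).
Implicit Types x y : E3.

Lemma measurable_scale3 d (T : measurableType d) (c : T -> R) (f : T -> E3) :
  measurable_fun [set: T] c -> measurable_fun [set: T] f ->
  measurable_fun [set: T] (fun t => scale3 (c t) (f t)).
Proof.
move=> mc mf.
have m1 := measurableT_comp (measurable_fst) mf.
have m11 := measurableT_comp (measurable_fst) m1.
have m12 := measurableT_comp (measurable_snd) m1.
have m2 := measurableT_comp (measurable_snd) mf.
by apply: measurable_fun_pair; [apply: measurable_fun_pair|];
  apply: measurable_funM.
Qed.

Lemma measurable_dot3 : measurable_fun [set: E3] (fun x => dot3 x x).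
Proof.
have m1 := (measurable_fst : measurable_fun [set: E3] fst).
have m11 := measurableT_comp (measurable_fst) m1.
have m12 := measurableT_comp (measurable_snd) m1.
have m2 := (measurable_snd : measurable_fun [set: E3] snd).
by apply: measurable_funD; [apply: measurable_funD|]; exact: measurable_funM.
Qed.

Lemma dot3_ge0 x : 0 <= dot3 x x.
Proof. by rewrite /dot3 !addr_ge0// -expr2 sqr_ge0. Qed.

Lemma dot3_scale (c : R) x :
  dot3 (scale3 c x) (scale3 c x) = c ^+ 2 * dot3 x x.
Proof. by rewrite /dot3 /scale3 /=; ring. Qed.

Lemma scale3A (a b : R) x : scale3 a (scale3 b x) = scale3 (a * b) x.
Proof. by rewrite /scale3 /= !mulrA. Qed.

Lemma scale31 x : scale3 1 x = x.
Proof. by case: x => [[a b] c]; rewrite /scale3 /= !mul1r. Qed.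

Lemma directionE x : direction x = scale3 (dot3 x x `^ (- 2^-1)) x.
Proof. by rewrite /direction /norm3 powRN powR12_sqrt// dot3_ge0. Qed.

Lemma integral_scale3 (c : R) (f : E3 -> \bar R) : 0 < c ->
  measurable_fun [set: E3] f -> (forall x, 0 <= f x)%E ->
  (\int[leb3 R]_x f x = (c ^+ 3)%:E * \int[leb3 R]_x f (scale3 c x))%E.
Proof.
move=> c0 mf f0.
have mc : measurable_fun [set: measurableTypeR R]
    (fun x : measurableTypeR R => c * x : measurableTypeR R).
  exact: measurable_funM.
pose leb1 : {sigma_finite_measure set (measurableTypeR R) -> \bar R} := mu1.
have S1 (g : measurableTypeR R -> \bar R) : measurable_fun setT g ->
    (forall t, 0 <= g t)%E ->
    (\int[leb1]_x g x = c%:E * \int[leb1]_x g (c * x)%R)%E.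
  by move=> mg g0; exact: integral_scale1.
pose h2 (x : measurableTypeR R * measurableTypeR R) :
  measurableTypeR R * measurableTypeR R := (c * x.1, c * x.2).
have mc2 : measurable_fun [set: measurableTypeR R * measurableTypeR R] h2.
  by apply: measurable_fun_pair; apply: (measurableT_comp mc).
have S2 := @integral_scale_prod R _ _ (measurableTypeR R) (measurableTypeR R)
  leb1 leb1 _ _ c c (ltW c0) (ltW c0) mc mc S1 S1.
have S3 := @integral_scale_prod R _ _
  (measurableTypeR R * measurableTypeR R)%type (measurableTypeR R)
  (sfprod leb1 leb1) leb1 h2 _ (c * c) c
  (mulr_ge0 (ltW c0) (ltW c0)) (ltW c0) mc2 mc S2 S1.
have -> : c ^+ 3 = c * c * c by ring.
exact: S3.
Qed.

(** The weight of a dilation, [int_q^oo (3/2) t^(-5/2) dt = q^(-3/2)]. *)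
Lemma integral_tail (q : R) : 0 < q ->
  (\int[mu1]_(t in `[q, +oo[) (3 / 2 * t `^ (- (5 / 2)))%:E
   = (q `^ (- (3 / 2)))%:E)%E.
Proof.
move=> q0.
have D (t : R) : 0 < t -> is_derive t 1 (fun u : R => - u `^ (- (3 / 2)))
    (3 / 2 * t `^ (- (5 / 2))).
  move=> t0; have := is_derive1_powR (- (3 / 2)) t0.
  have -> : - (3 / 2) - 1 = - (5 / 2) :> R by field.
  by move=> dt; apply: is_derive_eq; rewrite mulNr opprK.
rewrite (@ge0_continuous_FTC2y _ _ (fun u => - u `^ (- (3 / 2))) q 0).
- by rewrite -EFinN opprK add0e.
- by move=> t qt; rewrite mulr_ge0 ?powR_ge0// divr_ge0.
- apply: continuous_in_subspaceT => t; rewrite inE/= in_itv/= andbT => qt.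
  apply: cvgM; first exact: cvg_cst.
  have t0 : 0 < t by exact: lt_le_trans qt.
  have := is_derive1_powR (- (5 / 2)) t0 => -[/derivable1_diffP dt _].
  exact: (differentiable_continuous dt).
- rewrite -oppr0; apply: cvgN.
  apply: (@squeeze_cvgr _ _ _ _ (fun=> 0) (fun t => t^-1)).
  + near=> t; have t1 : 1 <= t by near: t; exact: nbhs_pinfty_ge.
    have t0 : 0 <= t by exact: le_trans t1.
    rewrite powR_ge0/= -[leRHS](powR_inv1 t0).
    by apply: ler_powR => //; lra.
  + exact: cvg_cst.
  + by apply/gtr0_cvgV0; [exact: nbhs_pinfty_gt|exact: cvg_id].
- by move=> t qt; have [] := D _ (lt_trans q0 qt).
- apply: cvg_at_right_filter.
  have [/derivable1_diffP dt _] := D _ q0.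
  exact: (differentiable_continuous dt).
- move=> t; rewrite in_itv/= andbT => qt.
  by rewrite derive1E; have [_ ->] := D _ (lt_trans q0 qt).
Unshelve. all: end_near. Qed.

Lemma integral_surface (f : E3 -> \bar R) :
  measurable_fun [set: E3] f -> (forall x, 0 <= f x)%E ->
  (\int[surface R]_w f w =
     3%:E * \int[leb3 R]_x ((\1_(@unit_ball R) x)%:E * f (direction x)))%E.
Proof.
move=> mf f0.
pose m : {measure set E3 -> \bar R} :=
  mscale (NngNum (ler0n R 3))
    (measure_function_pushforward__canonical__measure_function_Measure
      (mrestr (leb3 R) (@measurable_unit_ball R)) (@measurable_direction R)).
rewrite (eq_measure_integral m) => [|A mA _]; last by [].
rewrite ge0_integral_mscale; [|exact: measurableT|exact: mf|by []].
rewrite -[(NngNum (ler0n R 3))%:num%:E]/(3%:E).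
apply: (f_equal (fun z => 3%:E * z)%E).
rewrite (@ge0_integral_pushforward _ _ _ _ _ _ (@measurable_direction R) _ setT f
  measurableT mf (fun x _ => f0 x)).
rewrite preimage_setT integral_mrestr//.
  exact: measurableT_comp mf (@measurable_direction R).
by move=> x; exact: f0.
Qed.

Lemma leb3_origin : leb3 R [set x | dot3 x x = 0] = 0%E.
Proof.
have -> : [set x : E3 | dot3 x x = 0] = ([set 0] `*` [set 0]) `*` [set 0].
  apply/seteqP; split => [[[a b] c]|[[a b] c]] /=.
    rewrite /dot3 /= => /eqP.
    rewrite paddr_eq0 ?addr_ge0// -?expr2 ?sqr_ge0//.
    by rewrite paddr_eq0 ?sqr_ge0// !sqrf_eq0 => /andP[/andP[/eqP -> /eqP ->] /eqP ->].
  by move=> [[-> ->] ->]; rewrite /dot3 /= mul0r !addr0.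
rewrite -[LHS]/(((mu1 \x mu1) \x mu1)%E _) product_measure1E//; last first.
  exact: measurableX.
by rewrite [X in (_ * X)%E](lebesgue_measure_set1 (0 : R)) mule0.
Qed.

Let sf3 := sfprod (sfprod mu1 mu1) mu1.

Let tonelli (f : measurableTypeR R * E3 -> \bar R) :
  measurable_fun [set: measurableTypeR R * E3] f -> (forall z, 0 <= f z)%E ->
  (\int[mu1]_t \int[leb3 R]_x f (t, x) = \int[leb3 R]_x \int[mu1]_t f (t, x))%E.
Proof. by move=> mf f0; exact: (@fubini_tonelli _ _ _ _ _ mu1 sf3 f mf f0). Qed.

Local Notation pos := [set t : R | 0 < t].

Let mpos : measurable (pos : set (measurableTypeR R)).
Proof.
rewrite (_ : pos = `]0, +oo[%classic); first exact: measurable_itv.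
by apply/seteqP; split => x /=; rewrite in_itv/= andbT.
Qed.

Let mfst : measurable_fun [set: measurableTypeR R * E3] (fun z => z.1 : R).
Proof. exact: measurable_fst. Qed.

Let msnd : measurable_fun [set: measurableTypeR R * E3] snd.
Proof. exact: measurable_snd. Qed.

Let mpow (p : R) d (T : measurableType d) (f : T -> R) :
  measurable_fun [set: T] f -> measurable_fun [set: T] (fun t => f t `^ p).
Proof. by move=> mf; exact: measurableT_comp (measurable_powR p) mf. Qed.

Let mind d (T : measurableType d) d' (U : measurableType d') (A : set U)
    (f : T -> U) : measurable A -> measurable_fun [set: T] f ->
  measurable_fun [set: T] (fun t => \1_A (f t) : R).
Proof. by move=> mA mf; exact: measurableT_comp (measurable_indic _) mf. Qed.

Let powR_D (t a b : R) : 0 < t -> t `^ (a + b) = t `^ a * t `^ b.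
Proof. by move=> t0; rewrite powRD// (gt_eqF t0) implybT. Qed.

Lemma unit_ballP x : unit_ball x <-> 0 < dot3 x x <= 1.
Proof.
rewrite /unit_ball /= /norm3 sqrtr_gt0.
by rewrite -[X in _ <= X]sqrtr1 ler_psqrt// ?nnegrE ?dot3_ge0.
Qed.

(** Both sides are integrals over pairs of a dilation and a point. Writing the
    point [w] of the sphere as the direction of a point [x] of the unit ball and
    substituting [lam = t |x|^2], then [y = sqrt t x], turns the right-hand side
    into the integral of [f y] against a weight which integrates to [1]. *)
Theorem polar_integral (f : E3 -> \bar R) :
  measurable_fun [set: E3] f -> (forall x, 0 <= f x)%E ->
  (\int[leb3 R]_x f x = \int[mu1]_l ((\1_pos l * (2^-1 * l `^ 2^-1))%:E *
     \int[surface R]_w f (scale3 (l `^ 2^-1) w)))%E.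
Proof.
move=> mf f0.
pose q x := dot3 x x.
have mq : measurable_fun [set: E3] q by exact: measurable_dot3.
have mq2 : measurable_fun [set: measurableTypeR R * E3] (fun z => q z.2).
  exact: measurableT_comp mq msnd.
have mB := @measurable_unit_ball R.
pose G (z : measurableTypeR R * E3) : \bar R :=
  ((3 * (\1_pos z.1 * (2^-1 * z.1 `^ 2^-1)) * \1_(@unit_ball R) z.2)%:E
   * f (scale3 (z.1 `^ 2^-1 * q z.2 `^ (- 2^-1)) z.2))%E.
have mG : measurable_fun [set: measurableTypeR R * E3] G.
  apply: emeasurable_funM.
    apply/measurable_EFinP; apply: measurable_funM; last exact: mind.
    apply: measurable_funM => //; apply: measurable_funM; first exact: mind.
    by apply: measurable_funM => //; exact: mpow.
  apply: (measurableT_comp mf); apply: measurable_scale3 => //.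
  by apply: measurable_funM; exact: mpow.
have G0 z : (0 <= G z)%E.
  by rewrite mule_ge0// lee_fin !mulr_ge0// ?powR_ge0 ?invr_ge0.
pose H (z : measurableTypeR R * E3) : \bar R :=
  ((3 * (\1_pos z.1 * (2^-1 * z.1 `^ 2^-1)) * q z.2 `^ (3 / 2)
     * \1_(@unit_ball R) z.2)%:E * f (scale3 (z.1 `^ 2^-1) z.2))%E.
have mH : measurable_fun [set: measurableTypeR R * E3] H.
  apply: emeasurable_funM.
    apply/measurable_EFinP; apply: measurable_funM; last exact: mind.
    apply: measurable_funM; last exact: mpow.
    apply: measurable_funM => //; apply: measurable_funM; first exact: mind.
    by apply: measurable_funM => //; exact: mpow.
  by apply: (measurableT_comp mf); apply: measurable_scale3 => //; exact: mpow.
have H0 z : (0 <= H z)%E.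
  by rewrite mule_ge0// lee_fin !mulr_ge0// ?powR_ge0 ?invr_ge0.
pose A := [set z : measurableTypeR R * E3 | 0 < q z.2 <= z.1].
have mA : measurable A.
  rewrite (_ : A = (fun z => q z.2) @^-1` `]0, +oo[ `&`
    (fun z : measurableTypeR R * E3 => z.1 - q z.2) @^-1` `[0, +oo[).
    apply: measurableI; rewrite -[X in measurable X]setTI.
      by apply: mq2 => //; exact: measurable_itv.
    apply: (measurable_funB mfst mq2) => //; exact: measurable_itv.
  apply/seteqP; split => z /=; rewrite !in_itv/= !andbT subr_ge0.
    by move=> /andP.
  by move=> [a b]; apply/andP.
pose K (z : measurableTypeR R * E3) : \bar R :=
  ((q z.2 `^ (3 / 2) * (3 / 2 * z.1 `^ (- (5 / 2))) * \1_A z)%:E * f z.2)%E.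
have mK : measurable_fun [set: measurableTypeR R * E3] K.
  apply: emeasurable_funM; last exact: (measurableT_comp mf).
  apply/measurable_EFinP; apply: measurable_funM => //.
  by apply: measurable_funM; [exact: mpow|apply: measurable_funM => //; exact: mpow].
have K0 z : (0 <= K z)%E.
  by rewrite mule_ge0// lee_fin !mulr_ge0// ?powR_ge0 ?invr_ge0.
transitivity (\int[mu1]_t \int[leb3 R]_x G (t, x))%E; last first.
  apply: eq_integral => t _; rewrite integral_surface; last 2 first.
  - by apply: (measurableT_comp mf); exact: measurable_scale3.
  - by [].
  rewrite muleA -EFinM -ge0_integralZl_EFin//; last 3 first.
  - by move=> x _; rewrite mule_ge0// lee_fin.
  - apply: emeasurable_funM; first by apply/measurable_EFinP.
    apply: (measurableT_comp mf); apply: measurable_scale3 => //.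
    exact: measurable_direction.
  - by rewrite !mulr_ge0// ?powR_ge0 ?invr_ge0.
  apply: eq_integral => x _; rewrite /G /= muleA -EFinM directionE scale3A.
  by congr ((_)%:E * _)%E; ring.
rewrite tonelli//.
transitivity (\int[leb3 R]_x \int[mu1]_t H (t, x))%E; last first.
  apply: eq_integral => x _.
  have [xB|xB] := pselect (unit_ball x); last first.
    apply: eq_integral => t _; rewrite /H /G /= !indicE (memNset (A := @unit_ball R))//.
    by rewrite !mulr0 !mul0e.
  have q0 : 0 < q x by move/unit_ballP : xB => /andP[].
  rewrite [RHS](integral_scale1 q0); last 2 first.
  - by exact: measurableT_comp mG (measurable_fun_pair _ _).
  - by [].
  rewrite -ge0_integralZl_EFin//; last 2 first.
  - by apply: (measurableT_comp mG); apply: measurable_fun_pair => //; exact: measurable_funM.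
  - exact: ltW.
  apply: eq_integral => t _; rewrite /H /G /= muleA -EFinM.
  rewrite !indicE (_ : (q x * t \in pos) = (t \in pos)); last first.
    by apply/idP/idP; rewrite !inE/= pmulr_rgt0.
  have [t0|t0] := boolP (t \in pos); last by rewrite !(mul0r, mulr0) !mul0e.
  rewrite inE/= in t0.
  rewrite powRM ?(ltW q0) ?(ltW t0)//.
  have E : q x `^ 2^-1 * q x `^ (- 2^-1) = 1.
    by rewrite -powR_D// subrr powRr0.
  congr ((_)%:E * f (scale3 _ _))%E; last by rewrite mulrAC E mul1r.
  have -> : 3 / 2 = 1 + 2^-1 :> R by field.
  rewrite powR_D// powRr1 ?(ltW q0)//; ring.
rewrite -tonelli//.
transitivity (\int[mu1]_t \int[leb3 R]_x K (t, x))%E; last first.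
  apply: eq_integral => t _.
  have [t0|t0] := ltP 0 t; last first.
    apply: eq_integral => x _; rewrite /K /H /= !indicE.
    rewrite (memNset (A := pos)); last by apply/negP; rewrite -leNgt.
    rewrite (memNset (A := A)); last first.
      by move=> /= /andP[a b]; move: (lt_le_trans a b); rewrite ltNge t0.
    by rewrite !(mul0r, mulr0) !mul0e.
  have s0 : 0 < t `^ (- 2^-1) by exact: powR_gt0.
  rewrite [RHS](integral_scale3 s0); last 2 first.
  - exact: measurableT_comp mH (measurable_fun_pair _ _).
  - by [].
  rewrite -ge0_integralZl_EFin//; last 2 first.
  - apply: (measurableT_comp mH); apply: measurable_fun_pair => //.
    exact: measurable_scale3.
  - by rewrite exprn_ge0// ltW.
  apply: eq_integral => x _; rewrite /K /H /= muleA -EFinM scale3A.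
  have E : t `^ 2^-1 * t `^ (- 2^-1) = 1.
    by rewrite -powR_D// subrr powRr0.
  rewrite E scale31; congr ((_)%:E * _)%E.
  have E2 : (t `^ (- 2^-1)) ^+ 2 = t^-1.
    rewrite -powR_mulrn ?powR_ge0// -powRrM mulNr mulVf ?pnatr_eq0//.
    by rewrite powR_inv1// ltW.
  have qs : q (scale3 (t `^ (- 2^-1)) x) = t^-1 * q x.
    by rewrite /q dot3_scale E2.
  rewrite qs !indicE (mem_set (A := pos))// mul1r.
  have -> : (scale3 (t `^ (- 2^-1)) x \in @unit_ball R) = ((t, x) \in A).
    have tV : 0 < t^-1 by rewrite invr_gt0.
    apply/idP/idP; rewrite !inE.
      by move=> /unit_ballP; rewrite -/(q _) qs pmulr_rgt0// mulrC ler_pdivrMr// mul1r.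
    move=> xA; apply/unit_ballP; rewrite -/(q _) qs pmulr_rgt0//.
    by rewrite mulrC ler_pdivrMr// mul1r.
  rewrite powRM; [|by rewrite invr_ge0 ltW|exact: dot3_ge0].
  have -> : t^-1 `^ (3 / 2) = t `^ (- (3 / 2)).
    by rewrite -powR_inv1 ?(ltW t0)// -powRrM mulN1r.
  have -> : (t `^ (- 2^-1)) ^+ 3 = t `^ (- (3 / 2)).
    by rewrite -powR_mulrn ?powR_ge0// -powRrM; congr (_ `^ _); field.
  have -> : t `^ (- (5 / 2)) = t `^ (- (3 / 2)) * t `^ (- (3 / 2)) * t `^ 2^-1.
    by rewrite -!powR_D//; congr (_ `^ _); field.
  by field.
rewrite tonelli//.
rewrite (@ge0_negligible_integral _ _ _ _ setT [set x | q x = 0])//; last 2 first.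
- have -> : [set x | q x = 0] = q @^-1` [set 0] by [].
  by rewrite -[X in measurable X]setTI; exact: mq.
- exact: leb3_origin.
rewrite [RHS](@ge0_negligible_integral _ _ _ _ setT [set x | q x = 0])//; last 4 first.
- have -> : [set x | q x = 0] = q @^-1` [set 0] by [].
  by rewrite -[X in measurable X]setTI; exact: mq.
- exact: (@measurable_fun_fubini_tonelli_G _ _ _ _ _ mu1 K mK K0).
- by move=> x _; apply: integral_ge0.
- exact: leb3_origin.
apply: eq_integral => x; rewrite inE => -[_ /eqP/= qn].
have q0 : 0 < q x by rewrite lt_def qn dot3_ge0.
transitivity (\int[mu1]_t (f x * ((q x `^ (3 / 2))%:E *
    ((fun t => (3 / 2 * t `^ (- (5 / 2)))%:E) \_ `[q x, +oo[) t)))%E; last first.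
  apply: eq_integral => t _; rewrite /K /= muleC patchE indicE; congr (_ * _)%E.
  rewrite (_ : ((t, x) \in A) = (t \in `[q x, +oo[%classic)); last first.
    apply/idP/idP; rewrite !inE/= in_itv/= andbT; first by move=> /andP[].
    by move=> qt; apply/andP.
  case: ifPn => _; first by rewrite mulr1 EFinM.
  by rewrite mulr0 -[point]/(0%E : \bar R) mule0.
have mk : measurable_fun [set: measurableTypeR R]
    ((fun t => (3 / 2 * t `^ (- (5 / 2)))%:E) \_ `[q x, +oo[).
  apply/measurable_restrict; [exact: measurable_itv|exact: measurableT|].
  rewrite setTI; apply/measurable_EFinP; apply: measurable_funM => //.
  exact: measurable_funS (measurable_powR _).
have k0 t : (0 <= ((fun t => (3 / 2 * t `^ (- (5 / 2)))%:E) \_ `[q x, +oo[) t)%E.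
  by rewrite patchE; case: ifPn => // _; rewrite lee_fin mulr_ge0 ?powR_ge0// divr_ge0.
rewrite ge0_integralZl//; last 2 first.
- by apply: emeasurable_funM => //.
- by move=> t _; rewrite mule_ge0// lee_fin powR_ge0.
rewrite ge0_integralZl_EFin ?powR_ge0//.
by rewrite -integral_mkcond integral_tail// -EFinM -powR_D// subrr powRr0 mule1.
Qed.

(** The polar formula for the indicator of [N] is a vanishing integral of
    nonnegative terms. *)
Theorem polar_negligible (N : set E3) : measurable N -> leb3 R N = 0%E ->
  \forall l \ae mu1, 0 < l ->
    surface R [set w | N (scale3 (l `^ 2^-1) w)] = 0%E.
Proof.
move=> mN N0.
have mI : measurable_fun [set: E3] (fun x => (\1_N x)%:E : \bar R).
  exact/measurable_EFinP.
have := polar_integral mI (fun x => _); rewrite integral_indic// setIT N0.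
pose g (z : measurableTypeR R * E3) : \bar R :=
  (\1_N (scale3 (z.1 `^ 2^-1) (direction z.2)) * \1_(@unit_ball R) z.2)%:E.
have mB := @measurable_unit_ball R.
have mg : measurable_fun [set: measurableTypeR R * E3] g.
  apply/measurable_EFinP; apply: measurable_funM; last exact: mind.
  apply: mind => //; apply: measurable_scale3; first exact: mpow.
  exact: measurableT_comp (@measurable_direction R) msnd.
pose S l := (\int[surface R]_w (\1_N (scale3 (l `^ 2^-1) w))%:E)%E.
have SE l : S l = (3%:E * \int[leb3 R]_x g (l, x))%E.
  rewrite /S integral_surface; last 2 first.
  - by apply/measurable_EFinP; apply: mind => //; exact: measurable_scale3.
  - by move=> x; rewrite lee_fin.
  congr (_ * _)%E; apply: eq_integral => x _.
  by rewrite /g /= -EFinM mulrC.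
have mS : measurable_fun [set: measurableTypeR R] S.
  rewrite (_ : S = fun l => 3%:E * \int[leb3 R]_x g (l, x))%E; last first.
    by apply/funext => l; exact: SE.
  apply: emeasurable_funM; first exact: measurable_cst.
  apply: (@measurable_fun_fubini_tonelli_F _ _ _ _ _ sf3 g mg).
  by move=> z; rewrite lee_fin mulr_ge0.
move=> /(_ (fun x => _)) I0.
have {}I0 : (\int[mu1]_l ((\1_pos l * (2^-1 * l `^ 2^-1))%:E * S l) = 0)%E.
  by rewrite -I0// => x; rewrite lee_fin.
have S0 l : (0 <= S l)%E by apply: integral_ge0 => x _; rewrite lee_fin.
have w0 l : 0 <= \1_pos l * (2^-1 * l `^ 2^-1).
  by rewrite !mulr_ge0// ?powR_ge0 ?invr_ge0.
have : ae_eq mu1 setT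
    (fun l => (\1_pos l * (2^-1 * l `^ 2^-1))%:E * S l)%E (cst 0%E).
  apply/(ae_eq_integral_abs mu1 measurableT).
    apply: emeasurable_funM => //; apply/measurable_EFinP.
    apply: measurable_funM; first exact: mind.
    by apply: measurable_funM => //; exact: mpow.
  etransitivity; last exact: I0.
  by apply: eq_integral => l _; rewrite gee0_abs// mule_ge0// lee_fin.
apply: filterS => l /(_ I) /= + l0.
move=> /eqP; rewrite mule_eq0 => /orP[|/eqP]; last first.
  rewrite /S (_ : (fun w => _) =
    (fun w => (\1_[set w | N (scale3 (l `^ 2^-1) w)] w)%:E)); last first.
    by apply/funext => w; rewrite !indicE; congr ((_%:R)%:E); apply/idP/idP; rewrite !inE.
  rewrite integral_indic ?setIT//.
  rewrite -[X in measurable X]setTI.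
  by apply: (measurable_scale3 _ _) => //.
rewrite eqe indicE mem_set//= mul1r mulf_eq0 invr_eq0 pnatr_eq0/=.
by rewrite gt_eqF// powR_gt0.
Qed.

End Polar.

(** * Fibers of the spectral representation *)

Section NormConvergence.
Context {R : realType} {d : measure_display} {X : measurableType d}.
Variable mu : {measure set X -> \bar R}.
Context {T : Type} {F : set_system T} {FF : Filter F}.
Implicit Types f g : T -> X -> R[i].

(** Bilinear expansion at the limits, and Cauchy-Schwarz. *)
Lemma inner_cvg f g (f0 g0 : X -> R[i]) :
  (\forall t \near F, L2 mu (f t)) -> (\forall t \near F, L2 mu (g t)) ->
  L2 mu f0 -> L2 mu g0 ->
  norm2 mu (f t - f0) @[t --> F] --> (0 : R) ->
  norm2 mu (g t - g0) @[t --> F] --> (0 : R) ->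
  ccvg F (fun t => inner mu (f t) (g t)) (inner mu f0 g0).
Proof.
move=> Lf Lg Lf0 Lg0 cf cg; apply: ccvg_normc.
pose b t := norm2 mu (f t - f0) * norm2 mu (g t - g0)
  + (norm2 mu (f t - f0) * norm2 mu g0 + norm2 mu f0 * norm2 mu (g t - g0)).
apply: (@squeeze_cvgr _ _ _ _ (fun=> 0) b).
- apply: filterS2 Lf Lg => t Lf Lg; apply/andP; split; first exact: normc_ge0.
  have Lft := L2B Lf Lf0; have Lgt := L2B Lg Lg0.
  have -> : inner mu (f t) (g t) - inner mu f0 g0 =
      inner mu (f t - f0) (g t - g0)
      + (inner mu (f t - f0) g0 + inner mu f0 (g t - g0)).
    rewrite innerBr// !innerBl// innerBr//; ring.
  apply: le_trans (le_normcD _ _) _; rewrite lerD ?cauchy_schwarz//.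
  by apply: le_trans (le_normcD _ _) _; rewrite lerD ?cauchy_schwarz.
- exact: cvg_cst.
- rewrite (_ : 0 = 0 * 0 + (0 * norm2 mu g0 + norm2 mu f0 * 0)); last first.
    by rewrite mul0r mulr0 mul0r !addr0.
  by apply: cvgD; [exact: cvgM|apply: cvgD; apply: cvgM => //; exact: cvg_cst].
Qed.

Lemma norm2_cvg f (f0 : X -> R[i]) : (\forall t \near F, L2 mu (f t)) ->
  L2 mu f0 ->
  norm2 mu (f t - f0) @[t --> F] --> (0 : R) ->
  norm2 mu (f t) @[t --> F] --> norm2 mu f0.
Proof.
move=> Lf Lf0 cf; apply/cvgrPdist_le => e e0.
have /cvgrPdist_le/(_ e e0) := cf; apply: filterS2 Lf => t Lft.
rewrite sub0r normrN ger0_norm ?norm2_ge0//; apply: le_trans.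
by rewrite distrC le_norm2B.
Qed.

Lemma norm2_cvg_lin (a : R[i]) f g (b : T -> R) :
  (\forall t \near F, [/\ L2 mu (f t), L2 mu (g t) & 0 <= b t]) ->
  b t * norm2 mu (f t) @[t --> F] --> (0 : R) ->
  b t * norm2 mu (g t) @[t --> F] --> (0 : R) ->
  b t * norm2 mu (a *: f t + g t) @[t --> F] --> (0 : R).
Proof.
move=> Lfg cf cg.
apply: (@squeeze_cvgr _ _ _ _ (fun=> 0)
  (fun t => normc a * (b t * norm2 mu (f t)) + b t * norm2 mu (g t))).
- apply: filterS Lfg => t [Lf Lg b0].
  rewrite mulr_ge0 ?norm2_ge0//= mulrCA -mulrDr ler_wpM2l//.
  by rewrite -norm2Z//; apply: le_norm2D => //; exact: L2Z.
- exact: cvg_cst.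
- have -> : (0 : R) = normc a * 0 + 0 by rewrite mulr0 addr0.
  by apply: cvgD => //; apply: cvgM => //; exact: cvg_cst.
Qed.

Lemma norm2_cvg_lin1 (a : R[i]) f g :
  (\forall t \near F, L2 mu (f t) /\ L2 mu (g t)) ->
  norm2 mu (f t) @[t --> F] --> (0 : R) ->
  norm2 mu (g t) @[t --> F] --> (0 : R) ->
  norm2 mu (a *: f t + g t) @[t --> F] --> (0 : R).
Proof.
move=> Lfg cf cg; have := @norm2_cvg_lin a f g (fun=> 1).
have E (k : T -> X -> R[i]) : (fun t => 1 * norm2 mu (k t)) = fun t => norm2 mu (k t).
  by apply/funext => t; rewrite mul1r.
by rewrite !E; apply => //; apply: filterS Lfg => t [].
Qed.

End NormConvergence.

Section Fibers.
Variable R : realType.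
Variable FT : (R3 R -> R[i]) -> (R3 R -> R[i]).
Hypothesis FT_unitary : unitary_op (leb3 R) FT.
Implicit Types (v w : R3 R -> R[i]) (G H : nat -> R -> R3 R -> R[i]).

Local Notation mu1 := (@lebesgue_measure R).
Local Notation sph := (surface R).
Local Notation L2S := (L2 (surface R)).
Local Notation L23 := (L2 (leb3 R)).
Local Notation nS := (norm2 (surface R)).
Local Notation n3 := (norm2 (leb3 R)).
Local Notation innS := (inner (surface R)).
Local Notation inn3 := (inner (leb3 R)).
Local Notation fib := (fiber FT).

#[local] Instance ae_mu1_filter : Filter (nbhs (almost_everywhere mu1)).
Proof. exact: (@ae_filter_ringOfSetsType _ _ _ mu1). Qed.

Lemma ae_polar (P : R3 R -> Prop) : (\forall x \ae leb3 R, P x) ->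
  \forall l \ae mu1, 0 < l ->
    \forall w \ae sph, P (scale3 (Num.sqrt l) w).
Proof.
move=> [N [mN N0 PN]]; apply: filterS (polar_negligible mN N0) => l lN l0.
exists [set w | N (scale3 (l `^ 2^-1) w)]; split.
- by rewrite -[X in measurable X]setTI; apply: measurable_scale3.
- exact: lN.
- by move=> w /= Pw; apply: PN => /=; rewrite powR12_sqrt// ltW.
Qed.

Lemma fiber0_ae v (f : R3 R -> R[i]) : FT v = f %[ae leb3 R] ->
  \forall l \ae mu1, 0 < l ->
    fiber0 FT v l =
      (fun om => (2 `^ (- 2^-1) * l `^ (4^-1))%:C * f (scale3 (Num.sqrt l) om))
      %[ae sph].
Proof.
move=> /ae_polar; apply: filterS => l /[apply]; apply: filterS => w + _.
by move=> /(_ I); rewrite /fiber0 => ->.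
Qed.

Lemma FT_lin_ae (a : R[i]) v w : L23 v -> L23 w ->
  FT (a *: v + w) = a *: FT v + FT w %[ae leb3 R].
Proof. by have [_ lin _ _] := FT_unitary; exact: lin. Qed.

Lemma L2_FT v : L23 v -> L23 (FT v).
Proof. by have [L _ _ _] := FT_unitary; exact: L. Qed.

Lemma norm2_FT v : L23 v -> n3 (FT v) = n3 v.
Proof.
move=> Lv; have [_ _ iso _] := FT_unitary.
apply/eqP; rewrite -(@eqrXn2 _ 2) ?norm2_ge0//; apply/eqP.
by rewrite -(Re_inner (L2_FT Lv)) -(Re_inner Lv) iso.
Qed.

(** The weight [2^(-1/2) l^(1/4)] of the fibers is the square root of the density
    [sqrt l / 2] of polar coordinates in the variable [l = |xi|^2]. *)
Lemma normsq_fiber0 v : L23 v ->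
  ((n3 v ^+ 2)%:E =
   \int[mu1]_l ((\1_[set t : R | (0 < t)%R] l)%:E * normsq sph (fiber0 FT v l)))%E.
Proof.
move=> Lv; rewrite -norm2_FT// -normsq_norm2; last exact: L2_FT.
have [mFv _] := L2_FT Lv.
have mf : measurable_fun [set: R3 R]
    (fun x => (Re (FT v x) ^+ 2 + Im (FT v x) ^+ 2)%:E).
  by apply/measurable_EFinP; exact: measurable_sq.
have f0 x : (0 <= (Re (FT v x) ^+ 2 + Im (FT v x) ^+ 2)%:E)%E.
  by rewrite lee_fin addr_ge0// sqr_ge0.
rewrite normsqE (polar_integral mf f0); apply: eq_integral => l _.
rewrite EFinM -muleA; have [l0|l0] := ltP 0 l; last first.
  by rewrite indicE memNset ?mul0e//=; apply/negP; rewrite -leNgt.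
congr (_ * _)%E; rewrite normsqE -ge0_integralZl_EFin//; last 2 first.
- by apply: (measurableT_comp mf); exact: measurable_scale3.
- by rewrite mulr_ge0 ?powR_ge0 ?invr_ge0.
apply: eq_integral => x _; rewrite -EFinM; congr (_%:E).
rewrite /fiber0 powR12_sqrt ?(ltW l0)//.
set z := FT v _; set c := _ * l `^ 4^-1.
have -> : 2^-1 * Num.sqrt l = c ^+ 2.
  rewrite /c exprMn -!powR_mulrn ?powR_ge0// -!powRrM.
  rewrite mulNr mulVf ?pnatr_eq0// powR_inv1//.
  by rewrite -powR12_sqrt ?(ltW l0)//; congr (_ * _ `^ _); field.
rewrite !reimE; ring.
Qed.

Lemma smooth_fibersP v : classE FT v -> smooth_fibers FT v (fiberD FT v).
Proof. by move=> [_ vG]; exact: xgetPex. Qed.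

Lemma L2_fiberD v k (l : R) : classE FT v -> 0 <= l -> L2S (fiberD FT v k l).
Proof. by move=> /smooth_fibersP[+ _ _ _ _] l0; exact. Qed.

Lemma L2_fiber v (l : R) : classE FT v -> 0 <= l -> L2S (fib v l).
Proof. exact: L2_fiberD. Qed.

Lemma L2_classE v : classE FT v -> L23 v. Proof. by case. Qed.

Lemma norm_classE v : classE FT v ->
  ((n3 v ^+ 2)%:E =
   \int[mu1]_l (\1_[set t : R | (0 < t)%R] l * nS (fib v l) ^+ 2)%:E)%E.
Proof.
move=> Ev; rewrite normsq_fiber0; last exact: L2_classE.
have [L G0 _ _ _] := smooth_fibersP Ev.
have E : (fun l => (\1_[set t : R | (0 < t)%R] l)%:E * normsq sph (fiber0 FT v l))%E
    = (fun l => (\1_[set t : R | (0 < t)%R] l * nS (fib v l) ^+ 2)%:E) %[ae mu1].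
  apply: filterS G0 => l + _; have [l0|l0] := ltP 0 l; last first.
    by rewrite indicE memNset ?mul0e ?mul0r//=; apply/negP; rewrite -leNgt.
  move=> /(_ isT) lE; rewrite EFinM; congr (_ * _)%E.
  rewrite -(normsq_norm2 (L2_fiber Ev (ltW l0))); apply: normsq_ae.
  exact: ae_eq_sym.
apply/eqP; rewrite eq_le; apply/andP; split; apply: ge0_ae_le_integral => //.
- by move=> l; rewrite mule_ge0 ?lee_fin// normsq_ge0.
- by move=> l; rewrite lee_fin mulr_ge0// sqr_ge0.
- by move=> l; rewrite lee_fin mulr_ge0// sqr_ge0.
- by move=> l; rewrite mule_ge0 ?lee_fin// normsq_ge0.
- exact: ae_eq_sym.
Qed.

(** ** Regularity of the fibers *)

(** Away from the end point of the half-line, the constraint [0 <= l + t] holds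
    for all small [t]. *)
Lemma strong_derivative_pos (g g' : R -> R3 R -> R[i]) (l : R) : 0 < l ->
  strong_derivative g g' ->
  nS ((t^-1)%:C *: (g (l + t) - g l) - g' l) @[t --> (0 : R)^'] --> (0 : R).
Proof.
move=> l0 /(_ _ (ltW l0)) cg A /cg.
rewrite /within /= !nbhs_simpl => wA.
have D : \forall t \near (0 : R), 0 <= l + t.
  apply/nbhs_ballP; exists l => //= t; rewrite /ball/= sub0r normrN => tl.
  by have := ler_norm (- t); rewrite normrN; lra.
have {}D : \forall t \near (0 : R)^', 0 <= l + t by apply: filterS D.
by apply: filterS2 D wA => t Dt; apply.
Qed.

Lemma fiber_translate_cvg (g g' : R -> R3 R -> R[i]) (l : R) : 0 < l ->
  (forall l, 0 <= l -> L2S (g l)) -> (forall l, 0 <= l -> L2S (g' l)) ->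
  strong_derivative g g' ->
  nS (g y - g l) @[y --> l] --> (0 : R).
Proof.
move=> l0 Lg Lg' dg; have c := strong_derivative_pos l0 dg.
suff ct : nS (g (l + t) - g l) @[t --> (0 : R)] --> (0 : R).
  apply/cvgrPdist_lt => e e0; have /cvgrPdist_lt/(_ e e0) := ct.
  move=> /nbhs_ballP[r /= r0 rP]; apply/nbhs_ballP; exists r => //= y ly.
  have := rP (y - l); rewrite /= (addrC l) subrK; apply.
  by move: ly; rewrite /ball/= sub0r opprB.
have Lgl := Lg _ (ltW l0); have Lgl' := Lg' _ (ltW l0).
have B : `|t| * (nS ((t^-1)%:C *: (g (l + t) - g l) - g' l) + nS (g' l))
    @[t --> (0 : R)^'] --> (0 : R).
  rewrite -[X in _ --> X](mul0r (0 + nS (g' l))); apply: cvgM; last first.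
    by apply: cvgD => //; exact: cvg_cst.
  apply: cvg_trans (cvg_app _ (@cvg_within _ (nbhs (0 : R)) _ _)) _.
  by rewrite -[X in _ --> X](@normr0 _ R); exact: cvg_norm cvg_id.
apply/cvgrPdist_lt => e e0; have /cvgrPdist_lt/(_ e e0) := B.
rewrite /dnbhs /within /= !near_simpl => wB.
have D : \forall t \near (0 : R), 0 <= l + t.
  apply/nbhs_ballP; exists l => //= t; rewrite /ball/= sub0r normrN => tl.
  by have := ler_norm (- t); rewrite normrN; lra.
apply: filterS2 D wB => t Dt /= wt; rewrite sub0r normrN ger0_norm ?norm2_ge0//.
have [->|t0] := eqVneq t 0; first by rewrite addr0 subrr norm2_0.
move: (wt t0); rewrite sub0r normrN; apply: le_lt_trans.
have Ld := L2B (Lg _ Dt) Lgl; have Lq := L2B (L2Z (t^-1)%:C Ld) Lgl'.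
rewrite ger0_norm; last by rewrite mulr_ge0// addr_ge0// norm2_ge0.
have E : g (l + t) - g l =
    t%:C *: (((t^-1)%:C *: (g (l + t) - g l) - g' l) + g' l).
  by rewrite subrK scalerA -rmorphM/= divff// scale1r.
rewrite E norm2Z -?E; last exact: L2D.
by rewrite normc_real ler_wpM2l// le_norm2D.
Qed.

Lemma smooth_fibers_cvg v G k (l : R) : smooth_fibers FT v G -> 0 < l ->
  nS (G k y - G k l) @[y --> l] --> (0 : R).
Proof.
move=> [L _ dG _ _] l0.
exact: (fiber_translate_cvg l0 (L k) (L k.+1) (dG k)).
Qed.

Lemma near_pos (l : R) : 0 < l -> \forall y \near l, 0 < y.
Proof. by move=> l0; exact: lt_nbhsr. Qed.

(** Decay gives the bound near [0] and infinity, and compactness in between; the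
    weight makes it integrable in [l]. *)
Lemma fiberD_bound v k : classE FT v ->
  exists2 K : R, 0 <= K & forall l : R, 0 < l ->
    (1 + l ^+ 2) * nS (fiberD FT v k l) <= K.
Proof.
move=> Ev; have [L _ dG G0 Goo] := smooth_fibersP Ev.
pose n l := nS (fiberD FT v k l).
have n0 l : 0 <= n l by exact: norm2_ge0.
have [r r0 rP] : exists2 r : R, 0 < r & forall l, 0 < l < r -> n l <= 1.
  have /cvgrPdist_lt/(_ 1 ltr01) := G0 k 0%N.
  move=> /nbhs_ballP[r /= r0 rP]; exists r => // l /andP[l0 lr].
  have := rP l; rewrite /ball/= !sub0r !normrN gtr0_norm// => /(_ lr l0).
  by rewrite expr0 invr1 mul1r ger0_norm ?norm2_ge0// => /ltW.
have [M M0 MP] : exists2 M : R, 0 < M & forall l, M < l -> n l <= 1 /\ l ^+ 2 * n l <= 1.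
  have /cvgrPdist_lt/(_ 1 ltr01) := Goo k 0%N.
  move=> [M1 [_ M1P]]; have /cvgrPdist_lt/(_ 1 ltr01) := Goo k 2%N.
  move=> [M2 [_ M2P]]; exists (Num.max 1 (Num.max M1 M2)).
    by rewrite lt_max ltr01.
  move=> l; rewrite !gt_max => /and3P[l1 lM1 lM2].
  have := M1P _ lM1; have := M2P _ lM2; rewrite /= !sub0r !normrN expr0 mul1r.
  rewrite !ger0_norm ?norm2_ge0//; last by rewrite mulr_ge0 ?sqr_ge0 ?norm2_ge0.
  by move=> /ltW ? /ltW ?.
pose a := r / 2; pose b := M + r.
have a0 : 0 < a by rewrite divr_gt0.
have ar : a < r by rewrite /a; lra.
have ab : a <= b by rewrite /a /b; lra.
have bM : M < b by rewrite /b; lra.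
have cn : {within `[a, b], continuous n}.
  apply: continuous_in_subspaceT => l; rewrite inE/= in_itv/= => /andP[al _].
  have l0 : 0 < l by exact: lt_le_trans al.
  apply/cvgrPdist_le => e e0.
  have /cvgrPdist_le/(_ e e0) := smooth_fibers_cvg k (smooth_fibersP Ev) l0.
  apply: filterS2 (near_pos l0) => y y0; rewrite sub0r normrN ger0_norm ?norm2_ge0//.
  by apply: le_trans; rewrite distrC; apply: le_norm2B; apply: L; exact: ltW.
have [c _ cP] := EVT_max ab cn.
have b0 : 0 <= b by exact: le_trans (ltW a0) ab.
exists ((1 + r ^+ 2) + 2 + (1 + b ^+ 2) * n c).
  by rewrite !addr_ge0// ?sqr_ge0// mulr_ge0// addr_ge0// sqr_ge0.
move=> l l0; rewrite -/(n l).
have T1 : 0 <= (1 + b ^+ 2) * n c by rewrite mulr_ge0// addr_ge0// sqr_ge0.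
have T2 : 0 <= r ^+ 2 by rewrite sqr_ge0.
have [lr|lr] := ltP l r.
  have nl := rP l; rewrite l0 lr in nl; have {}nl := nl isT.
  have : l ^+ 2 <= r ^+ 2 by nra.
  have := n0 l; move: (sqr_ge0 l); nra.
have [lM|lM] := ltP M l; first by have [? ?] := MP _ lM; lra.
have lab : l \in `[a, b].
  by rewrite in_itv/= (le_trans (ltW ar) lr) (le_trans lM (ltW bM)).
have := cP _ lab; have : l ^+ 2 <= b ^+ 2 by nra.
have := n0 l; have := n0 c; move: (sqr_ge0 l) (sqr_ge0 b).
move: (n l) (n c) (l ^+ 2) (b ^+ 2) => *; nra.
Qed.

(** Two smooth families which agree for almost every [l] agree for all [l > 0]
    by continuity. *)
Lemma smooth_fibers_unique v w G H : smooth_fibers FT v G ->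
  smooth_fibers FT w H -> FT v = FT w %[ae leb3 R] ->
  forall l : R, 0 < l -> G 0%N l = H 0%N l %[ae sph].
Proof.
move=> sG sH vw l l0; have [LG G0 _ _ _] := sG; have [LH H0 _ _ _] := sH.
apply: norm2_sub_ae; [exact: LG (ltW l0)|exact: LH (ltW l0)|].
pose n y := nS (G 0%N y - H 0%N y).
have ae0 : \forall y \ae mu1, 0 < y -> n y = 0.
  have F0 := fiber0_ae vw.
  apply: filterS3 G0 H0 F0 => y Gy Hy Fy y0; rewrite -[RHS](norm2_0 sph).
  apply: norm2_ae; apply: filterS3 (Gy y0) (Hy y0) (Fy y0) => x gx hx fx _.
  by rewrite !ptE gx// hx// fx// subrr.
have cn : n y @[y --> l] --> n l.
  apply: norm2_cvg.
  - by apply: filterS (near_pos l0) => y /ltW y0; apply: L2B; [exact: LG|exact: LH].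
  - by apply: L2B; [exact: LG (ltW l0)|exact: LH (ltW l0)].
  rewrite (_ : (fun y => _) = fun y =>
      nS ((-1) *: (H 0%N y - H 0%N l) + (G 0%N y - G 0%N l))); last first.
    apply/funext => y; congr (nS _).
    by apply/funext => x; rewrite !ptE; ring.
  apply: norm2_cvg_lin1.
  - apply: filterS (near_pos l0) => y /ltW y0; split.
      by apply: L2B; [exact: LH|exact: LH (ltW l0)].
    by apply: L2B; [exact: LG|exact: LG (ltW l0)].
  - exact: smooth_fibers_cvg sH l0.
  - exact: smooth_fibers_cvg sG l0.
apply/eqP; apply: contrapT => /negP; rewrite -/(n l) => nl.
have npos : 0 < n l by rewrite lt_def nl norm2_ge0.
have /cvgrPdist_lt/(_ _ npos) := cn.
move=> /nbhs_ballP[r /= r0 rP].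
have [N [mN N0 sN]] := ae0.
pose r' := Num.min r l.
have r'0 : 0 < r' by rewrite lt_min r0 l0.
have : (mu1 (ball l r') <= mu1 N)%E.
  apply: le_measure; rewrite ?inE//; first exact: measurable_ball.
  move=> y yb; apply: sN => /= h.
  have [ylr yll] : `|l - y| < r /\ `|l - y| < l.
    by move: yb; rewrite /ball/= lt_min => /andP.
  have y0 : 0 < y by have := ler_norm (l - y); lra.
  by have := rP y ylr; rewrite /= h// subr0 gtr0_norm// ltxx.
rewrite N0 lebesgue_measure_ball ?(ltW r'0)// lee_fin.
by rewrite leNgt pmulrn_rgt0.
Qed.

Lemma smooth_fibers_lin (a : R[i]) v w G H : L23 v -> L23 w ->
  smooth_fibers FT v G -> smooth_fibers FT w H ->
  smooth_fibers FT (a *: v + w) (fun k l => a *: G k l + H k l).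
Proof.
move=> Lv Lw [LG G0 dG G1 G2] [LH H0 dH H1 H2]; split.
- by move=> k l l0; apply: L2_lin; [exact: LG|exact: LH].
- have F0 := fiber0_ae (FT_lin_ae a Lv Lw).
  apply: filterS3 G0 H0 F0 => l Gl Hl Fl l0.
  apply: filterS3 (Gl l0) (Hl l0) (Fl l0) => x gx hx fx _.
  by rewrite fx// !ptE gx// hx// /fiber0; ring.
- move=> k l l0; rewrite (_ : (fun t => _) = (fun t =>
    nS (a *: ((t^-1)%:C *: (G k (l + t) - G k l) - G k.+1 l)
    + ((t^-1)%:C *: (H k (l + t) - H k l) - H k.+1 l)))); last first.
    apply/funext => t; congr (nS _).
    by apply/funext => x; rewrite !ptE; ring.
  apply: norm2_cvg_lin1; [|exact: dG|exact: dH].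
  have wT : within [set t : R | 0 <= l + t] (0 : R)^' [set t : R | 0 <= l + t].
    exact: withinT.
  apply: filterS wT => t lt0; split; apply: L2B.
  + by apply/L2Z/L2B; exact: LG.
  + exact: LG.
  + by apply/L2Z/L2B; exact: LH.
  + exact: LH.
- move=> k N; apply: norm2_cvg_lin => //.
  near=> l; have l0 : 0 <= l by apply: ltW; near: l; exact: nbhs_right_gt.
  by split; [exact: LG|exact: LH|rewrite invr_ge0 exprn_ge0].
- move=> k N; apply: norm2_cvg_lin => //.
  near=> l; have l0 : 0 <= l by near: l; exact: nbhs_pinfty_ge.
  by split; [exact: LG|exact: LH|rewrite exprn_ge0].
Unshelve. all: end_near. Qed.

Lemma classE_lin (a : R[i]) v w : classE FT v -> classE FT w ->
  classE FT (a *: v + w).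
Proof.
move=> Ev Ew; split; first by apply: L2_lin; exact: L2_classE.
exists (fun k l => a *: fiberD FT v k l + fiberD FT w k l).
by apply: smooth_fibers_lin; [exact: L2_classE..|exact: smooth_fibersP|exact: smooth_fibersP].
Qed.

Lemma fiber_lin (a : R[i]) v w (l : R) : classE FT v -> classE FT w -> 0 < l ->
  fib (a *: v + w) l = a *: fib v l + fib w l %[ae sph].
Proof.
move=> Ev Ew l0; apply: (smooth_fibers_unique (smooth_fibersP (classE_lin a Ev Ew))
  (smooth_fibers_lin a (L2_classE Ev) (L2_classE Ew) (smooth_fibersP Ev)
    (smooth_fibersP Ew))) => //.
exact: ae_eq_refl.
Qed.

Lemma classE0 : classE FT 0.
Proof.
split; first exact: L20.
exists (fun _ _ => 0); split.
- by move=> *; exact: L20.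
- have F0 := FT_lin_ae (-1) (L20 (leb3 R)) (L20 (leb3 R)).
  have {}F0 : FT 0 = (fun=> 0) %[ae leb3 R].
    move: F0; rewrite scaler0 addr0; apply: filterS => x /[apply].
    by rewrite !ptE mulN1r addNr.
  apply: filterS (fiber0_ae F0) => l /[apply]; apply: filterS => x /[apply] ->.
  by rewrite mulr0.
- move=> k l l0; rewrite (_ : (fun t => _) = fun=> 0); first exact: cvg_cst.
  by apply/funext => t; rewrite !subrr scaler0 subrr norm2_0.
- by move=> k N; rewrite norm2_0; under eq_fun do rewrite mulr0; exact: cvg_cst.
- by move=> k N; rewrite norm2_0; under eq_fun do rewrite mulr0; exact: cvg_cst.
Qed.

Lemma classEZ (a : R[i]) v : classE FT v -> classE FT (a *: v).
Proof. by move=> Ev; rewrite -[_ *: _]addr0; apply: classE_lin => //; exact: classE0. Qed.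

Lemma fiber_ae0 v (l : R) : classE FT v -> n3 v = 0 -> 0 < l ->
  fib v l = 0 %[ae sph].
Proof.
move=> Ev v0 l0; have F0 : FT v = FT ((-1) *: v + v) %[ae leb3 R].
  have Lv := L2_classE Ev.
  have := norm2_FT Lv; rewrite v0 => /(norm2_eq0_ae (L2_FT Lv)) A.
  apply: filterS2 A (FT_lin_ae (-1) Lv Lv) => x a b _.
  by rewrite b// a// !ptE mulN1r addNr.
have := smooth_fibers_unique (smooth_fibersP Ev)
  (smooth_fibers_lin (-1) (L2_classE Ev) (L2_classE Ev) (smooth_fibersP Ev)
    (smooth_fibersP Ev)) F0 l0.
by apply: filterS => x /[apply]; rewrite !ptE mulN1r addNr.
Qed.

(** ** The densities [<v_lam, w_lam>] *)

Let ip i j v w (l : R) := innS (fiberD FT v i l) (fiberD FT w j l).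

(** The difference quotient of an inner product splits into those of the two
    fibers, as in the Leibniz rule. *)
Lemma ip_derive i j v w (l : R) : classE FT v -> classE FT w -> 0 < l ->
  ccvg (0 : R)^' (fun t => (t^-1)%:C * (ip i j v w (l + t) - ip i j v w l))
    (ip i.+1 j v w l + ip i j.+1 v w l).
Proof.
move=> Ev Ew l0; have [LG _ dG _ _] := smooth_fibersP Ev.
have [LH _ dH _ _] := smooth_fibersP Ew.
have l0' := ltW l0.
pose Q (G : R -> R3 R -> R[i]) t := (t^-1)%:C *: (G (l + t) - G l).
have D : \forall t \near (0 : R)^', 0 <= l + t.
  suff D : \forall t \near (0 : R), 0 <= l + t by apply: filterS D.
  apply/nbhs_ballP; exists l => //= t; rewrite /ball/= sub0r normrN => tl.
  by have := ler_norm (- t); rewrite normrN; lra.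
have LQ (G : R -> R3 R -> R[i]) : (forall l, 0 <= l -> L2S (G l)) -> \forall t \near (0 : R)^', L2S (Q G t).
  by move=> LG'; apply: filterS D => t lt0; apply/L2Z/L2B; exact: LG'.
have cH : nS (fiberD FT w j (l + t) - fiberD FT w j l) @[t --> (0 : R)^'] --> (0 : R).
  have := smooth_fibers_cvg j (smooth_fibersP Ew) l0.
  move=> /cvgrPdist_lt c; apply/cvgrPdist_lt => e e0.
  have /nbhs_ballP[r /= r0 rP] := c e e0.
  apply/nbhs_ballP; exists r => //= t tr _; apply: rP.
  by move: tr; rewrite /ball/= sub0r normrN opprD addrA subrr sub0r normrN.
have c1 : ccvg (0 : R)^' (fun t => innS (Q (fiberD FT v i) t) (fiberD FT w j (l + t)))
    (ip i.+1 j v w l).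
  apply: inner_cvg => //.
  - by apply: LQ => y; exact: LG.
  - by apply: filterS D => t; exact: LH.
  - exact: LG.
  - exact: LH.
  - exact: strong_derivative_pos (dG i).
have c2 : ccvg (0 : R)^' (fun t => innS (fiberD FT v i l) (Q (fiberD FT w j) t))
    (ip i j.+1 v w l).
  apply: inner_cvg => //.
  - by apply: nearW => t; exact: LG.
  - by apply: LQ => y; exact: LH.
  - exact: LG.
  - exact: LH.
  - by under eq_fun do rewrite subrr norm2_0; exact: cvg_cst.
  - exact: strong_derivative_pos (dH j).
have E : \forall t \near (0 : R)^',
    innS (Q (fiberD FT v i) t) (fiberD FT w j (l + t))
    + innS (fiberD FT v i l) (Q (fiberD FT w j) t)
    = (t^-1)%:C * (ip i j v w (l + t) - ip i j v w l).
  apply: filterS D => t lt0; rewrite /Q /ip.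
  have Lv := LG i _ lt0; have Lw := LH j _ lt0.
  have Lv' := LG i _ l0'; have Lw' := LH j _ l0'.
  rewrite innerZl ?innerZr//; [|exact: L2B..].
  by rewrite innerBl// innerBr// conjc_real; ring.
have [c31 c32] := ccvgD c1 c2.
split.
  apply: cvg_trans c31; apply: near_eq_cvg.
  by apply: filterS E => t ->.
apply: cvg_trans c32; apply: near_eq_cvg.
by apply: filterS E => t ->.
Qed.

Let is_derive_quotient (z : R -> R) (l a : R) :
  t^-1 * (z (l + t) - z l) @[t --> (0 : R)^'] --> a -> is_derive l 1 z a.
Proof.
move=> c; have {}c : (h^-1 *: (z (h *: 1 + l) - z l)) @[h --> (0 : R)^'] --> a.
  apply: cvg_trans c; apply: near_eq_cvg; apply: nearW => h.
  by rewrite /GRing.scale /= mulr1 (addrC h).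
have d : derivable z l 1 by apply: cvgP c.
by apply: DeriveDef => //; apply: cvg_lim c.
Qed.

(** [true] selects the real part and [false] the imaginary part, so that facts
    about real densities are proved once for both. *)
Definition part (p : bool) (z : R[i]) : R := if p then Re z else Im z.

Lemma part_le p z : `|part p z| <= normc z.
Proof. by case: p; [exact: Re_le_normc|exact: Im_le_normc]. Qed.

Lemma is_derive_ip p i j v w (l : R) : classE FT v -> classE FT w -> 0 < l ->
  is_derive l 1 (fun y => part p (ip i j v w y))
    (part p (ip i.+1 j v w l + ip i j.+1 v w l)).
Proof.
move=> Ev Ew l0; have [c1 c2] := ip_derive i j Ev Ew l0.
case: p; apply: is_derive_quotient.
  apply: cvg_trans c1; apply: near_eq_cvg; apply: nearW => t.
  by rewrite !reimE mul0r subr0.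
apply: cvg_trans c2; apply: near_eq_cvg; apply: nearW => t.
by rewrite !reimE mul0r addr0.
Qed.

Lemma ip_bound i j v w : classE FT v -> classE FT w ->
  exists2 K : R, 0 <= K & forall l : R, 0 < l ->
    (1 + l ^+ 2) ^+ 2 * normc (ip i j v w l) <= K.
Proof.
move=> Ev Ew; have [K K0 KP] := fiberD_bound i Ev.
have [M M0 MP] := fiberD_bound j Ew.
exists (K * M) => [|l l0]; first exact: mulr_ge0.
have := cauchy_schwarz (L2_fiberD i Ev (ltW l0)) (L2_fiberD j Ew (ltW l0)).
rewrite -/(ip i j v w l) => cs; apply: le_trans (ler_pM _ _ (KP l l0) (MP l l0)).
- rewrite mulrACA -expr2 ler_wpM2l// sqr_ge0//.
- by rewrite mulr_ge0 ?norm2_ge0// addr_ge0// sqr_ge0.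
- by rewrite mulr_ge0 ?norm2_ge0// addr_ge0// sqr_ge0.
Qed.

(** The properties of a density on the line which make its principal values
    behave well: integrability with a first moment, and a Lipschitz derivative
    on the open half-line. *)
Definition tame (z z1 : R -> R) (K : R) : Prop :=
  [/\ measurable_fun [set: R] z,
      forall l : R, (1 + l ^+ 2) ^+ 2 * `|z l| <= K,
      forall l : R, 0 < l -> is_derive l 1 z (z1 l) &
      forall x y : R, 0 < x -> 0 < y -> `|z1 x - z1 y| <= K * `|x - y|].

Lemma measurable_half_line (z : R -> R) : (forall l, 0 < l -> {for l, continuous z}) ->
  (forall l, l < 0 -> z l = 0) -> measurable_fun [set: R] z.
Proof.
move=> cz z0.
have -> : [set: R] = `]-oo, 0[ `|` ([set 0] `|` `]0, +oo[).
  apply/seteqP; split => // x _; rewrite /= !in_itv/= andbT.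
  by case: (ltgtP x 0) => [x0|x0|->]; [left|right; right|right; left].
apply/measurable_funU; [exact: measurable_itv| |split].
  by apply: measurableU => //; exact: measurable_itv.
  move=> mD A mA; have [A0|A0] := pselect (A 0).
    rewrite (_ : _ `&` _ = `]-oo, 0[%classic)//.
    apply/seteqP; split => x /=; rewrite in_itv/=; first by move=> -[].
    by move=> x0; rewrite z0.
  rewrite (_ : _ `&` _ = set0)//.
  by apply/seteqP; split => x //=; rewrite in_itv/= => -[x0]; rewrite z0.
apply/measurable_funU; [by []|exact: measurable_itv|split].
  exact: measurable_fun_set1.
apply: open_continuous_measurable_fun; first exact: interval_open.
by move=> x; rewrite inE/= in_itv/= andbT; exact: cz.
Qed.

Lemma eta_pos v w (l : R) : 0 < l -> Defs.eta FT v w l = ip 0 0 v w l.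
Proof. by move=> l0; rewrite /Defs.eta (ltW l0). Qed.

Lemma eta_neg v w (l : R) : l < 0 -> Defs.eta FT v w l = 0.
Proof. by move=> l0; rewrite /Defs.eta leNgt l0. Qed.

(** A density vanishes on the negative half-line; on the positive one it and its
    first two derivatives are sums of inner products of fibers, which decay. *)
Lemma eta_tame p v w : classE FT v -> classE FT w ->
  exists z1 K, tame (fun l => part p (Defs.eta FT v w l)) z1 K.
Proof.
move=> Ev Ew.
pose z1 l := part p (ip 1 0 v w l + ip 0 1 v w l).
have dz (l : R) : 0 < l -> is_derive l 1 (fun l => part p (Defs.eta FT v w l)) (z1 l).
  move=> l0; apply: near_eq_is_derive (is_derive_ip p 0 0 Ev Ew l0).
  by apply: filterS (near_pos l0) => y y0; rewrite eta_pos.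
have [K0 K00 K0P] := ip_bound 0 0 Ev Ew.
have [K1 K10 K1P] := ip_bound 2 0 Ev Ew.
have [K2 K20 K2P] := ip_bound 1 1 Ev Ew.
have [K3 K30 K3P] := ip_bound 0 2 Ev Ew.
have B i j (l K : R) : 0 < l -> (1 + l ^+ 2) ^+ 2 * normc (ip i j v w l) <= K ->
    normc (ip i j v w l) <= K.
  move=> l0; apply: le_trans; rewrite ler_peMl ?normc_ge0//.
  by have := sqr_ge0 l; move: (l ^+ 2) => x x0; nra.
exists z1, (K0 + `|part p (Defs.eta FT v w 0)| + (K1 + 2 * K2 + K3)); split.
- apply: measurable_half_line => l l0.
    have [/derivable1_diffP d _] := dz l l0.
    exact: differentiable_continuous d.
  by rewrite eta_neg//; case: (p).
- move=> l; have T : 0 <= K1 + 2 * K2 + K3 by rewrite !addr_ge0// mulr_ge0.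
  have T2 : 0 <= `|part p (Defs.eta FT v w 0)| by [].
  have [l0|l0|->] := ltgtP l 0.
  + have -> : part p (Defs.eta FT v w l) = 0 by rewrite eta_neg//; case: (p).
    by rewrite normr0 mulr0 addr_ge0// addr_ge0.
  + apply: (@le_trans _ _ K0); last by rewrite -addrA lerDl addr_ge0.
    apply: le_trans (K0P _ l0); rewrite ler_wpM2l ?sqr_ge0// eta_pos//.
    exact: part_le.
  + by rewrite expr0n/= addr0 expr1n mul1r; lra.
- exact: dz.
- move=> x y x0 y0.
  pose z2 l := part p ((ip 2 0 v w l + ip 1 1 v w l) + (ip 1 1 v w l + ip 0 2 v w l)).
  have partD a b : part p (a + b) = part p a + part p b.
    by case: (p); rewrite /part !reimE.
  have dz1 (l : R) : 0 < l -> is_derive l 1 z1 (z2 l).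
    move=> l0; rewrite /z2 partD.
    have -> : z1 = (fun y => part p (ip 1 0 v w y)) \+ (fun y => part p (ip 0 1 v w y)).
      by apply/funext => u; rewrite /z1 partD.
    apply: is_deriveD; exact: is_derive_ip.
  have bz2 (l : R) : 0 < l -> `|z2 l| <= K1 + 2 * K2 + K3.
    move=> l0; rewrite /z2 !partD.
    have b1 := le_trans (part_le p _) (B _ _ _ _ l0 (K1P _ l0)).
    have b2 := le_trans (part_le p _) (B _ _ _ _ l0 (K2P _ l0)).
    have b3 := le_trans (part_le p _) (B _ _ _ _ l0 (K3P _ l0)).
    apply: le_trans (ler_normD _ _) _.
    have := ler_normD (part p (ip 2 0 v w l)) (part p (ip 1 1 v w l)).
    have := ler_normD (part p (ip 1 1 v w l)) (part p (ip 0 2 v w l)); lra.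
  have lip (a b : R) : 0 < a -> a < b -> `|z1 b - z1 a| <= (K1 + 2 * K2 + K3) * (b - a).
    move=> a0 ab.
    have dz1' u : u \in `]a, b[ -> is_derive u 1 z1 (z2 u).
      by rewrite in_itv/= => /andP[au _]; apply: dz1; exact: lt_trans au.
    have [|c cab ->] := MVT ab dz1'.
      apply: continuous_in_subspaceT => u; rewrite inE/= in_itv/= => /andP[au _].
      have [/derivable1_diffP d _] := dz1 u (lt_le_trans a0 au).
      exact: differentiable_continuous d.
    have ba : 0 <= b - a by rewrite subr_ge0 ltW.
    rewrite normrM (ger0_norm ba) ler_wpM2r// bz2//.
    by move: cab; rewrite in_itv/= => /andP[ac _]; exact: lt_trans ac.
  have wk (t : R) : 0 <= t -> (K1 + 2 * K2 + K3) * t <=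
      (K0 + `|part p (Defs.eta FT v w 0)| + (K1 + 2 * K2 + K3)) * t.
    by move=> t0; rewrite ler_wpM2r// lerDr addr_ge0.
  have [xy|yx|->] := ltgtP x y; last by rewrite !subrr !normr0 mulr0.
    rewrite distrC (distrC x) (@ger0_norm _ (y - x)) ?subr_ge0 ?(ltW xy)//.
    by apply: le_trans (lip _ _ x0 xy) _; apply: wk; rewrite subr_ge0 ltW.
  rewrite (@ger0_norm _ (x - y)) ?subr_ge0 ?(ltW yx)//.
  by apply: le_trans (lip _ _ y0 yx) _; apply: wk; rewrite subr_ge0 ltW.
Qed.

End Fibers.

#[local] Opaque Defs.fiberD Defs.inner Defs.norm2.

(** * Spectral densities *)
Lemma Re_innerD (R : realType) (d : measure_display) (X : measurableType d)
    (mu : {measure set X -> \bar R}) (f g : X -> R[i]) :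
  L2 mu f -> L2 mu g -> Re (inner mu (f + g) (f + g)) =
    Re (inner mu f f) + Re (inner mu g g) + 2 * Re (inner mu f g).
Proof.
move=> Lf Lg; rewrite (Re_inner (L2D Lf Lg)) (Re_inner Lf) (Re_inner Lg).
exact: norm2D_sqr.
Qed.

Section SpectralDensities.
Variable R : realType.
Variable FT : (R3 R -> R[i]) -> (R3 R -> R[i]).
Hypothesis FT_unitary : unitary_op (leb3 R) FT.
Implicit Types (v w : R3 R -> R[i]).

Local Notation mu1 := (@lebesgue_measure R).
Local Notation sph := (surface R).
Local Notation L2S := (L2 (surface R)).
Local Notation L23 := (L2 (leb3 R)).
Local Notation nS := (norm2 (surface R)).
Local Notation n3 := (norm2 (leb3 R)).
Local Notation innS := (inner (surface R)).
Local Notation inn3 := (inner (leb3 R)).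
Local Notation fib := (fiber FT).
Local Notation ib z := (mu1.-integrable [set: R] (EFin \o z)).

Lemma integrable_oneDsqrV : ib (fun l : R => (1 + l ^+ 2)^-1).
Proof.
have m : measurable_fun [set: R] (fun l : R => ((1 + l ^+ 2)^-1)%:E).
  apply/measurable_EFinP; apply: continuous_measurable_fun.
  exact: (@continuous_oneDsqrV R).
have p0 l : (0 <= ((1 + l ^+ 2 : R)^-1)%:E)%E.
  by rewrite lee_fin invr_ge0 addr_ge0// sqr_ge0.
have I : (\int[mu1]_(l in `[0%R, +oo[) ((1 + l ^+ 2)^-1)%:E < +oo)%E.
  by rewrite (@integral0y_oneDsqr R) ltry.
apply/integrableP; split => //.
rewrite (_ : (fun x => _) = (fun l : R => ((1 + l ^+ 2)^-1)%:E)); last first.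
  by apply/funext => l; exact: (gee0_abs (p0 l)).
have -> : [set: R] = `]-oo, 0] `|` `]0, +oo[.
  apply/seteqP; split => // x _; rewrite /= !in_itv/= andbT.
  by case: (leP x 0) => x0; [left|right].
have m' (D : set R) : measurable_fun D (fun l : R => ((1 + l ^+ 2)^-1)%:E).
  exact: measurable_funTS.
rewrite ge0_integral_setU//=; [|exact: m'|]; last first.
  rewrite disj_set2E; apply/eqP; apply/seteqP; split => // x /= [].
  by rewrite !in_itv/= andbT leNgt => /negP.
apply: lte_add_pinfty.
  have := @ge0_integration_by_substitution0 R _ m p0.
  under [X in _ = X -> _]eq_integral do rewrite sqrrN.
  by move=> <-.
apply: le_lt_trans I; apply: ge0_subset_integral => //; first exact: m'.
by move=> x; rewrite /= !in_itv/= !andbT => /ltW.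
Qed.

Lemma tame_integrable z z1 K : tame z z1 K -> ib z /\ ib (fun l => l * z l).
Proof.
move=> [mz bz _ _].
have iK := intblZ K integrable_oneDsqrV.
have K0 : 0 <= K by apply: le_trans (bz 0); rewrite mulr_ge0// sqr_ge0.
have B (l : R) : [/\ 0 <= K * (1 + l ^+ 2)^-1, `|z l| <= K * (1 + l ^+ 2)^-1 &
    `|l * z l| <= K * (1 + l ^+ 2)^-1].
  have := bz l; have := sqr_ge0 l => l2 b.
  have p : 0 < 1 + l ^+ 2 by lra.
  split; first by rewrite mulr_ge0// invr_ge0 ltW.
    rewrite ler_pdivlMr//; apply: le_trans b.
    rewrite mulrC ler_wpM2r//; nra.
  rewrite ler_pdivlMr// normrM; apply: le_trans b.
  rewrite mulrAC ler_wpM2r// expr2 ler_wpM2r ?(ltW p)//.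
  by rewrite -(ler_pXn2r (_ : (0 < 2)%N)) ?nnegrE ?(ltW p)// real_normK ?num_real//; nra.
split; apply: (le_integrable measurableT _ _ iK).
- exact/measurable_EFinP.
- by move=> l _ /=; rewrite lee_fin; have [p b _] := B l; rewrite (ger0_norm p).
- by apply/measurable_EFinP; apply: measurable_funM.
- by move=> l _ /=; rewrite lee_fin; have [p _ b] := B l; rewrite (ger0_norm p).
Qed.

Lemma eta_integrable p v w : classE FT v -> classE FT w ->
  ib (fun l => part p (Defs.eta FT v w l)).
Proof.
by move=> Ev Ew; have [z1 [K /tame_integrable[]]] := eta_tame p Ev Ew.
Qed.

Lemma eta_ge0 v w (l : R) : 0 <= l -> Defs.eta FT v w l = innS (fib v l) (fib w l).
Proof. by rewrite /Defs.eta => ->. Qed.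

Lemma eta_conj v w (l : R) : classE FT v -> classE FT w ->
  Defs.eta FT w v l = (Defs.eta FT v w l)^*%C.
Proof.
move=> Ev Ew; have [l0|l0] := leP 0 l.
  by rewrite !eta_ge0//; apply: inner_conj; exact: L2_fiber.
by rewrite !eta_neg// conjc0.
Qed.

Lemma norm_eta v : classE FT v ->
  n3 v ^+ 2 = \int[mu1]_l Re (Defs.eta FT v v l).
Proof.
move=> Ev; rewrite /Rintegral.
rewrite -[LHS]/(fine (n3 v ^+ 2)%:E) (norm_classE FT_unitary Ev); congr fine.
have E : (fun l => (\1_[set t : R | (0 < t)%R] l * nS (fib v l) ^+ 2)%:E)
    = (fun l => (Re (Defs.eta FT v v l))%:E) %[ae mu1].
  exists [set 0]; split => //; first exact: lebesgue_measure_set1.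
  move=> l /= nE; apply/eqP; apply: contrapT => /negP l0; apply: nE => _.
  rewrite indicE; case: (ltgtP l 0) l0 => // l0 _.
    rewrite eta_neg// memNset ?mul0r//=.
    by apply/negP; rewrite -leNgt ltW.
  by rewrite eta_ge0 ?ltW// mem_set// mul1r (Re_inner (L2_fiber _ (ltW l0))).
have p0 l : (0 <= (Re (Defs.eta FT v v l))%:E)%E.
  rewrite lee_fin; have [l0|l0] := leP 0 l; last by rewrite eta_neg.
  by rewrite eta_ge0// (Re_inner (L2_fiber _ l0))// sqr_ge0.
have q0 l : (0 <= (\1_[set t : R | (0 < t)%R] l * nS (fib v l) ^+ 2)%:E)%E.
  by rewrite lee_fin mulr_ge0// sqr_ge0.
by apply/eqP; rewrite eq_le; apply/andP; split; apply: ge0_ae_le_integral => //;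
  exact: ae_eq_sym.
Qed.

Lemma fiberZ (a : R[i]) v (l : R) : classE FT v -> 0 < l ->
  fib (a *: v) l = a *: fib v l %[ae sph].
Proof.
move=> Ev l0; have := fiber_lin FT_unitary a Ev (classE0 FT_unitary) l0.
have := fiber_ae0 FT_unitary (classE0 FT_unitary) (norm2_0 _) l0.
rewrite addr0; apply: filterS2 => x a1 a2 _.
by rewrite a2// !ptE a1// ptE addr0.
Qed.

Lemma fiber_add v w (l : R) : classE FT v -> classE FT w -> 0 < l ->
  fib (v + w) l = fib v l + fib w l %[ae sph].
Proof.
by move=> Ev Ew l0; have := fiber_lin FT_unitary 1 Ev Ew l0; rewrite !scale1r.
Qed.

Lemma classED v w : classE FT v -> classE FT w -> classE FT (v + w).
Proof.
by move=> Ev Ew; rewrite -[v]scale1r; exact: classE_lin.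
Qed.

Let Rint_off0 (f g : R -> R) : ib f -> ib g -> (forall l, l != 0 -> f l = g l) ->
  \int[mu1]_l f l = \int[mu1]_l g l.
Proof.
move=> /measurable_int mf /measurable_int mg fg; congr fine.
apply: ae_eq_integral => //; exists [set 0]; split => //.
  exact: lebesgue_measure_set1.
move=> l /= nE; apply/eqP; apply: contrapT => /negP l0; apply: nE => _.
by rewrite fg.
Qed.

Let Rint_quadratic (f g k : R -> R) : ib f -> ib g -> ib k ->
  \int[mu1]_l (f l + g l + 2 * k l) =
  \int[mu1]_l f l + \int[mu1]_l g l + 2 * \int[mu1]_l k l.
Proof.
move=> If Ig Ik; rewrite (RintegralD measurableT (intblD If Ig) (intblZ 2 Ik)).
by rewrite (RintegralD measurableT If Ig) (RintegralZl 2 measurableT Ik).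
Qed.

(** Polarization of the unitarity of the spectral representation. *)
Theorem inner_eta p v w : classE FT v -> classE FT w ->
  part p (inn3 v w) = \int[mu1]_l part p (Defs.eta FT v w l).
Proof.
suff ReE v' w' : classE FT v' -> classE FT w' ->
    Re (inn3 v' w') = \int[mu1]_l Re (Defs.eta FT v' w' l).
  move=> Ev Ew; case: p; rewrite /part; first exact: ReE.
  have Lv := L2_classE Ev; have Lw := L2_classE Ew.
  have Eiw := classEZ FT_unitary 'i%C Ew.
  have := ReE v ('i%C *: w) Ev Eiw; rewrite innerZr//.
  have iE (z : R[i]) : Re ('i^*%C * z) = Im z by case: z => x y /=; ring.
  rewrite iE => ->; apply: Rint_off0.
  - exact: (eta_integrable true).
  - exact: (eta_integrable false).
  move=> l; case: (ltgtP l 0) => // l0 _; first by rewrite !eta_neg.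
  have l0' := ltW l0; rewrite !eta_ge0// -iE -innerZr//; [|exact: L2_fiber..].
  congr (Re _); apply: inner_ae_r; [exact: L2_fiber..| |exact: fiberZ].
  by apply: L2Z; exact: L2_fiber.
move=> Ev Ew; have Lv := L2_classE Ev; have Lw := L2_classE Ew.
have Evw := classED Ev Ew.
have N := norm2D_sqr Lv Lw.
have Iv : ib (fun l => Re (Defs.eta FT v' v' l)) := eta_integrable true Ev Ev.
have Iw : ib (fun l => Re (Defs.eta FT w' w' l)) := eta_integrable true Ew Ew.
have Ivw : ib (fun l => Re (Defs.eta FT v' w' l)) := eta_integrable true Ev Ew.
have I1 := intblD Iv Iw; have I2 := intblZ 2 Ivw.
have Is := eta_integrable true Evw Evw.
rewrite (norm_eta Evw) (norm_eta Ev) (norm_eta Ew) in N.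
have : \int[mu1]_l Re (Defs.eta FT (v' + w') (v' + w') l) =
    \int[mu1]_l (Re (Defs.eta FT v' v' l) + Re (Defs.eta FT w' w' l)
      + 2 * Re (Defs.eta FT v' w' l)).
  apply: Rint_off0 => //.
    exact: (intblD I1 I2).
  move=> l; case: (ltgtP l 0) => // l0 _.
    by rewrite !eta_neg//= mulr0 !addr0.
  have l0' := ltW l0; rewrite !eta_ge0//.
  have Fv := L2_fiber Ev l0'; have Fw := L2_fiber Ew l0'.
  have Fs := L2_fiber Evw l0'; have Fs' := L2D Fv Fw.
  rewrite (inner_ae Fs Fs' Fs Fs' (fiber_add Ev Ew l0) (fiber_add Ev Ew l0)).
  exact: Re_innerD.
move=> S; have Q := Rint_quadratic Iv Iw Ivw.
have /addrI := etrans (esym N) (etrans S Q).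
by apply: mulfI; rewrite pnatr_eq0.
Qed.

(** Off [a] both fibers carry a factor [l - a]; at [a] both sides vanish. *)
Lemma eta_Phi u1 u2 v1 v2 (a l : R) : 0 < a -> classE FT u1 -> classE FT u2 ->
  is_Phi FT u1 a v1 -> is_Phi FT u2 a v2 -> nS (fib u1 a) = 0 ->
  Defs.eta FT u1 u2 l = ((l - a) ^+ 2)%:C * Defs.eta FT v1 v2 l.
Proof.
move=> a0 Eu1 Eu2 [Ev1 P1 _] [Ev2 P2 _] u10.
have [l0|l0] := leP 0 l; last by rewrite !eta_neg// mulr0.
rewrite !eta_ge0//.
have [->|la] := eqVneq l a.
  rewrite subrr expr0n/= mul0r inner_norm0l//; exact: L2_fiber (ltW a0).
have F1 := L2_fiber Eu1 l0; have F2 := L2_fiber Eu2 l0.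
have G1 := L2_fiber Ev1 l0; have G2 := L2_fiber Ev2 l0.
rewrite (inner_ae G1 (L2Z _ F1) G2 (L2Z _ F2) (P1 l l0 la) (P2 l l0 la)).
rewrite innerZl ?innerZr//; last exact: L2Z.
rewrite conjc_real !mulrA -!rmorphM/= expr2.
have -> : (l - a) * (l - a) * (l - a)^-1 * (l - a)^-1 = 1.
  by field; rewrite subr_eq0.
by rewrite mul1r.
Qed.

End SpectralDensities.

#[local] Transparent Defs.fiberD Defs.inner Defs.norm2.

(** * Principal values *)

Section PrincipalValues.
Variable R : realType.
Local Notation mu1 := (@lebesgue_measure R).
Local Notation ib z := (mu1.-integrable [set: R] (EFin \o z)).
Local Notation off l eps := [set x : R | (eps <= `|x - l|)%R].

Lemma measurable_off (l eps : R) : measurable (off l eps : set (measurableTypeR R)).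
Proof.
rewrite (_ : off l eps = (fun x => `|x - l|) @^-1` `[eps, +oo[); last first.
  by apply/seteqP; split => x /=; rewrite in_itv/= andbT.
rewrite -[X in measurable X]setTI.
have m : measurable_fun [set: R] (fun x : R => `|x - l|).
  by apply: measurableT_comp => //; exact: measurable_funB.
by apply: m => //; exact: measurable_itv.
Qed.

Lemma off_compl (l eps : R) : ~` off l eps = `]l - eps, l + eps[%classic.
Proof.
apply/seteqP; split => x /=; rewrite in_itv/=.
  move=> /negP; rewrite -ltNge ltr_norml => /andP[a b].
  by apply/andP; split; lra.
move=> /andP[a b]; apply/negP; rewrite -ltNge ltr_norml; lra.
Qed.

Lemma integrable_cst_fin (D : set (measurableTypeR R)) (k : R) : measurable D ->
  (mu1 D < +oo)%E -> mu1.-integrable D (EFin \o cst k).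
Proof.
move=> mD Doo; apply/integrableP; split; first by apply/measurable_EFinP; exact: measurable_cst.
by rewrite /= integral_cst// lte_mul_pinfty.
Qed.

(** The window that is removed has length [2 eps] and [h] is bounded on it. *)
Lemma Rint_punctured (h : R -> R) (l M e0 : R) : 0 < e0 -> ib h ->
  (forall x, `|x - l| < e0 -> `|h x| <= M) ->
  \int[mu1]_(x in off l eps) h x @[eps --> (0 : R)^'+] --> \int[mu1]_x h x.
Proof.
move=> e00 ih hM.
have M0 : 0 <= M by apply: le_trans (hM l _); rewrite ?subrr ?normr0.
have E eps : \int[mu1]_x h x = \int[mu1]_(x in off l eps) h x
    + \int[mu1]_(x in ~` off l eps) h x.
  rewrite -Rintegral_setU//.
  - by rewrite setUv.
  - exact: measurable_off.
  - by apply: measurableC; exact: measurable_off.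
  - by rewrite setUv.
  - by rewrite disj_set2E setICr.
have mI eps : measurable (`]l - eps, l + eps[%classic : set (measurableTypeR R)).
  exact: measurable_itv.
have ihI eps : mu1.-integrable `]l - eps, l + eps[ (EFin \o h).
  exact: integrableS ih.
have muI eps : 0 < eps -> mu1 `]l - eps, l + eps[%classic = (2 * eps)%:E.
  move=> eps0; rewrite lebesgue_measure_itv/= lte_fin ifT; last lra.
  by rewrite -EFinD; congr (_%:E); ring.
apply/cvgrPdist_le => e epos; near=> eps.
have eps0 : 0 < eps by near: eps; exact: nbhs_right_gt.
have epse0 : eps < e0 by near: eps; exact: nbhs_right_lt.
have epsM : eps * (2 * M + 1) < e.
  by rewrite -ltr_pdivlMr; [near: eps; apply: nbhs_right_lt; rewrite divr_gt0//; lra|lra].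
rewrite (E eps) addrAC subrr add0r off_compl.
have B := le_normr_Rintegral (mI eps) (ihI eps); apply: (le_trans B).
apply: (@le_trans _ _ (\int[mu1]_(x in `]l - eps, l + eps[) M)).
  apply: le_Rintegral => //.
  - exact: integrable_norm.
  - by apply: integrable_cst_fin => //; rewrite muI// ltry.
  - move=> x; rewrite /= in_itv/= => /andP[a b]; apply: hM.
    by rewrite ltr_norml; lra.
rewrite Rintegral_cst; last exact: mI.
rewrite [X in fine X](muI _ eps0) /=; nra.
Unshelve. all: end_near. Qed.

Section DividedDifferences.
Variables (z z1 : R -> R) (K : R).
Hypothesis z_tame : tame z z1 K.

Definition divdiff (l x : R) : R := if x == l then z1 l else (z x - z l) / (x - l).

Let K0 : 0 <= K.
Proof. by have [_ + _ _] := z_tame => /(_ 0); apply: le_trans; rewrite mulr_ge0// sqr_ge0. Qed.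

Lemma divdiff_sym l x : divdiff l x = divdiff x l.
Proof.
rewrite /divdiff eq_sym; case: eqP => [->//|_].
by rewrite -(opprB (z l)) -(opprB l) invrN mulrNN.
Qed.

Lemma tame_continuous (l : R) : 0 < l -> {for l, continuous z}.
Proof.
have [_ _ dz _] := z_tame => /dz[/derivable1_diffP d _].
exact: differentiable_continuous d.
Qed.

Lemma divdiff_MVT (x y : R) : 0 < x -> x <= y ->
  exists2 c, x <= c <= y & divdiff x y = z1 c.
Proof.
have [_ _ dz _] := z_tame => x0.
rewrite le_eqVlt => /predU1P[<-|xy].
  by exists x; rewrite ?lexx// /divdiff eqxx.
have dz' u : u \in `]x, y[ -> is_derive u 1 z (z1 u).
  by rewrite in_itv/= => /andP[xu _]; apply: dz; exact: lt_trans xu.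
have [|c] := MVT xy dz'.
  apply: continuous_in_subspaceT => u; rewrite inE/= in_itv/= => /andP[xu _].
  by apply: tame_continuous; exact: lt_le_trans xu.
rewrite in_itv/= => /andP[xc cy] E; exists c; first by rewrite !ltW.
by rewrite /divdiff gt_eqF// E mulfK// subr_eq0 gt_eqF.
Qed.

Let z1_lip (x y : R) : 0 < x -> 0 < y -> `|z1 x - z1 y| <= K * `|x - y|.
Proof. by have [_ _ _] := z_tame; exact. Qed.

(** The second divided differences of [z] are bounded by the Lipschitz constant
    of its derivative: this is the mean value theorem in each of the three
    positions of [x] relative to [y] and [y']. *)
Lemma divdiff_lip (x y y' : R) : 0 < x -> 0 < y -> 0 < y' ->
  `|divdiff y x - divdiff y' x| <= K * `|y - y'|.
Proof.
move=> x0; wlog yy' : y y' / y <= y'.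
  move=> H y0 y'0; case: (leP y y') => [|/ltW] yy'; first exact: H.
  by rewrite distrC (distrC y); exact: H.
move=> y0 y'0; rewrite (distrC y) (ger0_norm (_ : 0 <= y' - y)) ?subr_ge0//.
have [xy|yx] := leP x y.
  have [c1 /andP[xc1 c1y] E1] := divdiff_MVT x0 xy.
  have [c2 /andP[yc2 c2y] E2] := divdiff_MVT y0 yy'.
  have b : `|z1 c2 - z1 c1| <= K * (y' - x).
    apply: le_trans (z1_lip _ _) _; [lra|lra|].
    by rewrite ler_wpM2l// ger0_norm; lra.
  have [y'x|y'x] := eqVneq y' x.
    by rewrite (_ : y = x) ?y'x ?subrr ?normr0 ?mulr0//; lra.
  have d0 : 0 < y' - x by rewrite subr_gt0 lt_def y'x; lra.
  have -> : divdiff y x - divdiff y' x = (y - y') / (y' - x) * (z1 c2 - z1 c1).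
    rewrite -E1 -E2 !(divdiff_sym _ x) /divdiff (negPf y'x).
    have [yx|yx] := eqVneq y x.
      rewrite yx (negPf y'x); field.
      by rewrite gt_eqF.
    have [yy|yy] := eqVneq y' y.
      by rewrite yy !subrr !mul0r.
    by field; rewrite !subr_eq0 ?yx ?yy ?y'x.
  rewrite normrM normrM (ler0_norm (_ : y - y' <= 0)) ?subr_le0//.
  rewrite normfV (gtr0_norm d0) opprB -mulrA mulrC ler_wpM2r ?subr_ge0//.
  by rewrite mulrC ler_pdivrMr.
have [y'x|xy'] := leP y' x.
  have [c1 /andP[yc1 c1x] E1] := divdiff_MVT y'0 y'x.
  have [c2 /andP[yc2 c2y] E2] := divdiff_MVT y0 yy'.
  have b : `|z1 c2 - z1 c1| <= K * (x - y).
    apply: le_trans (z1_lip _ _) _; [lra|lra|].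
    by rewrite ler_wpM2l// ler_norml; lra.
  have d0 : 0 < x - y by rewrite subr_gt0.
  have -> : divdiff y x - divdiff y' x = (y' - y) / (x - y) * (z1 c2 - z1 c1).
    rewrite -E1 -E2 /divdiff (gt_eqF yx).
    have [xx|xx] := eqVneq x y'.
      rewrite -xx (gt_eqF yx); field.
      by rewrite gt_eqF.
    have [yy|yy] := eqVneq y' y.
      by rewrite yy !subrr !mul0r.
    by field; rewrite !subr_eq0 ?yy ?xx ?(gt_eqF yx).
  rewrite normrM normrM (ger0_norm (_ : 0 <= y' - y)) ?subr_ge0//.
  rewrite normfV (gtr0_norm d0) -mulrA mulrC ler_wpM2r ?subr_ge0//.
  by rewrite mulrC ler_pdivrMr.
have [c1 /andP[yc1 c1x] E1] := divdiff_MVT y0 (ltW yx).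
have [c2 /andP[yc2 c2y] E2] := divdiff_MVT x0 (ltW xy').
rewrite E1 (divdiff_sym y') E2; apply: le_trans (z1_lip _ _) _; [lra|lra|].
by rewrite ler_wpM2l// ler_norml; lra.
Qed.

Lemma divdiff_continuous (l x : R) : 0 < l -> 0 < x ->
  {for x, continuous (divdiff l)}.
Proof.
move=> l0 x0; apply/cvgrPdist_lt => e e0.
have e0' : 0 < e / (K + 1) by rewrite divr_gt0// ltr_wpDl.
near=> y; have y0 : 0 < y by near: y; exact: lt_nbhsr.
rewrite !(divdiff_sym l); apply: le_lt_trans (divdiff_lip l0 x0 y0) _.
apply: (@le_lt_trans _ _ ((K + 1) * `|x - y|)).
  by rewrite ler_wpM2r// lerDl.
by rewrite mulrC -ltr_pdivlMr ?ltr_wpDl//.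
Unshelve. all: end_near. Qed.

Variable a : R.
Hypothesis a0 : 0 < a.
(* A window around [a] inside the half-line on which [z] is differentiable; the
   points at distance less than [a / 4] from [a] stay [a / 4] away from its
   ends. *)
Let c := a / 2.
Let b := 3 * a / 2.
Local Notation W := `[c, b]%classic.

(** A closed form of the principal value: the singularity at [l] is removed by
    the divided difference, and the principal value of [1 / (x - l)] over the
    fixed window [W] is a difference of logarithms. *)
Definition pvE (l : R) : R :=
  \int[mu1]_(x in ~` W) (z x / (x - l)) + \int[mu1]_(x in W) divdiff l x
  + z l * (ln (b - l) - ln (l - c)).

Let mW : measurable (W : set (measurableTypeR R)). Proof. exact: measurable_itv. Qed.

Let near_a (l : R) : `|l - a| < a / 4 ->
  [/\ 0 < l, c < l, l < b & a / 4 < l - c /\ a / 4 < b - l].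
Proof. by rewrite ltr_norml /c /b => /andP[? ?]; split; [lra..|split; lra]. Qed.

Lemma measurable_inv_sub (l : R) : measurable_fun [set: R] (fun x => (x - l)^-1).
Proof.
have mv : measurable_fun [set: R] (fun x : R => x^-1).
  have -> : [set: R] = `]-oo, 0[ `|` ([set 0] `|` `]0, +oo[).
    apply/seteqP; split => // x _; rewrite /= !in_itv/= andbT.
    by case: (ltgtP x 0) => [x0|x0|->]; [left|right; right|right; left].
  apply/measurable_funU; [exact: measurable_itv| |split].
    by apply: measurableU => //; exact: measurable_itv.
    apply: open_continuous_measurable_fun; first exact: interval_open.
    move=> x; rewrite inE/= in_itv/= => x0.
    by apply: cvgV => //; rewrite lt_eqF.
  apply/measurable_funU; [by []|exact: measurable_itv|split].
    exact: measurable_fun_set1.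
  apply: open_continuous_measurable_fun; first exact: interval_open.
  move=> x; rewrite inE/= in_itv/= andbT => x0.
  by apply: cvgV => //; rewrite gt_eqF.
by apply: (measurableT_comp mv); exact: measurable_funB.
Qed.

Let iz : ib z. Proof. by have [] := tame_integrable z_tame. Qed.

Let mz : measurable_fun [set: R] z. Proof. by have [] := z_tame. Qed.

Let out_dist (l x : R) : `|l - a| < a / 4 -> (~` W) x -> a / 4 <= `|x - l|.
Proof.
move=> /near_a[l0 cl lb [d1 d2]] /= /negP; rewrite in_itv/= negb_and -!ltNge.
move=> /orP[xc|bx]; last by apply: le_trans (ler_norm _); lra.
by rewrite distrC; apply: le_trans (ler_norm _); lra.
Qed.

Let int_out (l : R) : `|l - a| < a / 4 ->
  mu1.-integrable (~` W) (EFin \o (fun x => z x / (x - l))).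
Proof.
move=> la; have iz' : mu1.-integrable (~` W) (EFin \o (fun x => 4 / a * z x)).
  by apply: integrableS (intblZ (4 / a) iz) => //; exact: measurableC.
apply: (le_integrable _ _ _ iz'); first exact: measurableC.
  apply/measurable_EFinP; apply: measurable_funTS; apply: measurable_funM => //.
  exact: measurable_inv_sub.
move=> x xW /=; rewrite lee_fin !normrM mulrC ler_wpM2r//.
rewrite normfV -normrM (ger0_norm (_ : 0 <= 4 / a)) ?divr_ge0 ?(ltW a0)//.
rewrite -[4 / a]invrK invf_div lef_pV2 ?posrE ?divr_gt0//.
  exact: out_dist.
by apply: lt_le_trans (out_dist la xW); rewrite divr_gt0.
Qed.

Let int_in (l : R) : `|l - a| < a / 4 ->
  mu1.-integrable W (EFin \o divdiff l).
Proof.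
move=> /near_a[l0 _ _ _].
apply: continuous_compact_integrable; first exact: segment_compact.
apply: continuous_in_subspaceT => x; rewrite inE/= in_itv/= => /andP[cx _].
have cx' : a / 2 <= x := cx; apply: divdiff_continuous => //; apply: lt_le_trans cx'.
by rewrite divr_gt0.
Qed.

Let int_right (l eps : R) : 0 < eps -> l + eps < b ->
  \int[mu1]_(x in `[l + eps, b]) (x - l)^-1 = ln (b - l) - ln eps.
Proof.
move=> e0 leb; have lle : l < l + eps by rewrite ltrDl.
have D (x : R) : l < x -> is_derive x 1 (fun y => ln (y - l)) (x - l)^-1.
  move=> lx; have lx0 : 0 < x - l by rewrite subr_gt0.
  have dl : is_derive x 1 (fun y : R => y - l) 1.
    by apply: is_derive_eq; rewrite subr0.
  have := @is_derive1_comp R (@ln R) (fun y => y - l) x _ _ (is_derive1_ln lx0) dl.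
  by rewrite /GRing.scale /= mulr1.
have C (x : R) : l < x -> {for x, continuous (fun y => ln (y - l))}.
  move=> lx; have [/derivable1_diffP d _] := D x lx.
  exact: differentiable_continuous d.
rewrite /Rintegral (@continuous_FTC2 _ _ (fun y => ln (y - l)))//.
- by rewrite -EFinB/=; congr (ln _ - ln _); ring.
- apply: continuous_in_subspaceT => x; rewrite inE/= in_itv/= => /andP[lx _].
  apply: cvgV; first by rewrite gt_eqF// subr_gt0; exact: lt_le_trans lx.
  by apply: cvgB; [exact: cvg_id|exact: cvg_cst].
- split.
  + move=> x; rewrite in_itv/= => /andP[lx _].
    by have [] := D x (lt_trans lle lx).
  + by apply: cvg_at_right_filter; exact: C.
  + by apply: cvg_at_left_filter; apply: C; exact: lt_trans leb.
- move=> x; rewrite in_itv/= => /andP[lx _]; rewrite derive1E.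
  by have [_ ->] := D x (lt_trans lle lx).
Qed.

Let int_left (l eps : R) : 0 < eps -> c < l - eps ->
  \int[mu1]_(x in `[c, l - eps]) (x - l)^-1 = ln eps - ln (l - c).
Proof.
move=> e0 cle; have lel : l - eps < l by rewrite ltrBlDr ltrDl.
have D (x : R) : x < l -> is_derive x 1 (fun y => ln (l - y)) (x - l)^-1.
  move=> xl; have lx0 : 0 < l - x by rewrite subr_gt0.
  have dl : is_derive x 1 (fun y : R => l - y) (- 1).
    by apply: is_derive_eq; ring.
  have := @is_derive1_comp R (@ln R) (fun y => l - y) x _ _ (is_derive1_ln lx0) dl.
  by rewrite /GRing.scale /= mulrN1 -invrN opprB.
have C (x : R) : x < l -> {for x, continuous (fun y => ln (l - y))}.
  move=> lx; have [/derivable1_diffP d _] := D x lx.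
  exact: differentiable_continuous d.
rewrite /Rintegral (@continuous_FTC2 _ _ (fun y => ln (l - y)))//.
- by rewrite -EFinB/=; congr (ln _ - ln _); ring.
- apply: continuous_in_subspaceT => x; rewrite inE/= in_itv/= => /andP[_ xl].
  apply: cvgV; first by rewrite lt_eqF// subr_lt0; exact: le_lt_trans lel.
  by apply: cvgB; [exact: cvg_id|exact: cvg_cst].
- split.
  + move=> x; rewrite in_itv/= => /andP[_ xl].
    by have [] := D x (lt_trans xl lel).
  + by apply: cvg_at_right_filter; apply: C; exact: lt_trans lel.
  + by apply: cvg_at_left_filter; exact: C.
- move=> x; rewrite in_itv/= => /andP[_ xl]; rewrite derive1E.
  by have [_ ->] := D x (lt_trans xl lel).
Qed.

Lemma integrable_off_quotient (l eps : R) : 0 < eps ->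
  mu1.-integrable (off l eps) (EFin \o (fun x => z x / (x - l))).
Proof.
move=> e0; have mO := measurable_off l eps.
have iz' : mu1.-integrable (off l eps) (EFin \o (fun x => eps^-1 * z x)).
  by apply: integrableS (intblZ eps^-1 iz) => //.
apply: (le_integrable mO _ _ iz').
  apply/measurable_EFinP; apply: measurable_funTS; apply: measurable_funM => //.
  exact: measurable_inv_sub.
move=> x /= ox; rewrite lee_fin !normrM mulrC ler_wpM2r// !normfV.
rewrite (ger0_norm (ltW e0)) lef_pV2 ?posrE//.
exact: lt_le_trans ox.
Qed.

(** Inside the window, the logarithms of [eps] that come from the two sides of the
    singularity cancel. *)
Lemma pv_cvg (l : R) : `|l - a| < a / 4 ->
  \int[mu1]_(x in off l eps) (z x / (x - l)) @[eps --> (0 : R)^'+] --> pvE l.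
Proof.
move=> la; have [l0 cl lb [d1 d2]] := near_a la.
have a4 : 0 < a / 4 by rewrite divr_gt0.
have ipatch : ib (divdiff l \_ W).
  by rewrite -restrict_EFin; apply/(integrable_mkcond _ mW); exact: int_in.
have [M MP] : exists M, forall x, `|x - l| < a / 4 -> `|(divdiff l \_ W) x| <= M.
  exists (`|z1 l| + K * (a / 4)) => x xl.
  have xW : x \in W.
    by move: xl; rewrite inE/= in_itv/= ltr_norml => /andP[? ?]; apply/andP; split; lra.
  have x0 : 0 < x by move: xl; rewrite ltr_norml /c in cl * => /andP[? ?]; lra.
  rewrite patchE xW -[divdiff l x](subrK (z1 l)).
  apply: le_trans (ler_normD _ _) _; rewrite addrC lerD2l.
  have E : z1 l = divdiff l l by rewrite /divdiff eqxx.
  rewrite E !(divdiff_sym l); apply: le_trans (divdiff_lip l0 x0 l0) _.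
  by rewrite ler_wpM2l// ltW.
have P := Rint_punctured a4 ipatch MP.
rewrite -Rintegral_mkcond in P.
pose P2 (eps : R) := \int[mu1]_(x in ~` W) (z x / (x - l))
  + \int[mu1]_(x in off l eps) (divdiff l \_ W) x
  + z l * (ln (b - l) - ln (l - c)).
have Lim : P2 eps @[eps --> (0 : R)^'+] --> pvE l.
  by apply: cvgD; [apply: cvgD; [exact: cvg_cst|exact: P]|exact: cvg_cst].
suff PE : \forall eps \near (0 : R)^'+,
    \int[mu1]_(x in off l eps) (z x / (x - l)) = P2 eps.
  apply/cvgrPdist_le => e e0; have /cvgrPdist_le/(_ e e0) := Lim.
  by apply: filterS2 PE => eps ->.
near=> eps.
have e0 : 0 < eps by near: eps; exact: nbhs_right_gt.
have ea : eps < a / 4 by near: eps; exact: nbhs_right_lt.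
have mO := measurable_off l eps.
have Owc : ~` W `<=` off l eps.
  by move=> x /(out_dist la) /=; apply: le_trans; exact: ltW.
have OE : off l eps = ~` W `|` (W `&` off l eps).
  apply/seteqP; split => x.
    by move=> ox; have [xW|xW] := pselect (W x); [right|left].
  by move=> [/Owc|[]].
have OWE : W `&` off l eps = `[c, l - eps] `|` `[l + eps, b].
  apply/seteqP; split => x /=; rewrite !in_itv/=.
    move=> [/andP[cx xb]]; case: (leP x l) => xl.
      by rewrite distrC ger0_norm ?subr_ge0// => h; left; apply/andP; split; lra.
    by rewrite ger0_norm ?subr_ge0 ?(ltW xl)// => h; right; apply/andP; split; lra.
  move=> [|] /andP[x1 x2]; split; try (apply/andP; split; lra).
    by rewrite distrC; apply: le_trans (ler_norm _); lra.
  by apply: le_trans (ler_norm _); lra.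
have mOW : measurable (W `&` off l eps : set (measurableTypeR R)).
  exact: (measurableI _ _ mW mO).
have Owfin : (mu1 (W `&` off l eps) < +oo)%E.
  apply: (@le_lt_trans _ _ (mu1 W)).
    by apply: le_measure; rewrite ?inE.
  by rewrite lebesgue_measure_itv/=; case: ifPn => _; rewrite ?ltry// -EFinD ltry.
have ioff := integrable_off_quotient l e0.
have iinv : mu1.-integrable (W `&` off l eps) (EFin \o (fun x => (x - l)^-1)).
  apply: (le_integrable mOW _ _ (integrable_cst_fin eps^-1 mOW Owfin)).
    by apply/measurable_EFinP; apply: measurable_funTS; exact: measurable_inv_sub.
  move=> x [_ /= ox]; rewrite lee_fin normfV (ger0_norm (_ : 0 <= eps^-1)); last first.
    by rewrite invr_ge0 ltW.
  by rewrite lef_pV2 ?posrE//; exact: lt_le_trans ox.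
have idd : mu1.-integrable (W `&` off l eps) (EFin \o divdiff l).
  by apply: integrableS (int_in la) => //.
have izinv : mu1.-integrable (W `&` off l eps) (EFin \o (fun x => z l * (x - l)^-1)).
  by have := integrableZl mOW (z l) iinv; apply: eq_integrable.
have zE x : (W `&` off l eps) x -> z x / (x - l) = divdiff l x + z l * (x - l)^-1.
  move=> [_ /= ox]; rewrite /divdiff; case: eqP => [xl|_].
    by move: ox; rewrite xl subrr normr0 leNgt e0.
  by rewrite -mulrDl subrK.
have isum : mu1.-integrable (W `&` off l eps)
    (EFin \o (fun x => divdiff l x + z l * (x - l)^-1)).
  by have := integrableD mOW idd izinv; apply: eq_integrable.
rewrite [in LHS]OE /P2 Rintegral_setU//; last 3 first.
- exact: measurableC.
- by rewrite -OE.
- by rewrite disj_set2E setIA setICl set0I.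
have -> : \int[mu1]_(x in W `&` off l eps) (z x / (x - l)) =
    \int[mu1]_(x in W `&` off l eps) (divdiff l x + z l * (x - l)^-1).
  by apply: eq_Rintegral => x; rewrite inE => /zE.
rewrite RintegralD// RintegralZl// -addrA; congr (_ + _).
rewrite -Rintegral_mkcondr; congr (_ + _ * _); first by rewrite setIC.
rewrite OWE Rintegral_setU//.
- have leb : l + eps < b by lra.
  have cle : c < l - eps by lra.
  by rewrite (int_left e0 cle) (int_right e0 leb); ring.
- by rewrite -OWE.
- rewrite disj_set2E; apply/eqP/seteqP; split => // x /= [].
  rewrite !in_itv/= => /andP[? ?] /andP[? ?]; lra.
Unshelve. all: end_near. Qed.

Let ln_lip (m u v : R) : 0 < m -> m <= u -> m <= v ->
  `|ln u - ln v| <= m^-1 * `|u - v|.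
Proof.
move=> m0; wlog uv : u v / v <= u.
  move=> H mu mv; case: (leP v u) => [|/ltW] uv; first exact: H.
  by rewrite distrC (distrC u); exact: H.
move=> mu mv; have v0 : 0 < v by exact: lt_le_trans mv.
have u0 : 0 < u by exact: lt_le_trans mu.
rewrite !ger0_norm ?subr_ge0 ?ler_ln ?posrE//.
rewrite -ln_div ?posrE//.
have -> : u / v = 1 + (u - v) / v by field; rewrite gt_eqF.
have q0 : 0 <= (u - v) / v by rewrite divr_ge0 ?subr_ge0// ltW.
apply: le_trans (le_ln1Dx _) _; first by apply: lt_le_trans q0; rewrite ltrN10.
rewrite mulrC ler_wpM2r ?subr_ge0// lef_pV2 ?posrE//.
Qed.

Let z_bound (l : R) : `|z l| <= K.
Proof.
have [_ + _ _] := z_tame => /(_ l); apply: le_trans.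
rewrite ler_peMl//; have := sqr_ge0 l; move: (l ^+ 2) => x x0; nra.
Qed.

Lemma tame_lip (l l' : R) : `|l - a| < a / 4 -> `|l' - a| < a / 4 ->
  `|z l - z l'| <= (`|z1 a| + K * a) * `|l - l'|.
Proof.
wlog ll : l l' / l <= l'.
  move=> H la l'a; case: (leP l l') => [|/ltW] ll; first exact: H.
  by rewrite distrC (distrC l); exact: H.
move=> la l'a; have [l0 _ _ _] := near_a la.
have [c0 /andP[lc cl'] E] := divdiff_MVT l0 ll.
have [->|nl] := eqVneq l l'; first by rewrite !subrr !normr0 mulr0.
have -> : z l - z l' = z1 c0 * (l - l').
  rewrite -E /divdiff (negPf (_ : l' != l)); last by rewrite eq_sym.
  by field; rewrite subr_eq0 eq_sym.
rewrite normrM ler_wpM2r// -[z1 c0](subrK (z1 a)).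
apply: le_trans (ler_normD _ _) _; rewrite addrC lerD2l.
apply: le_trans (z1_lip _ a0) _; first exact: lt_le_trans lc.
rewrite ler_wpM2l//.
move: la l'a; rewrite !ltr_norml => /andP[? ?] /andP[? ?].
rewrite ler_norml; apply/andP; split; lra.
Qed.

(** Outside the window the kernel is Lipschitz in [l], inside the divided
    differences are, and the logarithms are evaluated away from [0]. *)
Lemma pvE_lip : exists2 M, 0 <= M & forall l l',
  `|l - a| < a / 4 -> `|l' - a| < a / 4 -> `|pvE l - pvE l'| <= M * `|l - l'|.
Proof.
have a4 : 0 < a / 4 by rewrite divr_gt0.
have mWC : measurable (~` W : set (measurableTypeR R)) by exact: measurableC.
have izC : mu1.-integrable (~` W) (EFin \o (fun x => `|z x|)).
  by apply: integrable_norm; apply: integrableS iz.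
pose N := \int[mu1]_(x in ~` W) `|z x|.
pose A := (a / 4)^-1.
have A0 : 0 < A by rewrite invr_gt0.
have N0 : 0 <= N by apply: Rintegral_ge0 => x _.
exists (A ^+ 2 * N + K * (b - c) + ((`|z1 a| + K * a) * 2 + K * (2 * A))).
  have bc0 : 0 <= b - c by rewrite /b /c; move: a0; lra.
  have Ka0 : 0 <= K * a by rewrite mulr_ge0// ltW.
  have KA0 : 0 <= K * (2 * A) by rewrite !mulr_ge0// ltW.
  have AN0 : 0 <= A ^+ 2 * N by rewrite mulr_ge0// sqr_ge0.
  have Kb0 : 0 <= K * (b - c) by rewrite mulr_ge0.
  have z0 : 0 <= `|z1 a| by [].
  by move: Ka0 KA0 AN0 Kb0 z0; move: (K * a) (K * (2 * A)) (A ^+ 2 * N) (K * (b - c)) `|z1 a| => *; lra.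
move=> l l' la l'a.
have T1 : `|\int[mu1]_(x in ~` W) (z x / (x - l)) - \int[mu1]_(x in ~` W) (z x / (x - l'))|
    <= A ^+ 2 * N * `|l - l'|.
  have il := int_out la; have il' := int_out l'a.
  have id : mu1.-integrable (~` W) (EFin \o (fun x => z x / (x - l) - z x / (x - l'))).
    by have := integrableB mWC il il'; apply: eq_integrable.
  rewrite -RintegralB//.
  apply: le_trans (le_normr_Rintegral mWC id) _.
  have iN : mu1.-integrable (~` W) (EFin \o (fun x => A ^+ 2 * `|l - l'| * `|z x|)).
    by have := integrableZl mWC (A ^+ 2 * `|l - l'|) izC; apply: eq_integrable.
  have -> : A ^+ 2 * N * `|l - l'| = \int[mu1]_(x in ~` W) (A ^+ 2 * `|l - l'| * `|z x|).
    by rewrite RintegralZl// -/N; ring.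
  apply: le_Rintegral => //; first exact: integrable_norm.
  move=> x xW; have d1 := out_dist la xW; have d2 := out_dist l'a xW.
  have n1 : x - l != 0 by rewrite -normr_gt0; exact: lt_le_trans d1.
  have n2 : x - l' != 0 by rewrite -normr_gt0; exact: lt_le_trans d2.
  have -> : z x / (x - l) - z x / (x - l') = (x - l)^-1 * (x - l')^-1 * (l - l') * z x.
    by field; rewrite n1 n2.
  rewrite 3!normrM ler_wpM2r// ler_wpM2r// expr2 !normfV ler_pM ?invr_ge0//.
    by rewrite lef_pV2 ?posrE ?normr_gt0.
  by rewrite lef_pV2 ?posrE ?normr_gt0.
have T2 : `|\int[mu1]_(x in W) divdiff l x - \int[mu1]_(x in W) divdiff l' x|
    <= K * (b - c) * `|l - l'|.
  have il := int_in la; have il' := int_in l'a.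
  have [l0 _ _ _] := near_a la; have [l'0 _ _ _] := near_a l'a.
  have id : mu1.-integrable W (EFin \o (fun x => divdiff l x - divdiff l' x)).
    by have := integrableB mW il il'; apply: eq_integrable.
  have cb : c < b by rewrite /c /b; lra.
  have muW : mu1 W = (b - c)%:E by rewrite lebesgue_measure_itv/= lte_fin cb -EFinB.
  rewrite -RintegralB//.
  apply: le_trans (le_normr_Rintegral mW id) _.
  have -> : K * (b - c) * `|l - l'| = \int[mu1]_(x in W) (K * `|l - l'|).
    by rewrite Rintegral_cst// [X in fine X]muW /=; ring.
  apply: le_Rintegral => //; first exact: integrable_norm.
    by apply: integrable_cst_fin => //; rewrite [X in (X < _)%E]muW ltry.
  move=> x; rewrite /= in_itv/= => /andP[cx _]; apply: divdiff_lip => //.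
  by apply: lt_le_trans cx; rewrite /c divr_gt0.
have T3 : `|z l * (ln (b - l) - ln (l - c)) - z l' * (ln (b - l') - ln (l' - c))|
    <= ((`|z1 a| + K * a) * 2 + K * (2 * A)) * `|l - l'|.
  have LL u v : `|u - a| < a / 4 -> `|v - a| < a / 4 ->
      `|(ln (b - u) - ln (u - c)) - (ln (b - v) - ln (v - c))| <= 2 * A * `|u - v|.
    move=> /near_a[_ _ _ [u1 u2]] /near_a[_ _ _ [v1 v2]].
    have -> : (ln (b - u) - ln (u - c)) - (ln (b - v) - ln (v - c)) =
      (ln (b - u) - ln (b - v)) + (ln (v - c) - ln (u - c)) by ring.
    apply: le_trans (ler_normD _ _) _.
    have := ln_lip a4 (ltW u2) (ltW v2); have := ln_lip a4 (ltW v1) (ltW u1).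
    rewrite (_ : b - u - (b - v) = v - u); last ring.
    rewrite (_ : v - c - (u - c) = v - u); last ring.
    rewrite -/A (distrC v u); lra.
  have La : `|ln (b - l) - ln (l - c)| <= 2.
    have a1 : `|a - a| < a / 4 by rewrite subrr normr0.
    have := LL l a la a1; rewrite (_ : b - a = a - c); last by rewrite /b /c; field.
    rewrite subrr subr0 => /le_trans; apply.
    have -> : 2 * A * `|l - a| = 2 * (A * `|l - a|) by rewrite mulrA.
    rewrite ler_piMr//.
    have <- : A * (a / 4) = 1 by rewrite /A mulVf// gt_eqF.
    by rewrite ler_wpM2l ?ltW//.
  have -> : z l * (ln (b - l) - ln (l - c)) - z l' * (ln (b - l') - ln (l' - c)) =
    (z l - z l') * (ln (b - l) - ln (l - c))
    + z l' * ((ln (b - l) - ln (l - c)) - (ln (b - l') - ln (l' - c))) by ring.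
  apply: le_trans (ler_normD _ _) _; rewrite !normrM mulrDl; apply: lerD.
    rewrite mulrAC; apply: ler_pM => //; exact: tame_lip.
  by rewrite -mulrA; apply: ler_pM => //; exact: LL.
have -> : pvE l - pvE l' =
  (\int[mu1]_(x in ~` W) (z x / (x - l)) - \int[mu1]_(x in ~` W) (z x / (x - l')))
  + (\int[mu1]_(x in W) divdiff l x - \int[mu1]_(x in W) divdiff l' x)
  + (z l * (ln (b - l) - ln (l - c)) - z l' * (ln (b - l') - ln (l' - c))).
  rewrite /pvE; ring.
rewrite (mulrDl (A ^+ 2 * N + K * (b - c))).
apply: le_trans (ler_normD _ _) _; apply: (lerD _ T3).
rewrite (mulrDl (A ^+ 2 * N)).
by apply: le_trans (ler_normD _ _) _; exact: lerD.
Qed.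

(** A double zero at [a] gives the singular integral an expansion of second order:
    [(x - a)^2 = (x - l) ((x - a) + (l - a)) + (l - a)^2]. *)
Lemma pv_double_zero (k : R) (h : R -> R) (l : R) :
  (forall x, h x = k * ((x - a) ^+ 2 * z x)) -> `|l - a| < a / 4 ->
  pv h l = k * (\int[mu1]_x ((x - a) * z x) + (l - a) * \int[mu1]_x z x
    + (l - a) ^+ 2 * pvE l).
Proof.
move=> hE la; have [l0 _ _ _] := near_a la.
have a4 : 0 < a / 4 by rewrite divr_gt0.
have [_ ixz] := tame_integrable z_tame.
have i1 : ib (fun x => (x - a) * z x).
  have := intblD ixz (intblZ (- a) iz); apply: eq_integrable => // x _ /=.
  by congr (_%:E); ring.
have zb := z_bound.
have c0 := Rint_punctured a4 iz (fun x _ => zb x).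
have c1 : \int[mu1]_(x in off l eps) ((x - a) * z x) @[eps --> (0 : R)^'+]
    --> \int[mu1]_x ((x - a) * z x).
  apply: (Rint_punctured (M := a * K) a4 i1) => x xl.
  rewrite normrM ler_pM//; move: xl la; rewrite !ltr_norml => /andP[? ?] /andP[? ?].
  by rewrite ler_norml; apply/andP; split; lra.
apply/cvg_lim => //.
pose P2 eps := k * (\int[mu1]_(x in off l eps) ((x - a) * z x)
  + (l - a) * \int[mu1]_(x in off l eps) z x
  + (l - a) ^+ 2 * \int[mu1]_(x in off l eps) (z x / (x - l))).
have Lim : P2 eps @[eps --> (0 : R)^'+] --> k * (\int[mu1]_x ((x - a) * z x)
    + (l - a) * \int[mu1]_x z x + (l - a) ^+ 2 * pvE l).
  apply: cvgM; first exact: cvg_cst.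
  apply: cvgD; [apply: cvgD => //|]; apply: cvgM => //; try exact: cvg_cst.
  exact: pv_cvg.
suff PE : \forall eps \near (0 : R)^'+,
    \int[mu1]_(x in off l eps) (h x / (x - l)) = P2 eps.
  apply/cvgrPdist_le => e e0; have /cvgrPdist_le/(_ e e0) := Lim.
  by apply: filterS2 PE => eps ->.
near=> eps; have e0 : 0 < eps by near: eps; exact: nbhs_right_gt.
have mO := measurable_off l eps.
have j1 : mu1.-integrable (off l eps) (EFin \o (fun x => (x - a) * z x)).
  exact: integrableS i1.
have j2 : mu1.-integrable (off l eps) (EFin \o z) by exact: integrableS iz.
have j3 : mu1.-integrable (off l eps) (EFin \o (fun x => z x / (x - l))).
  exact: integrable_off_quotient.
have j2' : mu1.-integrable (off l eps) (EFin \o (fun x => (l - a) * z x)).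
  by have := integrableZl mO (l - a) j2; apply: eq_integrable.
have j3' : mu1.-integrable (off l eps) (EFin \o (fun x => (l - a) ^+ 2 * (z x / (x - l)))).
  by have := integrableZl mO ((l - a) ^+ 2) j3; apply: eq_integrable.
have j12 : mu1.-integrable (off l eps) (EFin \o (fun x => (x - a) * z x + (l - a) * z x)).
  by have := integrableD mO j1 j2'; apply: eq_integrable.
rewrite /P2 -(RintegralZl _ mO j2) -(RintegralZl _ mO j3) -(RintegralD mO j1 j2').
rewrite -(RintegralD mO j12 j3').
have j123 : mu1.-integrable (off l eps) (EFin \o (fun x =>
    (x - a) * z x + (l - a) * z x + (l - a) ^+ 2 * (z x / (x - l)))).
  by have := integrableD mO j12 j3'; apply: eq_integrable.
rewrite -(RintegralZl _ mO j123); apply: eq_Rintegral => x; rewrite inE /= => ox.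
have xl : x - l != 0 by rewrite -normr_gt0; exact: lt_le_trans ox.
rewrite hE; field; exact: xl.
Unshelve. all: end_near. Qed.

End DividedDifferences.
End PrincipalValues.

(** * Pairs of two-by-two matrices near a degenerate point *)

Section TwoByTwo.
Variable R : realType.
Local Notation M2 := 'M[R[i]]_2.
Implicit Types X Y : M2.

Lemma addM2E X Y j k : (X + Y) j k = X j k + Y j k. Proof. by rewrite mxE. Qed.
Lemma scaleM2E (a : R[i]) X j k : (a *: X) j k = a * X j k. Proof. by rewrite mxE. Qed.
Lemma scalarM2E (a : R[i]) j k : (a%:M : M2) j k = a *+ (j == k).
Proof. by rewrite mxE. Qed.

Lemma zeroM2E j k : (0 : M2) j k = 0. Proof. by rewrite mxE. Qed.

Definition M2E := (addM2E, scaleM2E, scalarM2E, zeroM2E).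

Lemma ord2P (P : 'I_2 -> Prop) : P 0 -> P 1 -> forall j, P j.
Proof.
move=> P0 P1 [[|[|m]] mlt] //.
  by have -> : Ordinal mlt = 0 by apply: val_inj.
by have -> : Ordinal mlt = 1 by apply: val_inj.
Qed.

Lemma sum2 (V : nmodType) (f : 'I_2 -> V) : \sum_(j < 2) f j = f 0 + f 1.
Proof.
by rewrite big_ord_recl big_ord1; congr (_ + f _); apply: val_inj.
Qed.

Let lift00 : lift (0 : 'I_2) (0 : 'I_1) = 1. Proof. exact: val_inj. Qed.
Let lift10 : lift (1 : 'I_2) (0 : 'I_1) = 0. Proof. exact: val_inj. Qed.

Lemma cofactor2 X : [/\ cofactor X 0 0 = X 1 1, cofactor X 0 1 = - X 1 0,
  cofactor X 1 0 = - X 0 1 & cofactor X 1 1 = X 0 0].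
Proof.
by split; rewrite /cofactor det_mx11 !mxE ?lift00 ?lift10 /= ?expr0 ?mul1r
  ?expr1 ?mulN1r// sqrrN expr1n mul1r.
Qed.

Lemma det2 X : \det X = X 0 0 * X 1 1 - X 0 1 * X 1 0.
Proof.
have [c00 c01 _ _] := cofactor2 X.
by rewrite (expand_det_row _ 0) sum2 c00 c01 mulrN.
Qed.

(** The polar form of the determinant, which is a quadratic form in size two. *)
Definition polar_det X Y : R[i] :=
  X 0 0 * Y 1 1 + X 1 1 * Y 0 0 - X 0 1 * Y 1 0 - X 1 0 * Y 0 1.

Lemma detD2 X Y : \det (X + Y) = \det X + polar_det X Y + \det Y.
Proof. by rewrite !det2 /polar_det !mxE; ring. Qed.

Lemma detZ2 (a : R[i]) X : \det (a *: X) = a ^+ 2 * \det X.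
Proof. by rewrite !det2 !mxE; ring. Qed.

Lemma polar_detZl (a : R[i]) X Y : polar_det (a *: X) Y = a * polar_det X Y.
Proof. by rewrite /polar_det !mxE; ring. Qed.

Lemma polar_detZr (a : R[i]) X Y : polar_det X (a *: Y) = a * polar_det X Y.
Proof. by rewrite /polar_det !mxE; ring. Qed.

Lemma cofactorZ2 (a : R[i]) X j k : cofactor (a *: X) j k = a * cofactor X j k.
Proof.
have [x00 x01 x10 x11] := cofactor2 X.
have [y00 y01 y10 y11] := cofactor2 (a *: X).
by elim/ord2P: j; elim/ord2P: k; rewrite ?(x00, x01, x10, x11) ?(y00, y01, y10, y11)
  scaleM2E ?mulrN.
Qed.

Lemma polar_det_cofactor X Y : polar_det X Y = \sum_j \sum_k cofactor X j k * Y j k.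
Proof.
have [x00 x01 x10 x11] := cofactor2 X.
by rewrite !sum2 x00 x01 x10 x11 /polar_det; ring.
Qed.

Definition mcvg (T : Type) (F : set_system T) (f : T -> M2) (X : M2) : Prop :=
  forall j k, ccvg F (fun t => f t j k) (X j k).

Section Convergence.
Variables (T : Type) (F : set_system T).
Context {FF : Filter F}.

Lemma near_eq_ccvg (f g : T -> R[i]) (z : R[i]) :
  (\forall t \near F, f t = g t) -> ccvg F f z -> ccvg F g z.
Proof.
move=> fg [f1 f2]; split.
- by apply: cvg_trans f1; apply: near_eq_cvg; apply: filterS fg => t ->.
- by apply: cvg_trans f2; apply: near_eq_cvg; apply: filterS fg => t ->.
Qed.

Lemma near_eq_cvgr (f g : T -> R) (a : R) :
  (\forall t \near F, f t = g t) -> f t @[t --> F] --> a -> g t @[t --> F] --> a.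
Proof.
by move=> fg; apply: cvg_trans; apply: near_eq_cvg; apply: filterS fg => t ->.
Qed.

Lemma ccvgB (f g : T -> R[i]) (z w : R[i]) : ccvg F f z -> ccvg F g w ->
  ccvg F (fun t => f t - g t) (z - w).
Proof.
move=> fz gw.
have -> : (fun t => f t - g t) = (fun t => f t + (-1) * g t).
  by apply/funext => t; rewrite mulN1r.
by rewrite -(mulN1r w); apply: ccvgD => //; apply: ccvgM => //; exact: ccvg_cst.
Qed.

Lemma mcvg_det (f : T -> M2) X : mcvg F f X -> ccvg F (fun t => \det (f t)) (\det X).
Proof.
move=> fX; rewrite det2; under eq_fun do rewrite det2.
by apply: ccvgB; apply: ccvgM.
Qed.

Lemma mcvg_cofactor (f : T -> M2) X j k : mcvg F f X ->
  ccvg F (fun t => cofactor (f t) j k) (cofactor X j k).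
Proof.
move=> fX; have N (g : T -> R[i]) z : ccvg F g z -> ccvg F (fun t => - g t) (- z).
  move=> gz; rewrite -(sub0r z); under eq_fun do rewrite -sub0r.
  by apply: ccvgB => //; exact: ccvg_cst.
have [x00 x01 x10 x11] := cofactor2 X.
elim/ord2P: j; elim/ord2P: k.
- rewrite x00; under eq_fun => t do have [-> _ _ _] := cofactor2 (f t).
  exact: fX.
- rewrite x01; under eq_fun => t do have [_ -> _ _] := cofactor2 (f t).
  exact: N.
- rewrite x10; under eq_fun => t do have [_ _ -> _] := cofactor2 (f t).
  exact: N.
- rewrite x11; under eq_fun => t do have [_ _ _ ->] := cofactor2 (f t).
  exact: fX.
Qed.

Lemma mcvg_polar_det (f g : T -> M2) X Y : mcvg F f X -> mcvg F g Y ->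
  ccvg F (fun t => polar_det (f t) (g t)) (polar_det X Y).
Proof.
move=> fX gY; rewrite /polar_det.
by apply: ccvgB; [apply: ccvgB; [apply: ccvgD|]|]; apply: ccvgM.
Qed.

Lemma mcvgD (f g : T -> M2) X Y : mcvg F f X -> mcvg F g Y ->
  mcvg F (fun t => f t + g t) (X + Y).
Proof.
move=> fX gY j k; rewrite mxE; under eq_fun do rewrite mxE.
exact: ccvgD.
Qed.

Lemma mcvgZ (a : T -> R[i]) (f : T -> M2) (z : R[i]) X :
  ccvg F a z -> mcvg F f X -> mcvg F (fun t => a t *: f t) (z *: X).
Proof.
move=> az fX j k; rewrite mxE; under eq_fun do rewrite mxE.
exact: ccvgM.
Qed.

Lemma mcvg_cst X : mcvg F (fun _ => X) X.
Proof. by move=> j k; exact: ccvg_cst. Qed.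

Lemma near_eq_mcvg (f g : T -> M2) X :
  (\forall t \near F, f t = g t) -> mcvg F f X -> mcvg F g X.
Proof. by move=> fg fX j k; apply: near_eq_ccvg (fX j k); apply: filterS fg => t ->. Qed.

End Convergence.

Definition hermitian2 X := forall j k, X k j = (X j k)^*%C.

Lemma hermitian2E X : hermitian2 X ->
  [/\ X 0 0 = (Re (X 0 0))%:C, X 1 1 = (Re (X 1 1))%:C & X 1 0 = (X 0 1)^*%C].
Proof.
move=> hX; split; last exact: hX.
- have := hX 0 0; case: (X 0 0) => x y [] /eqP; rewrite -addr_eq0 -mulr2n mulrn_eq0 /=.
  by move=> /eqP ->.
- have := hX 1 1; case: (X 1 1) => x y [] /eqP; rewrite -addr_eq0 -mulr2n mulrn_eq0 /=.
  by move=> /eqP ->.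
Qed.

(** With [X = C] and [Y = D] this reads [F1 = det C - det D], and identifies [F2]
    with the polar form of the determinant. *)
Lemma det_hermitian2 X Y : hermitian2 X -> hermitian2 Y ->
  [/\ Re (\det (X + 'i%C *: Y)) = Re (\det X) - Re (\det Y),
      Im (\det (X + 'i%C *: Y)) = Re (polar_det X Y),
      Im (polar_det X Y) = 0 & Im (\det X) = 0].
Proof.
move=> hX hY; have [x0 x1 x2] := hermitian2E hX; have [y0 y1 y2] := hermitian2E hY.
rewrite /polar_det !det2 !mxE x0 x1 x2 y0 y1 y2.
have [] : Re ('i%C : R[i]) = 0 /\ Im ('i%C : R[i]) = 1 by [].
move: ('i%C : R[i]) => w Re_i Im_i.
split; rewrite !(reimE, Re_i, Im_i); move: (Re (X 0 0)) (Re (X 1 1)) (Re (Y 0 0))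
  (Re (Y 1 1)) (Re (X 0 1)) (Im (X 0 1)) (Re (Y 0 1)) (Im (Y 0 1)) => *; ring.
Qed.

(** If [det X = det Y >= 0] with [Y] a multiple of a positive matrix, then
    [polar_det X Y * tr Y = det Y * tr X + polar_det X (Y ^ 2)] by
    Cayley-Hamilton, where both terms on the right have the sign of [tr X]. Here
    [X] has diagonal entries [c1, c2] and off-diagonal entry [cr + i ci], and [Y]
    is [t] times the matrix of [p1, p2] and [pr + i qi]. *)
Lemma det_le_polar_det (c1 c2 cr ci p1 p2 pr qi t : R) :
  0 <= p1 -> 0 <= p2 -> pr ^+ 2 + qi ^+ 2 <= p1 * p2 ->
  c1 * c2 - cr ^+ 2 - ci ^+ 2 = t ^+ 2 * (p1 * p2 - pr ^+ 2 - qi ^+ 2) ->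
  `|(t ^+ 2 * (p1 * p2 - pr ^+ 2 - qi ^+ 2)) * (c1 + c2)|
    <= `|t * (c1 * p2 + c2 * p1 - 2 * (cr * pr + ci * qi))| * `|t * (p1 + p2)|.
Proof.
move=> p10 p20 pp E.
pose D := p1 * p2 - pr ^+ 2 - qi ^+ 2.
pose S1 := p1 ^+ 2 + pr ^+ 2 + qi ^+ 2.
pose S2 := p2 ^+ 2 + pr ^+ 2 + qi ^+ 2.
have D0 : 0 <= D by rewrite /D; lra.
have sq (x : R) : 0 <= x ^+ 2 by exact: sqr_ge0.
wlog cc : c1 c2 cr ci E / 0 <= c1 + c2.
  move=> H; have [/H|/ltW c0] := leP 0 (c1 + c2); first exact.
  have E' : (- c1) * (- c2) - (- cr) ^+ 2 - (- ci) ^+ 2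
      = t ^+ 2 * (p1 * p2 - pr ^+ 2 - qi ^+ 2) by rewrite -E; ring.
  have c0' : 0 <= - c1 + - c2 by lra.
  have := H _ _ _ _ E' c0'.
  rewrite (_ : - c1 + - c2 = - (c1 + c2)); last ring.
  rewrite mulrN normrN.
  rewrite (_ : t * (- c1 * p2 + - c2 * p1 - 2 * (- cr * pr + - ci * qi))
    = - (t * (c1 * p2 + c2 * p1 - 2 * (cr * pr + ci * qi)))); last ring.
  by rewrite normrN.
have cc2 : cr ^+ 2 + ci ^+ 2 <= c1 * c2.
  have : 0 <= t ^+ 2 * D by rewrite mulr_ge0.
  by rewrite -E; lra.
have c12 : 0 <= c1 * c2 by apply: le_trans cc2; rewrite addr_ge0.
have [c10 c20] : 0 <= c1 /\ 0 <= c2.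
  by have [h1|h1] := leP 0 c1; have [h2|h2] := leP 0 c2; split; nra.
have S10 : 0 <= S1 by rewrite /S1 !addr_ge0.
have S20 : 0 <= S2 by rewrite /S2 !addr_ge0.
pose w := (p1 + p2) * (cr * pr + ci * qi).
have N0 : 0 <= c1 * S2 + c2 * S1 - 2 * w.
  suff : `|2 * w| <= `|c1 * S2 + c2 * S1|.
    have cS : 0 <= c1 * S2 + c2 * S1 by rewrite addr_ge0 ?mulr_ge0.
    by rewrite (ger0_norm cS) subr_ge0; apply: le_trans; exact: ler_norm.
  rewrite -(@ler_pXn2r _ 2)// ?nnegrE// !real_normK ?num_real//.
  have w2 : w ^+ 2 <= (cr ^+ 2 + ci ^+ 2) * ((p1 + p2) ^+ 2 * (pr ^+ 2 + qi ^+ 2)).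
    have -> : (cr ^+ 2 + ci ^+ 2) * ((p1 + p2) ^+ 2 * (pr ^+ 2 + qi ^+ 2))
        = w ^+ 2 + ((p1 + p2) * (cr * qi - ci * pr)) ^+ 2 by rewrite /w; ring.
    by rewrite lerDl.
  have SS : (p1 + p2) ^+ 2 * (pr ^+ 2 + qi ^+ 2) <= S1 * S2.
    have -> : S1 * S2 = (p1 + p2) ^+ 2 * (pr ^+ 2 + qi ^+ 2) + D ^+ 2.
      by rewrite /S1 /S2 /D; ring.
    by rewrite lerDl.
  have w3 : w ^+ 2 <= (c1 * c2) * (S1 * S2).
    by apply: le_trans w2 _; rewrite ler_pM// ?addr_ge0// mulr_ge0// ?addr_ge0.
  have -> : (2 * w) ^+ 2 = 4 * w ^+ 2 by ring.
  have -> : (c1 * S2 + c2 * S1) ^+ 2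
      = (c1 * S2 - c2 * S1) ^+ 2 + 4 * ((c1 * c2) * (S1 * S2)) by ring.
  by have := sq (c1 * S2 - c2 * S1); lra.
rewrite -normrM.
have -> : t * (c1 * p2 + c2 * p1 - 2 * (cr * pr + ci * qi)) * (t * (p1 + p2))
    = t ^+ 2 * (D * (c1 + c2) + (c1 * S2 + c2 * S1 - 2 * w)).
  by rewrite /D /S1 /S2 /w; ring.
have r0 : 0 <= D * (c1 + c2) by rewrite mulr_ge0.
have r1 : 0 <= D * (c1 + c2) + (c1 * S2 + c2 * S1 - 2 * w) by rewrite addr_ge0.
rewrite -/D -(mulrA _ D) (ger0_norm (mulr_ge0 (sq t) r0)).
by rewrite (ger0_norm (mulr_ge0 (sq t) r1)) ler_wpM2l// lerDl.
Qed.

Definition positive2 X := [/\ hermitian2 X, 0 <= Re (X 0 0), 0 <= Re (X 1 1) &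
  normc (X 0 1) ^+ 2 <= Re (X 0 0) * Re (X 1 1)].

Lemma det_le_polar_det2 X Y (t : R) : hermitian2 X -> positive2 Y ->
  Re (\det X) = Re (\det (t%:C *: Y)) ->
  `|Re (\det (t%:C *: Y)) * Re (\tr X)|
    <= `|Re (polar_det X (t%:C *: Y))| * `|Re (\tr (t%:C *: Y))|.
Proof.
move=> hX [hY Y0 Y1 Y2].
have [x0 x1 x2] := hermitian2E hX; have [y0 y1 y2] := hermitian2E hY.
move: Y2; rewrite normc_sqr.
rewrite /polar_det /mxtrace !sum2 !det2 !mxE x0 x1 x2 y0 y1 y2.
move: Y0 Y1; move: (Re (X 0 0)) (Re (X 1 1)) (Re (Y 0 0)) (Re (Y 1 1)) => c1 c2 p1 p2 p10 p20.
case: (X 0 1) (Y 0 1) => cr ci [pr qi]; rewrite !reimE /= => pp E.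
have E' : c1 * c2 - cr ^+ 2 - ci ^+ 2 = t ^+ 2 * (p1 * p2 - pr ^+ 2 - qi ^+ 2).
  by lra.
have tr (x y z x' y' z' : R) : x = x' -> y = y' -> z = z' ->
  `|x| <= `|y| * `|z| -> `|x'| <= `|y'| * `|z'| by move=> -> -> ->.
by apply: tr (det_le_polar_det p10 p20 pp E'); ring.
Qed.

End TwoByTwo.

(** * Matrix pencils *)

Section Pencils.
Variables (R : realType) (alpha0 lam0 : R).
Local Notation M2 := 'M[R[i]]_2.
Local Notation F := (alpha0^').
Implicit Types (c y d : R -> R) (G : M2) (P : R -> M2) (alpha : R).

Definition near_lip P : Prop := exists r K : R, [/\ 0 < r, 0 <= K & forall l l' j k,
  `|l - lam0| < r -> `|l' - lam0| < r -> normc (P l j k - P l' j k) <= K * `|l - l'|].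

(** The common shape of the matrices [C], [D] and [B]. When [c] vanishes at
    [alpha0], the entries vanish at [(alpha0, lam0)]; for [c = 0] and [G = 0] they
    vanish to second order. *)
Definition pencil c G P alpha (l : R) : M2 :=
  ((c alpha)%:C)%:M
  + alpha%:C *: ((l - lam0)%:C *: G + ((l - lam0) ^+ 2)%:C *: P l).

Lemma pencilE c G P alpha (l : R) j k : pencil c G P alpha l j k =
  (c alpha)%:C *+ (j == k)
  + alpha%:C * ((l - lam0)%:C * G j k + ((l - lam0) ^+ 2)%:C * P l j k).
Proof. by rewrite !mxE. Qed.

#[local] Opaque pencil.

Lemma near_tau : \forall alpha \near F, alpha - alpha0 != 0.
Proof. by near=> alpha; rewrite subr_eq0; near: alpha; exact: nbhs_dnbhs_neq. Unshelve. all: end_near. Qed.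

Lemma cvg_alpha : alpha @[alpha --> F] --> alpha0.
Proof. exact: (@nbhs_dnbhs R alpha0). Qed.

Lemma cvg_tau : alpha - alpha0 @[alpha --> F] --> (0 : R).
Proof. by rewrite -(subrr alpha0); apply: cvgB; [exact: cvg_alpha|exact: cvg_cst]. Qed.

Lemma cvg_path y (L : R) : (y alpha - lam0) / (alpha - alpha0) @[alpha --> F] --> L ->
  y alpha - lam0 @[alpha --> F] --> (0 : R).
Proof.
move=> yL; rewrite -(mulr0 L).
apply: cvg_trans (cvgM yL cvg_tau); apply: near_eq_cvg.
by near=> alpha => /=; rewrite /GRing.mul_fun /= divfK//; near: alpha; exact: near_tau.
Unshelve. all: end_near. Qed.

Lemma near_small y (r : R) : 0 < r -> y alpha @[alpha --> F] --> (0 : R) ->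
  \forall alpha \near F, `|y alpha| < r.
Proof.
move=> r0 /cvgrPdist_lt/(_ r r0); apply: filterS => alpha.
by rewrite sub0r normrN.
Qed.

Lemma near_lip_cvg P y : near_lip P -> y alpha - lam0 @[alpha --> F] --> (0 : R) ->
  mcvg F (fun alpha => P (y alpha)) (P lam0).
Proof.
move=> [r [K [r0 K0 PK]]] y0 j k; apply: ccvg_normc.
have b : K * `|y alpha - lam0| @[alpha --> F] --> (0 : R).
  have := cvgM (cvg_cst K) (cvg_norm y0).
  by rewrite normr0 mulr0; exact.
apply: (squeeze_cvgr _ (cvg_cst 0) b); near=> alpha.
rewrite normc_ge0/=; apply: PK; last by rewrite subrr normr0.
by near: alpha; exact: near_small.
Unshelve. all: end_near. Qed.

Lemma ccvg_real0 (f : R -> R) : f alpha @[alpha --> F] --> (0 : R) ->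
  ccvg F (fun alpha => (f alpha)%:C) 0.
Proof. by move=> f0; exact: (ccvg_real f0). Qed.

(** Only the terms of first order in [alpha - alpha0] and [lam - lam0] survive the
    division. *)
Lemma pencil_cvg c G P y (c1 L : R) : near_lip P ->
  c alpha / (alpha - alpha0) @[alpha --> F] --> c1 ->
  (y alpha - lam0) / (alpha - alpha0) @[alpha --> F] --> L ->
  mcvg F (fun alpha => ((alpha - alpha0)^-1)%:C *: pencil c G P alpha (y alpha))
    ((c1%:C)%:M + (alpha0 * L)%:C *: G).
Proof.
move=> Plip cc yL; have y0 := cvg_path yL.
have lim : mcvg F (fun alpha => (c alpha / (alpha - alpha0))%:C *: 1%:M +
    (alpha * ((y alpha - lam0) / (alpha - alpha0)))%:C *:
      (G + (y alpha - lam0)%:C *: P (y alpha)))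
    (c1%:C *: 1%:M + (alpha0 * L)%:C *: (G + 0 *: P lam0)).
  apply: mcvgD; apply: mcvgZ.
  - exact: ccvg_real.
  - exact: mcvg_cst.
  - by apply: ccvg_real; apply: cvgM => //; exact: cvg_alpha.
  - apply: mcvgD; first exact: mcvg_cst.
    by apply: mcvgZ; [exact: ccvg_real0|exact: near_lip_cvg].
rewrite scale0r addr0 in lim; rewrite -scalemx1; apply: near_eq_mcvg lim.
near=> alpha; apply/matrixP => j k; rewrite !(pencilE, M2E).
have t0 : (alpha - alpha0)%:C != 0.
  have t0 : alpha - alpha0 != 0 by near: alpha; exact: near_tau.
  by apply: contra t0 => /eqP[->].
rewrite !rmorphM/= !fmorphV/=.
move: t0; move: (_%:C)^-1 (c alpha)%:C => *.
by case: (j == k); rewrite ?mulr1n ?mulr0n; ring.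
Unshelve. all: end_near. Qed.

Lemma pencil2_cvg P y (L : R) : near_lip P ->
  (y alpha - lam0) / (alpha - alpha0) @[alpha --> F] --> L ->
  mcvg F (fun alpha => ((alpha - alpha0) ^- 2)%:C *: pencil (fun=> 0) 0 P alpha (y alpha))
    ((alpha0 * L ^+ 2)%:C *: P lam0).
Proof.
move=> Plip yL; have y0 := cvg_path yL.
have lim : mcvg F (fun alpha =>
    (alpha * ((y alpha - lam0) / (alpha - alpha0)) ^+ 2)%:C *: P (y alpha))
    ((alpha0 * L ^+ 2)%:C *: P lam0).
  apply: mcvgZ; last exact: near_lip_cvg.
  by apply: ccvg_real; apply: cvgM; [exact: cvg_alpha|apply: cvgM].
apply: near_eq_mcvg lim.
near=> alpha; apply/matrixP => j k; rewrite !(pencilE, M2E).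
have t0 : (alpha - alpha0)%:C != 0.
  have t0 : alpha - alpha0 != 0 by near: alpha; exact: near_tau.
  by apply: contra t0 => /eqP[->].
rewrite !(rmorphM, rmorphXn, fmorphV)/= mul0rn mulr0 !add0r.
move: t0; move: ((alpha - alpha0)%:C) => t t0.
by field.
Unshelve. all: end_near. Qed.

(** Moving along [lam] by [d] changes a pencil by [d] times a matrix close to
    its first order coefficient. *)
Lemma pencil_diff c G P y d : near_lip P ->
  y alpha - lam0 @[alpha --> F] --> (0 : R) -> d alpha @[alpha --> F] --> (0 : R) ->
  exists2 W, mcvg F W (alpha0%:C *: G) & forall alpha,
    pencil c G P alpha (y alpha + d alpha)
      = pencil c G P alpha (y alpha) + (d alpha)%:C *: W alpha.
Proof.
move=> Plip y0 d0; have [r [K [r0 K0 PK]]] := Plip.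
have yd0 : y alpha + d alpha - lam0 @[alpha --> F] --> (0 : R).
  rewrite -(addr0 0); under eq_fun do rewrite addrAC.
  exact: cvgD.
pose q alpha j k := (((y alpha - lam0) ^+ 2)%:C * (d alpha)^-1%:C) *
  (P (y alpha + d alpha) j k - P (y alpha) j k).
pose w alpha j k := alpha%:C * (G j k
    + ((2 * (y alpha - lam0) + d alpha)%:C * P (y alpha + d alpha) j k + q alpha j k)).
exists (fun alpha => \matrix_(j, k) w alpha j k).
  move=> j k; have -> : (fun alpha => (\matrix_(j, k) w alpha j k) j k) = w^~ j ^~ k.
    by apply/funext => alpha; rewrite mxE.
  rewrite mxE -[G j k]addr0.
  have -> : (0 : R[i]) = 0 * P lam0 j k + 0 by rewrite mul0r addr0.
  apply: ccvgM; first by apply: ccvg_real; exact: cvg_alpha.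
  apply: ccvgD; first exact: ccvg_cst.
  apply: ccvgD.
    apply: ccvgM; last exact: near_lip_cvg.
    apply: ccvg_real0; rewrite -(addr0 0); apply: cvgD => //.
    by rewrite -(mulr0 2); apply: cvgM => //; exact: cvg_cst.
  apply: ccvg_normc.
  have b : `|y alpha - lam0| ^+ 2 * K @[alpha --> F] --> (0 : R).
    rewrite -(mul0r K); apply: cvgM; last exact: cvg_cst.
    rewrite -(mulr0 `|0 : R|) normr0 mulr0.
    have := cvgM (cvg_norm y0) (cvg_norm y0).
    by rewrite normr0 mulr0; exact.
  apply: (squeeze_cvgr _ (cvg_cst 0) b); near=> alpha.
  rewrite normc_ge0/= subr0 /q !Normc.normcM -mulrA.
  rewrite !normc_real normrX ler_wpM2l ?exprn_ge0//.
  have [->|dn] := eqVneq (d alpha) 0.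
    by rewrite invr0 normr0 mul0r.
  rewrite normfV mulrC ler_pdivrMr ?normr_gt0//.
  apply: le_trans (PK _ _ _ _ _ _) _.
  - by near: alpha; exact: near_small.
  - by near: alpha; exact: near_small.
  - by rewrite addrAC subrr add0r.
move=> alpha; apply/matrixP => j k.
rewrite !(pencilE, M2E) mxE /w /q.
have [->|dn] := eqVneq (d alpha) 0.
  by rewrite !addr0 mul0r addr0.
have dnC : (d alpha)%:C != 0 by apply: contra dn => /eqP[->].
rewrite (_ : y alpha + d alpha - lam0 = (y alpha - lam0) + d alpha); last ring.
move: (y alpha - lam0) => x.
move: (G j k) (P _ j k) (P _ j k) (_ *+ _) => g p p' c0.
rewrite !(rmorphD, rmorphM, rmorphXn, rmorphB, fmorphV)/=.
by field.
Unshelve. all: end_near. Qed.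

End Pencils.
#[global] Opaque pencil.

(** * Asymptotics along the resonance curves *)

Section Resonance.
Variables (R : realType) (alpha0 lam0 : R).
Local Notation M2 := 'M[R[i]]_2.
Local Notation F := (alpha0^').
Variables (G : M2) (P Z : R -> M2).
Hypotheses (alpha0_neq0 : alpha0 != 0) (P_lip : near_lip lam0 P)
  (Z_lip : near_lip lam0 Z) (Z_pos : forall l, positive2 (Z l)).

Definition Cpencil := pencil lam0 (fun alpha => 1 - alpha / alpha0) G P.
Definition Dpencil := pencil lam0 (fun=> 0) 0 Z.
Local Notation C := Cpencil.
Local Notation D := Dpencil.
Local Notation B alpha l := (C alpha l + 'i%C *: D alpha l).

Variable r0 : R.
Hypothesis r00 : 0 < r0.
Hypothesis C_herm : forall alpha l, `|l - lam0| < r0 -> hermitian2 (C alpha l).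

Variables (y : R -> R) (L : R).
Hypothesis y_slope : (y alpha - lam0) / (alpha - alpha0) @[alpha --> F] --> L.
Let F2 alpha := Im (\det (B alpha (y alpha))).
Hypothesis F1_zero : \forall alpha \near F, Re (\det (B alpha (y alpha))) = 0.
Hypothesis F2_neq0 : \forall alpha \near F, F2 alpha != 0.

Let M : M2 := ((- alpha0^-1)%:C)%:M + (alpha0 * L)%:C *: G.
Hypothesis trM_neq0 : Re (\tr M) != 0.

Local Notation tau alpha := (alpha - alpha0).

Let FF : Filter F := _.

Let pencilDZ c G0 (Q Q' : R -> M2) (a : R[i]) alpha l :
  pencil lam0 c G0 Q alpha l + a *: pencil lam0 (fun=> 0) 0 Q' alpha l
  = pencil lam0 c G0 (fun x => Q x + a *: Q' x) alpha l.
Proof.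
apply/matrixP => j k.
refine (etrans (addM2E _ _ _ _) (etrans (congr2 +%R (pencilE _ _ _ _ _ _ _ _)
  (etrans (scaleM2E _ _ _ _) (congr1 _ (pencilE _ _ _ _ _ _ _ _))))
  (etrans _ (esym (pencilE _ _ _ _ _ _ _ _))))).
rewrite zeroM2E addM2E scaleM2E mul0rn mulr0 !add0r.
by move: (Q l j k) (Q' l j k) => *; ring.
Qed.

Lemma near_lipDi (Q Q' : R -> M2) : near_lip lam0 Q -> near_lip lam0 Q' ->
  near_lip lam0 (fun x => Q x + 'i%C *: Q' x).
Proof.
move=> [r [K [r_gt0 K0 QK]]] [r' [K' [r'0 K'0 QK']]].
exists (Num.min r r'), (K + K'); split.
- by rewrite lt_min r_gt0.
- by rewrite addr_ge0.
move=> l l' j k; rewrite !lt_min => /andP[lr lr'] /andP[l'r l'r'].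
rewrite !M2E.
have -> : Q l j k + 'i%C * Q' l j k - (Q l' j k + 'i%C * Q' l' j k)
    = (Q l j k - Q l' j k) + 'i%C * (Q' l j k - Q' l' j k) by ring.
apply: le_trans (le_normcD _ _) _; rewrite mulrDl; apply: lerD; first exact: QK.
by rewrite Normc.normcM normc_i mul1r; exact: QK'.
Qed.

Let Pi := fun x => P x + 'i%C *: Z x.
Let Pi_lip : near_lip lam0 Pi. Proof. exact: near_lipDi. Qed.

Let BE alpha l : B alpha l = pencil lam0 (fun alpha => 1 - alpha / alpha0) G Pi alpha l.
Proof. exact: pencilDZ. Qed.

Let DE alpha l : D alpha l = (alpha * (l - lam0) ^+ 2)%:C *: Z l.
Proof.
apply/matrixP => j k; rewrite [LHS]pencilE !M2E mul0rn mulr0 !add0r !rmorphM/=.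
by rewrite mulrA.
Qed.

Let c_slope : (1 - alpha / alpha0) / tau alpha @[alpha --> F] --> - alpha0^-1.
Proof.
apply: (near_eq_cvgr _ (cvg_cst (- alpha0^-1))); near=> alpha.
have t0 : tau alpha != 0 by near: alpha; exact: near_tau.
by rewrite /=; field; rewrite t0.
Unshelve. all: end_near. Qed.

Lemma B_slope (x : R -> R) : (x alpha - lam0) / tau alpha @[alpha --> F] --> L ->
  mcvg F (fun alpha => ((tau alpha)^-1)%:C *: B alpha (x alpha)) M.
Proof.
move=> xL; apply: near_eq_mcvg (pencil_cvg G Pi_lip c_slope xL).
by near=> alpha; rewrite BE.
Unshelve. all: end_near.
Qed.

Let C_slope : mcvg F (fun alpha => ((tau alpha)^-1)%:C *: C alpha (y alpha)) M.
Proof. exact: (pencil_cvg G P_lip c_slope y_slope). Qed.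

Let D_slope : mcvg F (fun alpha => (tau alpha ^- 2)%:C *: D alpha (y alpha))
  ((alpha0 * L ^+ 2)%:C *: Z lam0).
Proof. exact: (pencil2_cvg Z_lip y_slope). Qed.

Let tau0 : ccvg F (fun alpha => (tau alpha)%:C) 0.
Proof. by apply: ccvg_real0; exact: cvg_tau. Qed.

Let tauC : \forall alpha \near F, (tau alpha)%:C != 0.
Proof.
by apply: filterS (near_tau alpha0) => alpha; apply: contra => /eqP[->].
Qed.

Let D_slope0 : mcvg F (fun alpha => ((tau alpha)^-1)%:C *: D alpha (y alpha)) 0.
Proof.
have /(_ FF) := mcvgZ tau0 D_slope; rewrite scale0r; apply: near_eq_mcvg; near=> alpha.
have t0 : (tau alpha)%:C != 0 by near: alpha; exact: tauC.
rewrite scalerA; congr (_ *: _); rewrite !(fmorphV, rmorphXn)/=.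
by move: t0; move: (tau alpha)%:C => t t0; field.
Unshelve. all: end_near. Qed.

Let y0 : y alpha - lam0 @[alpha --> F] --> (0 : R).
Proof. exact: cvg_path y_slope. Qed.

Let near_path : \forall alpha \near F,
  [/\ hermitian2 (C alpha (y alpha)), hermitian2 (D alpha (y alpha)) &
      polar_det (C alpha (y alpha)) (D alpha (y alpha)) = (F2 alpha)%:C].
Proof.
near=> alpha.
have hC : hermitian2 (C alpha (y alpha)).
  by apply: C_herm; near: alpha; exact: near_small.
have hD : hermitian2 (D alpha (y alpha)).
  rewrite DE => j k; rewrite !M2E conjcM; have [hZ _ _ _] := Z_pos (y alpha).
  by rewrite hZ; congr (_ * _); apply: complex_ext; rewrite !reimE ?oppr0.
have [_ E2 E3 _] := det_hermitian2 hC hD.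
split => //; apply: complex_ext; rewrite ?ReZ ?ImZ ?E3// -E2.
Unshelve. all: end_near. Qed.

(** [F2] is the polar form of [C] and [D], which are of first and of second
    order. *)
Lemma F2_cvg3 : ccvg F (fun alpha => (F2 alpha)%:C / (tau alpha)%:C ^+ 3)
  (polar_det M ((alpha0 * L ^+ 2)%:C *: Z lam0)).
Proof.
have /(_ FF) := mcvg_polar_det C_slope D_slope; apply: near_eq_ccvg; near=> alpha.
have t0 : (tau alpha)%:C != 0 by near: alpha; exact: tauC.
have [_ _ <-] : [/\ hermitian2 (C alpha (y alpha)), hermitian2 (D alpha (y alpha)) &
  polar_det (C alpha (y alpha)) (D alpha (y alpha)) = (F2 alpha)%:C].
  by near: alpha; exact: near_path.
rewrite polar_detZl polar_detZr !(fmorphV, rmorphXn)/=.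
move: t0; move: (tau alpha)%:C => t t0.
by field.
Unshelve. all: end_near. Qed.

Let F2_cvg2 : F2 alpha / tau alpha ^+ 2 @[alpha --> F] --> (0 : R).
Proof.
have /(_ FF) := ccvgM tau0 F2_cvg3; rewrite mul0r => -[H _]; move: H.
apply: near_eq_cvgr; near=> alpha.
have t0 : tau alpha != 0 by near: alpha; exact: near_tau.
rewrite -!(fmorphV, rmorphXn) -!rmorphM /=.
by field.
Unshelve. all: end_near. Qed.

Let ratio_le (a b c e k : R) : k != 0 -> b != 0 -> c != 0 ->
  `|a * c| <= `|b| * `|e| -> `|a / b| <= `|k * e| / `|k * c|.
Proof.
move=> k0 b0 c0; rewrite !normrM normfV ler_pdivlMr ?mulr_gt0 ?normr_gt0//.
rewrite mulrAC ler_pdivrMr ?normr_gt0// => H.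
rewrite (_ : `|a| * (`|k| * `|c|) = `|k| * (`|a| * `|c|)); last ring.
rewrite (_ : `|k| * `|e| * `|b| = `|k| * (`|b| * `|e|)); last ring.
by rewrite ler_wpM2l.
Qed.

(** On the branch [det C = det D], so that [|det D / F2|] is at most the ratio of
    the traces of [D] and [C], which are of second and of first order. *)
Let detD_small : Re (\det (D alpha (y alpha))) / F2 alpha @[alpha --> F] --> (0 : R).
Proof.
have tr_cvg (f : R -> M2) X : mcvg F f X -> Re (\tr (f alpha)) @[alpha --> F] --> Re (\tr X).
  by move=> fX; have [] : ccvg F (fun alpha => \tr (f alpha)) (\tr X) by apply: ccvg_sum => j.
have trC := tr_cvg _ _ C_slope; have trD := tr_cvg _ _ D_slope0.
have trM0 : `|Re (\tr M)| != 0 by rewrite normr_eq0.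
have b := cvgM (cvg_norm trD) (cvgV trM0 (cvg_norm trC)).
rewrite [X in Re X](_ : _ = 0) in b; last by rewrite /mxtrace sum2 !M2E addr0.
rewrite /= normr0 mul0r in b; move/(_ FF FF FF FF) in b.
have bn : `|Re (\det (D alpha (y alpha))) / F2 alpha| @[alpha --> F] --> (0 : R).
  apply: (squeeze_cvgr _ (cvg_cst 0) b); near=> alpha.
  rewrite normr_ge0 /=.
  have [hC hD EF] : [/\ hermitian2 (C alpha (y alpha)), hermitian2 (D alpha (y alpha)) &
    polar_det (C alpha (y alpha)) (D alpha (y alpha)) = (F2 alpha)%:C].
    by near: alpha; exact: near_path.
  have F20 : F2 alpha != 0 by near: alpha.
  have t0 : tau alpha != 0 by near: alpha; exact: near_tau.
  have F10 : Re (\det (B alpha (y alpha))) = 0 by near: alpha.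
  have [E1 _ _ _] := det_hermitian2 hC hD.
  have CD : Re (\det (C alpha (y alpha))) = Re (\det (D alpha (y alpha))).
    by apply/eqP; rewrite -subr_eq0 -E1 F10.
  have trCn : Re (\tr (((tau alpha)^-1)%:C *: C alpha (y alpha))) != 0.
    by near: alpha; move/cvgrPdist_lt : trC => /(_ `|Re (\tr M)|);
      rewrite normr_gt0 => /(_ trM_neq0); apply: filterS => z; apply: contraTneq => ->;
      rewrite subr0 ltxx.
  have main := det_le_polar_det2 hC (Z_pos (y alpha)) (t := alpha * (y alpha - lam0) ^+ 2).
  rewrite -DE in main; have := main CD; rewrite EF ReZ => main'.
  have trZ (X : M2) (a : R) : Re (\tr (a%:C *: X)) = a * Re (\tr X).
    by rewrite mxtraceZ !reimE mul0r subr0.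
  rewrite !trZ in trCn *.
  move: trCn; rewrite mulf_eq0 negb_or => /andP[_ trCn].
  by apply: ratio_le; rewrite ?invr_eq0.
apply/cvgrPdist_lt => e e0; move/cvgrPdist_lt : bn => /(_ e e0).
by apply: filterS => alpha; rewrite !sub0r !normrN normr_id.
Unshelve. all: end_near. Qed.

(** The point of energy [h] widths away from the branch. *)
Variables (l : 'I_2) (n h : R).
Hypotheses (n_neq0 : n != 0) (Mll_neq0 : Re (cofactor M l l) != 0).
Let d alpha := h * (F2 alpha / (alpha * Re (cofactor (C alpha (y alpha)) l l) * n)).
Let rho := h / (alpha0 * Re (cofactor M l l) * n).

Let cof_slope : Re (cofactor (C alpha (y alpha)) l l) / tau alpha @[alpha --> F] -->
  Re (cofactor M l l).
Proof.
have [Ml Cl] : exists k, cofactor M l l = M k k /\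
    forall alpha, cofactor (C alpha (y alpha)) l l = C alpha (y alpha) k k.
  elim/ord2P: l; [exists 1|exists 0]; split => [|alpha].
  - by have [] := cofactor2 M.
  - by have [] := cofactor2 (C alpha (y alpha)).
  - by have [] := cofactor2 M.
  - by have [] := cofactor2 (C alpha (y alpha)).
case: Cl => -> Cl; have [H _] := C_slope Ml Ml.
apply: near_eq_cvgr H; near=> alpha.
by rewrite Cl M2E !reimE mul0r subr0 mulrC.
Unshelve. all: end_near. Qed.

Lemma rho_cvg : d alpha * tau alpha / F2 alpha @[alpha --> F] --> rho.
Proof.
have lim : h / (alpha * (Re (cofactor (C alpha (y alpha)) l l) / tau alpha) * n)
    @[alpha --> F] --> rho.
  apply: cvgM; first exact: cvg_cst.
  apply: cvgV; first by rewrite !mulf_neq0.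
  apply: cvgM; last exact: cvg_cst.
  by apply: cvgM; [exact: cvg_alpha|exact: cof_slope].
apply: near_eq_cvgr lim; near=> alpha.
have F20 : F2 alpha != 0 by near: alpha.
have t0 : tau alpha != 0 by near: alpha; exact: near_tau.
rewrite /d; move: (Re (cofactor _ l l)) => c.
have [->|c0] := eqVneq c 0.
  by rewrite !(mulr0, mul0r, invr0).
have [->|a0] := eqVneq alpha 0.
  by rewrite !(mulr0, mul0r, invr0).
by field; rewrite n_neq0 c0 a0 F20 t0.
Unshelve. all: end_near. Qed.

Lemma shift_small : d alpha / tau alpha @[alpha --> F] --> (0 : R).
Proof.
have /(_ FF) := cvgM rho_cvg F2_cvg2; rewrite mulr0; apply: near_eq_cvgr; near=> alpha.
have F20 : F2 alpha != 0 by near: alpha.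
have t0 : tau alpha != 0 by near: alpha; exact: near_tau.
by rewrite /GRing.mul_fun /=; field; rewrite F20 t0.
Unshelve. all: end_near. Qed.

Lemma shifted_slope : (y alpha + d alpha - lam0) / tau alpha @[alpha --> F] --> L.
Proof.
rewrite -(addr0 L); under eq_fun do rewrite addrAC mulrDl.
by apply: cvgD; [exact: y_slope|exact: shift_small].
Qed.

Let d0 : d alpha @[alpha --> F] --> (0 : R).
Proof.
have /(_ FF) := cvgM shift_small (@cvg_tau _ alpha0); rewrite mul0r.
apply: near_eq_cvgr; near=> alpha.
by rewrite /GRing.mul_fun /= divfK//; near: alpha; exact: near_tau.
Unshelve. all: end_near. Qed.

Let dCtau : ccvg F (fun alpha => (d alpha / tau alpha)%:C) 0.
Proof. by apply: ccvg_real0; exact: shift_small. Qed.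

Let rhoC : ccvg F (fun alpha => (d alpha * tau alpha / F2 alpha)%:C) rho%:C.
Proof. by apply: ccvg_real; exact: rho_cvg. Qed.

(** The relative size of the increment of a determinant under the shift. *)
Let det_shift (X W : R -> M2) X0 W0 :
  mcvg F (fun alpha => ((tau alpha)^-1)%:C *: X alpha) X0 -> mcvg F W W0 ->
  ccvg F (fun alpha => (\det (X alpha + (d alpha)%:C *: W alpha) - \det (X alpha))
      / (F2 alpha)%:C) (rho%:C * polar_det X0 W0).
Proof.
move=> XX WW.
have lim : ccvg F (fun alpha => (d alpha * tau alpha / F2 alpha)%:C *
    (polar_det (((tau alpha)^-1)%:C *: X alpha) (W alpha)
     + (d alpha / tau alpha)%:C * \det (W alpha)))
    (rho%:C * (polar_det X0 W0 + 0 * \det W0)).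
  apply: ccvgM; first exact: rhoC.
  apply: ccvgD; first exact: mcvg_polar_det.
  by apply: ccvgM; [exact: dCtau|exact: mcvg_det].
rewrite mul0r addr0 in lim; apply: near_eq_ccvg lim; near=> alpha.
have t0 : (tau alpha)%:C != 0 by near: alpha; exact: tauC.
have F20 : (F2 alpha)%:C != 0.
  have F20 : F2 alpha != 0 by near: alpha.
  by apply: contra F20 => /eqP[->].
rewrite detD2 detZ2 polar_detZl polar_detZr; move: (d alpha) => x.
rewrite !(rmorphM, fmorphV)/=.
move: t0 F20; move: (tau alpha)%:C (F2 alpha)%:C (\det _) (\det _) (polar_det _ _) => *.
by field; apply/andP.
Unshelve. all: end_near. Qed.

(** On the branch [det B = i F2], to which the shift adds the first variation of
    the determinant. *)
Lemma det_ratio : ccvg F (fun alpha => \det (B alpha (y alpha + d alpha)) / (F2 alpha)%:C)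
  ('i%C + rho%:C * polar_det M (alpha0%:C *: G)).
Proof.
have [W WG WE] := pencil_diff (fun alpha => 1 - alpha / alpha0) G Pi_lip y0 d0.
have /(_ FF FF) lim := ccvgD (ccvg_cst 'i%C) (det_shift (B_slope y_slope) WG).
apply: near_eq_ccvg lim; near=> alpha.
have F20 : (F2 alpha)%:C != 0.
  have F20 : F2 alpha != 0 by near: alpha.
  by apply: contra F20 => /eqP[->].
have E : \det (B alpha (y alpha + d alpha))
    = \det (B alpha (y alpha) + (d alpha)%:C *: W alpha).
  exact: (congr1 (fun X => \det X) (etrans (BE alpha (y alpha + d alpha))
    (etrans (WE alpha) (congr1 (fun X => X + _) (esym (BE alpha (y alpha))))))).
rewrite [in RHS]E.
have -> : \det (B alpha (y alpha)) = 'i%C * (F2 alpha)%:C.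
  have F10 : Re (\det (B alpha (y alpha))) = 0 by near: alpha.
  apply: complex_ext; rewrite !reimE ?F10 /= ?mulr0 ?mul0r ?mul1r ?subr0 ?add0r//.
by rewrite mulrBl mulfK// subrKC.
Unshelve. all: end_near. Qed.

(** The first variation of [det D] is negligible because [D] is of second
    order. *)
Lemma detD_ratio :
  ccvg F (fun alpha => \det (D alpha (y alpha + d alpha)) / (F2 alpha)%:C) 0.
Proof.
have [W WG WE] := pencil_diff (fun=> 0) 0 Z_lip y0 d0.
have /(_ FF FF) lim := ccvgD (ccvg_real detD_small) (det_shift D_slope0 WG).
rewrite add0r [polar_det _ _](_ : _ = 0) ?mulr0 in lim; last first.
  by rewrite /polar_det !M2E; ring.
apply: near_eq_ccvg lim; near=> alpha.
have [hC hD EF] : [/\ hermitian2 (C alpha (y alpha)), hermitian2 (D alpha (y alpha)) &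
    polar_det (C alpha (y alpha)) (D alpha (y alpha)) = (F2 alpha)%:C].
  by near: alpha; exact: near_path.
have [_ _ _ Im0] := det_hermitian2 hD hC.
have -> : (Re (\det (D alpha (y alpha))) / F2 alpha)%:C = \det (D alpha (y alpha)) / (F2 alpha)%:C.
  rewrite rmorphM fmorphV; congr (_ / _).
  by apply: complex_ext; rewrite !reimE.
by rewrite [D alpha (y alpha + d alpha)]WE mulrBl subrKC.
Unshelve. all: end_near. Qed.

End Resonance.

(** * Expansion of the perturbed model at the double eigenvalue *)

Section Expansion.
Variables (R : realType) (FT : (R3 R -> R[i]) -> (R3 R -> R[i])).
Hypothesis FT_unitary : unitary_op (leb3 R) FT.
Local Notation mu1 := (@lebesgue_measure R).
Implicit Types u v : R3 R -> R[i].

Definition first_moment (a : R) v1 v2 : R[i] :=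
  (\int[mu1]_x ((x - a) * Re (Defs.eta FT v1 v2 x)))
  +i* (\int[mu1]_x ((x - a) * Im (Defs.eta FT v1 v2 x))).

Definition expands (a : R) u1 u2 v1 v2 (p : R -> R[i]) (K : R) := [/\ 0 <= K,
  forall l l', `|l - a| < a / 4 -> `|l' - a| < a / 4 ->
    normc (p l - p l') <= K * `|l - l'| &
  forall l, `|l - a| < a / 4 ->
    gamma (Defs.eta FT u1 u2) l = first_moment a v1 v2
      + (l - a)%:C * inner (leb3 R) v1 v2 + ((l - a) ^+ 2)%:C * p l
    /\ gamma (Defs.eta FT u2 u1) l = (gamma (Defs.eta FT u1 u2) l)^*%C].

(** [pv_double_zero] applies to the real and imaginary parts; the integrals of the
    densities of [v1] and [v2] make up their inner product. *)
Lemma gamma_Phi (a : R) u1 u2 v1 v2 : 0 < a ->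
  classE FT u1 -> classE FT u2 -> is_Phi FT u1 a v1 -> is_Phi FT u2 a v2 ->
  norm2 (surface R) (fiber FT u1 a) = 0 ->
  exists p K, expands a u1 u2 v1 v2 p K.
Proof.
move=> a0 E1 E2 P1 P2 u0.
have V1 : classE FT v1 by case: P1.
have V2 : classE FT v2 by case: P2.
have [zr1 [Kr tr]] := eta_tame true V1 V2.
have [zi1 [Ki ti]] := eta_tame false V1 V2.
have [Mr Mr0 lr] := pvE_lip tr a0.
have [Mi Mi0 li] := pvE_lip ti a0.
pose pr := pvE (fun l : R => part true (Defs.eta FT v1 v2 l)) zr1 a.
pose qi := pvE (fun l : R => part false (Defs.eta FT v1 v2 l)) zi1 a.
have E (x : R) : Defs.eta FT u1 u2 x = ((x - a) ^+ 2)%:C * Defs.eta FT v1 v2 x.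
  exact: (eta_Phi x a0 E1 E2 P1 P2 u0).
have E' (x : R) : Defs.eta FT u2 u1 x = ((x - a) ^+ 2)%:C * (Defs.eta FT v1 v2 x)^*%C.
  rewrite (eta_conj x E1 E2) E conjcM; congr (_ * _).
  by apply: complex_ext; rewrite !reimE ?oppr0.
have IR := inner_eta FT_unitary true V1 V2.
have II := inner_eta FT_unitary false V1 V2.
exists (fun l => pr l +i* qi l), (Mr + Mi); split.
- by rewrite addr_ge0.
- move=> l l' la l'a; rewrite -[X in normc X]/(_ +i* _).
  have -> : (pr l - pr l') +i* (qi l - qi l') = (pr l - pr l')%:C + 'i%C * (qi l - qi l')%:C.
    by apply: complex_ext; rewrite !reimE /= ?mul0r ?mul1r ?subr0 ?addr0 ?add0r.
  apply: le_trans (le_normcD _ _) _; rewrite Normc.normcM !normc_real.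
  by rewrite normc_i mul1r mulrDl lerD//; [exact: lr|exact: li].
move=> l la.
have Gr : pv (fun x => Re (Defs.eta FT u1 u2 x)) l
    = 1 * (\int[mu1]_x ((x - a) * part true (Defs.eta FT v1 v2 x))
      + (l - a) * \int[mu1]_x part true (Defs.eta FT v1 v2 x) + (l - a) ^+ 2 * pr l).
  apply: (pv_double_zero tr a0) => // x.
  by rewrite E !reimE mul0r subr0 mul1r.
have Gi : pv (fun x => Im (Defs.eta FT u1 u2 x)) l
    = 1 * (\int[mu1]_x ((x - a) * part false (Defs.eta FT v1 v2 x))
      + (l - a) * \int[mu1]_x part false (Defs.eta FT v1 v2 x) + (l - a) ^+ 2 * qi l).
  apply: (pv_double_zero ti a0) => // x.
  by rewrite E !reimE mul0r addr0 mul1r.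
have Gr' : pv (fun x => Re (Defs.eta FT u2 u1 x)) l
    = 1 * (\int[mu1]_x ((x - a) * part true (Defs.eta FT v1 v2 x))
      + (l - a) * \int[mu1]_x part true (Defs.eta FT v1 v2 x) + (l - a) ^+ 2 * pr l).
  apply: (pv_double_zero tr a0) => // x.
  by rewrite E' !reimE mul0r subr0 mul1r.
have Gi' : pv (fun x => Im (Defs.eta FT u2 u1 x)) l
    = (- 1) * (\int[mu1]_x ((x - a) * part false (Defs.eta FT v1 v2 x))
      + (l - a) * \int[mu1]_x part false (Defs.eta FT v1 v2 x) + (l - a) ^+ 2 * qi l).
  apply: (pv_double_zero ti a0) => // x.
  by rewrite E' !reimE mul0r addr0 mulrN mulN1r.
have key (x : R) (X Y ip Z : R[i]) :
    Re Z = 1 * (Re X + x * Re ip + x ^+ 2 * Re Y) ->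
    Im Z = 1 * (Im X + x * Im ip + x ^+ 2 * Im Y) ->
    Z = X + x%:C * ip + (x ^+ 2)%:C * Y.
  by move=> h1 h2; apply: complex_ext; rewrite ?h1 ?h2 !reimE; ring.
have G1 := congr2 (@Complex R) Gr Gi.
have G2 := congr2 (@Complex R) Gr' Gi'.
rewrite -IR in Gr; rewrite -II in Gi.
split; first by apply: (key _ (first_moment a v1 v2) (pr l +i* qi l)); [exact: Gr|exact: Gi].
refine (etrans G2 (esym (etrans (congr1 (@conjc R) G1) _))).
by rewrite mulN1r !mul1r.
Qed.

Lemma first_moment0 (a : R) v1 v2 : classE FT v1 -> classE FT v2 ->
  (forall l : R, 0 < l -> Defs.eta FT v1 v2 l = 0) -> first_moment a v1 v2 = 0.
Proof.
move=> V1 V2 z0.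
have H p : \int[mu1]_x ((x - a) * part p (Defs.eta FT v1 v2 x)) = 0.
  have [z1 [K [mz _ _ _]]] := eta_tame p V1 V2.
  rewrite /Rintegral (ae_eq_integral (cst 0%E)) ?integral0//.
    apply/measurable_EFinP; apply: measurable_funM => //.
    exact: measurable_funB.
  exists [set 0]; split => //; first exact: lebesgue_measure_set1.
  move=> x /= xn; apply: contrapT => x0; apply: xn => _.
  have [x1|x1] := ltP 0 x; first by rewrite z0//; case: p {mz}; rewrite /part /= mulr0.
  have xneg : x < 0 by rewrite lt_neqAle x1 andbT; apply/eqP.
  rewrite /Defs.eta leNgt xneg /=.
  by case: p {mz}; rewrite /part /= mulr0.
by have := congr2 (@Complex R) (H true) (H false).
Qed.

(** First moments are linear, which transfers linear relations among the
    eigenfunctions to the matrix of their first moments. *)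
Lemma first_moment_lin (a : R) (c : R[i]) v1 v2 w :
  classE FT v1 -> classE FT v2 -> classE FT w ->
  (forall l : R, 0 < l -> Defs.eta FT v2 w l = c * Defs.eta FT v1 w l) ->
  first_moment a v1 w = 0 -> Re (first_moment a v2 w) = 0.
Proof.
move=> V1 V2 W E [m1 m2].
have [zr [Kr tr]] := eta_tame true V1 W.
have [zi [Ki ti]] := eta_tame false V1 W.
have [z2 [K2 t2]] := eta_tame true V2 W.
have I (z z1 : R -> R) K : tame z z1 K ->
    mu1.-integrable setT (EFin \o (fun x => (x - a) * z x)).
  move=> t; have [i1 i2] := tame_integrable t.
  have := intblD i2 (intblZ (- a) i1); apply: eq_integrable => // x _ /=.
  by congr (_%:E); ring.
have Ir := I _ _ _ tr; have Ii := I _ _ _ ti; have I2 := I _ _ _ t2.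
have Irc := intblZ (Re c) Ir; have Iic := intblZ (- Im c) Ii.
have -> : Re (first_moment a v2 w) = \int[mu1]_x
    (Re c * ((x - a) * part true (Defs.eta FT v1 w x))
     + (- Im c) * ((x - a) * part false (Defs.eta FT v1 w x))).
  rewrite /Rintegral; congr fine; apply: ae_eq_integral => //.
  - by have /integrableP[] := I2.
  - by have /integrableP[] := intblD Irc Iic.
  exists [set 0]; split => //; first exact: lebesgue_measure_set1.
  move=> x /= xn; apply: contrapT => x0; apply: xn => _.
  have [x1|x1] := ltP 0 x.
    by rewrite (E x x1) /part !reimE; congr (_%:E); ring.
  have xneg : x < 0 by rewrite lt_neqAle x1 andbT; apply/eqP.
  by rewrite !(eta_neg _ _ _ xneg) /part /= !mulr0 addr0.
rewrite RintegralD// (RintegralZl _ measurableT Ir) (RintegralZl _ measurableT Ii).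
by rewrite /part m1 m2 !mulr0 addr0.
Qed.

Lemma eta_null v w (l : R) : classE FT v -> classE FT w -> norm2 (leb3 R) v = 0 ->
  0 < l -> Defs.eta FT v w l = 0.
Proof.
move=> V W v0 l0; have z := fiber_ae0 FT_unitary V v0 l0.
have L x : classE FT x -> L2 (surface R) (fiber FT x l) by move=> ?; apply: L2_fiber => //; exact: ltW.
rewrite (eta_ge0 _ _ _ (ltW l0)).
have -> : inner (surface R) (fiber FT v l) (fiber FT w l)
    = inner (surface R) 0 (fiber FT w l).
  by apply: inner_ae; [exact: L|exact: L20|exact: L|exact: L|exact: z|exact: aeW].
exact: inner0l.
Qed.

#[local] Opaque gamma Defs.eta.

Variables (u phi : 'I_2 -> R3 R -> R[i]) (alpha0 lam0 : R).
Hypotheses (lam00 : 0 < lam0) (u_E : forall j, classE FT (u j))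
  (u_0 : forall j, norm2 (surface R) (fiber FT (u j) lam0) = 0)
  (gamma0 : forall j k : 'I_2,
     (j == k)%:R + alpha0%:C * gamma (Defs.eta FT (u j) (u k)) lam0 = 0)
  (Phi : forall j, is_Phi FT (u j) lam0 (phi j)).

Lemma phi_E j : classE FT (phi j). Proof. by case: (Phi j). Qed.

Lemma alpha0_neq0 : alpha0 != 0.
Proof.
apply/eqP => a0; have := gamma0 0 0; rewrite a0 mul0r addr0.
by move/eqP; rewrite oner_eq0.
Qed.

Definition Gram : 'M[R[i]]_2 := \matrix_(j, k) inner (leb3 R) (phi k) (phi j).

(** [pi] times the Gram matrix of the fibers of the eigenfunctions. *)
Definition Zmx (l : R) : 'M[R[i]]_2 :=
  \matrix_(j, k) (pi%:C * Defs.eta FT (phi k) (phi j) l).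

Lemma ZmxE l j k : Zmx l j k = pi%:C * Defs.eta FT (phi k) (phi j) l.
Proof. by rewrite mxE. Qed.

Let near_center : `|lam0 - lam0| < lam0 / 4.
Proof. by rewrite subrr normr0 divr_gt0. Qed.

Let expansions : exists (p : 'I_2 -> 'I_2 -> R -> R[i]) (K : 'I_2 -> 'I_2 -> R),
  forall j k, expands lam0 (u k) (u j) (phi k) (phi j) (p j k) (K j k).
Proof.
have H (x : 'I_2 * 'I_2) : exists pK : (R -> R[i]) * R,
    expands lam0 (u x.2) (u x.1) (phi x.2) (phi x.1) pK.1 pK.2.
  have [p [K pK]] := gamma_Phi lam00 (u_E x.2) (u_E x.1) (Phi x.2) (Phi x.1) (u_0 x.2).
  by exists (p, K).
have [f fP] := choice H.
by exists (fun j k => (f (j, k)).1), (fun j k => (f (j, k)).2) => j k; exact: (fP (j, k)).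
Qed.

(** The expansion of [gamma] at [lam0] itself, where [B] vanishes. *)
Lemma first_moment_phi j k : first_moment lam0 (phi k) (phi j) = - (j == k)%:R / alpha0%:C.
Proof.
have [p [K pK]] := expansions; have [_ _ /(_ _ near_center)[g _]] := pK j k.
have := gamma0 k j; rewrite g subrr expr0n !mul0r !addr0 eq_sym => /eqP.
rewrite addrC addr_eq0 => /eqP <-; rewrite mulrAC mulfV ?mul1r//.
by apply: contra alpha0_neq0 => /eqP[->].
Qed.

Lemma Cmx_pencil : exists2 P, near_lip lam0 P & exists2 r, 0 < r &
  forall alpha l, `|l - lam0| < r -> Cmx FT u alpha l = Cpencil alpha0 lam0 Gram P alpha l
    /\ hermitian2 (Cmx FT u alpha l).
Proof.
have [p [K pK]] := expansions.
exists (fun l => \matrix_(j, k) p j k l).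
  exists (lam0 / 4), (\sum_j \sum_k K j k); split; first by rewrite divr_gt0.
    by apply: sumr_ge0 => j _; apply: sumr_ge0 => k _; have [] := pK j k.
  move=> l l' j k la l'a; rewrite !mxE; have [_ pl _] := pK j k.
  apply: le_trans (pl _ _ la l'a) _; rewrite ler_wpM2r//.
  have K0 a b : 0 <= K a b by have [] := pK a b.
  rewrite (bigD1 j)//= (bigD1 k)//= -addrA lerDl addr_ge0//.
    by apply: sumr_ge0.
  by apply: sumr_ge0 => a _; exact: sumr_ge0.
exists (lam0 / 4); first by rewrite divr_gt0.
move=> alpha l la; split; [apply/matrixP => j k|move=> j k].
  have [_ _ /(_ _ la)[g _]] := pK j k.
  rewrite [LHS]mxE g first_moment_phi [RHS]pencilE !mxE.
  have a0 : alpha0%:C != 0 by apply: contra alpha0_neq0 => /eqP[->].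
  rewrite !(rmorphB, rmorphM, fmorphV, rmorph1)/=.
  move: (inner _ _ _) (p j k l) ((l - lam0)%:C) => *.
  by case: (j == k); rewrite ?mulr1n ?mulr0n; field.
have [_ _ /(_ _ la)[_ g]] := pK j k.
have E a b : Cmx FT u alpha l a b =
    (a == b)%:R + alpha%:C * gamma (Defs.eta FT (u b) (u a)) l by rewrite mxE.
have alg (z w : R[i]) (b b' : bool) : w = z^*%C -> b = b' ->
    b%:R + alpha%:C * w = (b'%:R + alpha%:C * z)^*%C.
  move=> -> ->; rewrite conjcD conjcM conjc_real; congr (_ + _).
  by case: b'; apply: complex_ext; rewrite !reimE /= ?oppr0.
exact: (etrans (E k j) (etrans (alg _ _ _ _ g (eq_sym k j))
  (esym (congr1 (@conjc R) (E j k))))).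
Qed.

Let pi_lip p j k : exists r K : R, [/\ 0 < r, 0 <= K & forall l l',
  `|l - lam0| < r -> `|l' - lam0| < r ->
  `|part p (Defs.eta FT (phi k) (phi j) l) - part p (Defs.eta FT (phi k) (phi j) l')|
    <= K * `|l - l'| ].
Proof.
have [z1 [K t]] := eta_tame p (phi_E k) (phi_E j).
exists (lam0 / 4), (`|z1 lam0| + K * lam0); split.
- by rewrite divr_gt0.
- have [_ + _ _] := t => /(_ 0); rewrite expr0n addr0 expr1n mul1r => K0.
  by rewrite addr_ge0// mulr_ge0// ?(ltW lam00)//; apply: le_trans K0.
exact: (tame_lip t lam00).
Qed.

Lemma Zmx_lip : near_lip lam0 Zmx.
Proof.
have H (x : bool * ('I_2 * 'I_2)) : exists rK : R * R, [/\ 0 < rK.1, 0 <= rK.2 & forall l l',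
  `|l - lam0| < rK.1 -> `|l' - lam0| < rK.1 ->
  `|part x.1 (Defs.eta FT (phi x.2.2) (phi x.2.1) l)
    - part x.1 (Defs.eta FT (phi x.2.2) (phi x.2.1) l')| <= rK.2 * `|l - l'| ].
  by have [r [K rK]] := pi_lip x.1 x.2.1 x.2.2; exists (r, K).
have [f fP] := choice H.
exists (\big[Num.min/1]_x (f x).1), (pi * (2 * \sum_x (f x).2)); split.
- by elim/big_ind: _ => // [a b a0 b0|x _]; [rewrite lt_min a0|have [] := fP x].
- by rewrite !mulr_ge0 ?pi_ge0//; apply: sumr_ge0 => x _; have [] := fP x.
move=> l l' j k la l'a.
have P p : `|part p (Defs.eta FT (phi k) (phi j) l)
    - part p (Defs.eta FT (phi k) (phi j) l')| <= (\sum_x (f x).2) * `|l - l'|.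
  have [_ _ fl] := fP (p, (j, k)); apply: le_trans (fl _ _ _ _) _.
  - by apply: lt_le_trans la _; exact: bigmin_le_cond.
  - by apply: lt_le_trans l'a _; exact: bigmin_le_cond.
  rewrite ler_wpM2r// (bigD1 (p, (j, k)))//= lerDl.
  by apply: sumr_ge0 => x _; have [] := fP x.
rewrite !mxE -mulrBr Normc.normcM.
rewrite normc_real (ger0_norm (pi_ge0 R)).
rewrite -(mulrA pi) ler_wpM2l ?pi_ge0//.
move: (P true) (P false); rewrite /part.
move: (Defs.eta _ _ _ l) (Defs.eta _ _ _ l') (\sum_x _) => [a b] [c e] S Pa Pb.
have -> : (a +i* b - (c +i* e)) = (a - c)%:C + 'i%C * (b - e)%:C.
  by apply: complex_ext; rewrite !reimE /= ?mul0r ?mul1r ?subr0 ?addr0 ?add0r.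
apply: le_trans (le_normcD _ _) _; rewrite Normc.normcM !normc_real.
by rewrite normc_i mul1r; move: Pa Pb => /=; lra.
Qed.

Lemma Zmx_pos l : positive2 (Zmx l).
Proof.
have E a b : Zmx l a b = pi%:C * Defs.eta FT (phi b) (phi a) l by rewrite mxE.
have [l0|l0] := leP 0 l; last first.
  have E0 a b : Zmx l a b = 0.
    by apply: (etrans (E a b)); rewrite eta_neg// mulr0.
  split; rewrite ?E0//=; first by move=> j k; rewrite !E0; apply: complex_ext; rewrite !reimE ?oppr0.
  by rewrite expr0n /= addr0 sqrtr0 expr0n mulr0.
have L j : L2 (surface R) (fiber FT (phi j) l) by exact: L2_fiber (phi_E j) l0.
have EI a b : Defs.eta FT (phi a) (phi b) l
    = inner (surface R) (fiber FT (phi a) l) (fiber FT (phi b) l).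
  exact: eta_ge0.
have En a : Re (Zmx l a a) = pi * norm2 (surface R) (fiber FT (phi a) l) ^+ 2.
  by rewrite E EI inner_norm2// !reimE mul0r subr0.
split.
- move=> j k; apply: (etrans (E k j)); rewrite (congr1 (@conjc R) (E j k)) conjcM conjc_real.
  by congr (_ * _); exact: (eta_conj l (phi_E k) (phi_E j)).
- by rewrite En mulr_ge0 ?pi_ge0// sqr_ge0.
- by rewrite En mulr_ge0 ?pi_ge0// sqr_ge0.
rewrite !En E EI Normc.normcM.
rewrite normc_real (ger0_norm (pi_ge0 R)).
rewrite mulrACA -expr2 exprMn ler_wpM2l ?sqr_ge0// -exprMn.
rewrite ler_pXn2r// ?nnegrE ?normc_ge0 ?mulr_ge0 ?norm2_ge0//.
by rewrite mulrC; exact: cauchy_schwarz.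
Qed.

Lemma Dmx_pencil alpha l : Dmx FT u alpha l = Dpencil lam0 Zmx alpha l.
Proof.
apply/matrixP => j k; rewrite [LHS]mxE [RHS]pencilE !M2E mxE.
have E := eta_Phi l lam00 (u_E k) (u_E j) (Phi k) (Phi j) (u_0 k).
rewrite E mul0rn mulr0 !add0r !rmorphM/=.
by move: (Defs.eta _ _ _ _) => z; ring.
Qed.

(** The matrix of first moments is [- 1 / alpha0], hence invertible, and a linear
    relation between the eigenfunctions would be one between its rows. The vector
    [w] is the component of [phi 1] orthogonal to [phi 0]. *)
Lemma Gram_pos : 0 < norm2 (leb3 R) (phi 0) ^+ 2 /\
  normc (inner (leb3 R) (phi 0) (phi 1)) ^+ 2
    < norm2 (leb3 R) (phi 0) ^+ 2 * norm2 (leb3 R) (phi 1) ^+ 2.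
Proof.
have aV : Re (- 1 / alpha0%:C) != 0.
  rewrite mulN1r -fmorphV -rmorphN ReZ oppr_eq0 invr_eq0.
  exact: alpha0_neq0.
have n0 : norm2 (leb3 R) (phi 0) != 0.
  apply: contra_neq aV => z.
  have <- := first_moment_phi 0 0; rewrite first_moment0 ?reimE//; try exact: phi_E.
  by move=> l l0; apply: eta_null => //; exact: phi_E.
have L j : L2 (leb3 R) (phi j) by case: (phi_E j).
set n1 := norm2 (leb3 R) (phi 0) ^+ 2; set n2 := norm2 (leb3 R) (phi 1) ^+ 2.
set ip := inner (leb3 R) (phi 0) (phi 1).
have n10 : 0 < n1 by rewrite /n1 lt_def sqr_ge0 andbT expf_neq0.
split=> //.
pose a := - ip^*%C / n1%:C; pose w := a *: phi 0 + phi 1.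
have W : classE FT w by apply: (classE_lin FT_unitary); exact: phi_E.
have w0 : norm2 (leb3 R) w != 0.
  apply: contra_neq aV => z.
  have <- := first_moment_phi 1 1.
  apply: (@first_moment_lin lam0 (- a) (phi 0) (phi 1) (phi 1)); try exact: phi_E.
    move=> l l0; have l0' := ltW l0.
    have Lf j : L2 (surface R) (fiber FT (phi j) l) by exact: L2_fiber (phi_E j) l0'.
    rewrite !(eta_ge0 _ _ _ l0') -(innerZl _ (Lf 0) (Lf 1)).
    apply: inner_ae; [exact: Lf|exact: (L2Z _ (Lf 0))|exact: Lf|exact: Lf| |exact: aeW].
    have f0 := fiber_ae0 FT_unitary W z l0.
    have fl := fiber_lin FT_unitary a (phi_E 0) (phi_E 1) l0.
    apply: filterS2 f0 fl => om f0 fl; move: fl; rewrite f0// => /(_ I).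
    by rewrite !ptE => /esym /eqP; rewrite addrC addr_eq0 => /eqP ->; rewrite mulNr.
  by rewrite (first_moment_phi 1 0) /= oppr0 mul0r.
have Lw : L2 (leb3 R) w by case: W.
have E : norm2 (leb3 R) w ^+ 2 = n2 - normc ip ^+ 2 / n1.
  have <- : Re (inner (leb3 R) w w) = norm2 (leb3 R) w ^+ 2 by rewrite inner_norm2.
  have n1C : n1%:C != 0 by apply: contra_neq (lt0r_neq0 n10) => -[].
  have w0' : inner (leb3 R) (phi 0) w = 0.
    rewrite innerDr ?innerZr//; last exact: L2Z.
    rewrite inner_norm2// -/n1 -/ip /a.
    have -> : (- ip^*%C / n1%:C)^*%C = - ip / n1%:C.
      rewrite conjcM -fmorphV; congr (_ * _); apply: complex_ext; rewrite !reimE ?opprK ?oppr0//.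
    by rewrite divfK// addNr.
  rewrite {1}/w inner_lin// w0' mulr0 add0r innerDr ?innerZr//; last exact: L2Z.
  rewrite inner_norm2// -/n2 (inner_conj (L 0) (L 1)) -/ip.
  have -> : a^*%C = - ip / n1%:C.
    rewrite conjcM -fmorphV; congr (_ * _); apply: complex_ext; rewrite !reimE ?opprK ?oppr0//.
  rewrite -fmorphV normc_sqr !reimE; field.
  exact: lt0r_neq0.
have : 0 < norm2 (leb3 R) w ^+ 2 by rewrite lt_def sqr_ge0 andbT expf_neq0.
by rewrite E subr_gt0 ltr_pdivrMr// mulrC.
Qed.

End Expansion.

(** * The coefficients of the eigenbasis *)

Section Eigenbasis.
Variables (R : realType) (phi : 'I_2 -> R3 R -> R[i]) (alpha0 : R).
Local Notation n1 := (norm2 (leb3 R) (phi 0) ^+ 2).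
Local Notation n2 := (norm2 (leb3 R) (phi 1) ^+ 2).
Local Notation ip := (inner (leb3 R) (phi 0) (phi 1)).
Local Notation d := (gap phi).
Hypotheses (alpha0_n0 : alpha0 != 0) (L2phi : forall j, L2 (leb3 R) (phi j))
  (n10 : 0 < n1) (gram : normc ip ^+ 2 < n1 * n2)
  (label : norm2 (leb3 R) (phi 0) <= norm2 (leb3 R) (phi 1))
  (split : ip <> 0 \/ norm2 (leb3 R) (phi 0) <> norm2 (leb3 R) (phi 1)).
Variable l : 'I_2.
Local Notation L := (slope phi alpha0 l).
Local Notation a := (eigcoef phi alpha0 (slope phi alpha0)).
Let sg : R := (-1) ^+ l.
(** The limit of [B / (alpha - alpha0)] along a branch of slope [L]. *)
Definition slope_mx : 'M[R[i]]_2 :=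
  ((- alpha0^-1)%:C)%:M + (alpha0 * L)%:C *: Gram phi.

(** The eigenvalue [m] of the Gram matrix that belongs to the slope [L]: here
    [x1, x2] are its diagonal entries, [g] is the squared modulus of the
    off-diagonal one, [e] the gap and [s] the sign that selects the eigenvalue. *)
Lemma eigen_real (x1 x2 g e s : R) : 0 < x1 -> x1 <= x2 -> 0 <= g -> g < x1 * x2 ->
  0 < e -> e ^+ 2 = (x1 - x2) ^+ 2 + 4 * g -> s ^+ 2 = 1 ->
  let m := (x1 + x2 - s * e) / 2 in
  [/\ 0 < m, (x1 + x2 + s * e) / (2 * alpha0 ^+ 2 * (x1 * x2 - g)) = (alpha0 ^+ 2 * m)^-1,
      (x2 - m) * (x1 - m) = g, 0 <= s * (x2 - m) & 0 <= s * (x1 - m)].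
Proof.
move=> x10 x12 g0 gx e0 e2 s2 m.
have ss : s = 1 \/ s = -1.
  have : (s - 1) * (s + 1) = 0 by rewrite -subr_sqr s2 expr1n subrr.
  by move/eqP; rewrite mulf_eq0 subr_eq0 addr_eq0 => /orP[/eqP|/eqP]; [left|right].
have ex : x2 - x1 <= e.
  rewrite -(@ler_pXn2r _ 2)// ?nnegrE ?subr_ge0 ?(ltW e0)// e2.
  by rewrite -(opprB x1) sqrrN lerDl mulr_ge0.
have ex' : e < x1 + x2.
  rewrite -(@ltr_pXn2r _ 2)// ?nnegrE ?(ltW e0)//; last lra.
  by rewrite e2; nra.
have mm : m * ((x1 + x2 + s * e) / 2) = x1 * x2 - g.
  have -> : m * ((x1 + x2 + s * e) / 2) = ((x1 + x2) ^+ 2 - s ^+ 2 * e ^+ 2) / 4.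
    by rewrite /m; field.
  by rewrite s2 e2; field.
have m0 : 0 < m by rewrite /m divr_gt0//; case: ss => ->; lra.
split=> //.
- rewrite -mm; have p0 : x1 + x2 + s * e != 0 by apply: lt0r_neq0; case: ss => ->; lra.
  by field; rewrite p0 alpha0_n0 lt0r_neq0.
- have -> : (x2 - m) * (x1 - m) = (s ^+ 2 * e ^+ 2 - (x1 - x2) ^+ 2) / 4.
    by rewrite /m; field.
  by rewrite s2 e2; field.
- by rewrite /m; case: ss => ->; lra.
- by rewrite /m; case: ss => ->; lra.
Qed.

Lemma gap_gt0 : 0 < d.
Proof.
rewrite /gap sqrtr_gt0; case: split => H.
  rewrite ltr_wpDl ?sqr_ge0// mulr_gt0// exprn_gt0// lt_def normc_ge0 andbT.
  by apply/eqP => /Normc.eq0_normc.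
rewrite ltr_wpDr ?mulr_ge0 ?normc_ge0//.
rewrite lt_def sqr_ge0 andbT expf_neq0// subr_eq0; apply/eqP => /eqP.
by rewrite eqrXn2 ?norm2_ge0// => /eqP.
Qed.

Let gap_sqr : d ^+ 2 = (n1 - n2) ^+ 2 + 4 * normc ip ^+ 2.
Proof. by rewrite sqr_sqrtr// addr_ge0 ?sqr_ge0// mulr_ge0// sqr_ge0. Qed.

Let n12 : n1 <= n2.
Proof. by rewrite ler_pXn2r// nnegrE norm2_ge0. Qed.

Let sg2 : sg ^+ 2 = 1. Proof. by rewrite sqrr_sign. Qed.

Let m := (n1 + n2 - sg * d) / 2.

Let eig : [/\ 0 < m, L = (alpha0 ^+ 2 * m)^-1, (n2 - m) * (n1 - m) = normc ip ^+ 2,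
  0 <= sg * (n2 - m) & 0 <= sg * (n1 - m)].
Proof. exact: (eigen_real n10 n12 (sqr_ge0 _) gram gap_gt0 gap_sqr sg2). Qed.

Lemma slope_neq0 : L != 0.
Proof.
have [m0 -> _ _ _] := eig.
by rewrite invr_eq0 mulf_neq0 ?expf_neq0// lt0r_neq0.
Qed.

(* The squared moduli of the two coefficients, in terms of the eigenvalue. *)
Let X0 := sg * (n2 - m) / (m * d).
Let X1 := sg * (n1 - m) / (m * d).

Let aE : a l 0 = (Num.sqrt X0)%:C /\ a l 1 = - (sg%:C * phase ip * (Num.sqrt X1)%:C).
Proof.
have [m0 LE _ _ _] := eig; have mn : m != 0 by rewrite lt0r_neq0.
have dn : d != 0 by rewrite lt0r_neq0 ?gap_gt0.
have E (n : R) : -1 + alpha0 ^+ 2 * n * L = (n - m) / m.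
  by rewrite LE; field; rewrite alpha0_n0 mn.
have E' (n : R) : 1 - alpha0 ^+ 2 * n * L = - ((n - m) / m).
  by rewrite LE; field; rewrite alpha0_n0 mn.
have D (n : R) : (n - m) / m / d = (n - m) / (m * d) by rewrite -mulrA -invfM.
have D' (n : R) : - ((n - m) / m) / d = -1 * (n - m) / (m * d) by rewrite -mulNr -mulrA -invfM mulN1r.
rewrite /eigcoef /X0 /X1.
have [l0|l1] : l = 0 \/ l = 1 by elim/ord2P: (l); [left|right].
- have s1 : sg = 1 by rewrite /sg l0 expr0.
  by move: E; rewrite {1}l0 => E; rewrite l0 eqxx /= !E !D s1 !mul1r mulNr.
- have s1 : sg = -1 by rewrite /sg l1 expr1.
  move: E'; rewrite {1}l1 => E'; rewrite l1 /= !E' !D' s1; split=> //.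
  have -> : (-1 : R)%:C = -1 by rewrite rmorphN rmorph1.
  by move: (phase ip) ((Num.sqrt _)%:C) => z w; ring.
Qed.

Let coef0 : 0 <= X0 /\ 0 <= X1.
Proof.
have [m0 _ _ s0 s1] := eig.
by rewrite /X0 /X1 !divr_ge0// mulr_ge0 ?(ltW m0) ?(ltW gap_gt0).
Qed.

Let conj_mul (z : R[i]) : z^*%C * z = (normc z ^+ 2)%:C.
Proof. by apply: complex_ext; rewrite !reimE ?normc_sqr; ring. Qed.

Let normcC_neq0 (z : R[i]) : z != 0 -> (normc z)%:C != 0.
Proof. by apply: contra => /eqP[/Normc.eq0_normc ->]. Qed.

Let ph1 : phase ip * (normc ip)%:C = ip.
Proof.
rewrite /phase; case: eqVneq => [->|ip0]; last by rewrite divfK ?normcC_neq0.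
by rewrite Normc.normc0 mulr0.
Qed.

Let ph : (phase ip)^*%C * phase ip = 1.
Proof.
rewrite /phase; case: eqVneq => [_|ip0]; first by rewrite mulr1 conjc1.
have nz := normcC_neq0 ip0; rewrite -fmorphV conjcM conjc_real mulrACA conj_mul.
have n0 : normc ip != 0 by apply: contra nz => /eqP ->.
by rewrite -!rmorphM /=; congr (_%:C); field.
Qed.

(** [slope_mx] is singular, so its cofactor matrix has rank one, and the factors
    are the coefficients of the eigenvector of the Gram matrix for [m]. *)
Lemma cofactor_slope j k :
  cofactor slope_mx j k = (sg * d / alpha0)%:C * ((a l j)^*%C * a l k).
Proof.
have [m0 LE g _ _] := eig; have mn : m != 0 by rewrite lt0r_neq0.
have dn : d != 0 by rewrite lt0r_neq0 ?gap_gt0.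
have [a0 a1] := aE; have [X00 X10] := coef0.
have [c00 c01 c10 c11] := cofactor2 slope_mx.
have sgn : sg != 0 by rewrite signr_eq0.
have G00 : Gram phi 0 0 = n1%:C by rewrite mxE inner_norm2.
have G11 : Gram phi 1 1 = n2%:C by rewrite mxE inner_norm2.
have G10 : Gram phi 1 0 = ip by rewrite mxE.
have G01 : Gram phi 0 1 = ip^*%C by rewrite mxE (inner_conj (L2phi 0) (L2phi 1)).
have S (x : R) : 0 <= x -> (Num.sqrt x)%:C * (Num.sqrt x)%:C = x%:C.
  by move=> x0; rewrite -rmorphM -expr2 sqr_sqrtr.
have S2 : (Num.sqrt X0)%:C * (Num.sqrt X1)%:C = (normc ip / (m * d))%:C.
  rewrite -rmorphM/= -sqrtrM// /X0 /X1.
  have -> : sg * (n2 - m) / (m * d) * (sg * (n1 - m) / (m * d))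
      = (normc ip / (m * d)) ^+ 2.
    rewrite expr_div_n -g; have -> : (n2 - m) * (n1 - m) = sg ^+ 2 * ((n2 - m) * (n1 - m)).
      by rewrite sg2 mul1r.
    by field; rewrite mn dn.
  by rewrite sqrtr_sqr ger0_norm// divr_ge0 ?normc_ge0// mulr_ge0 ?(ltW m0) ?(ltW gap_gt0).
have dg n : - alpha0^-1 + alpha0 * L * n = sg * d / alpha0 * (sg * (n - m) / (m * d)).
  have -> : sg * d / alpha0 * (sg * (n - m) / (m * d)) = sg ^+ 2 * ((n - m) / (alpha0 * m)).
    by field; rewrite alpha0_n0 mn dn.
  by rewrite sg2 LE; field; rewrite alpha0_n0 mn.
have off : (alpha0 * L)%:C * ip
    = (sg * d / alpha0)%:C * (sg%:C * phase ip * ((Num.sqrt X0)%:C * (Num.sqrt X1)%:C)).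
  rewrite S2 -{1}ph1.
  have -> : alpha0 * L = (sg * d / alpha0) * (sg / (m * d)).
    have -> : sg * d / alpha0 * (sg / (m * d)) = sg ^+ 2 / (alpha0 * m).
      by field; rewrite alpha0_n0 mn dn.
    by rewrite sg2 LE; field; rewrite alpha0_n0 mn.
  rewrite !rmorphM /= !fmorphV !rmorphM /=; ring.
have sgC : (sg%:C)^*%C = sg%:C by exact: conjc_real.
have a1c : (a l 1)^*%C = - (sg%:C * (phase ip)^*%C * (Num.sqrt X1)%:C).
  by rewrite a1; apply: complex_ext; rewrite !reimE; ring.
have offc := congr1 (@conjc R) off; rewrite !conjcM !conjc_real in offc.
elim/ord2P: j; elim/ord2P: k.
- rewrite c00 a0 !M2E G11 conjc_real S// mulr1n -!rmorphM -rmorphD dg; congr (_%:C).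
- rewrite c01 a0 a1 !M2E G10 conjc_real mulr0n add0r off; ring.
- rewrite c10 a0 a1c !M2E G01 mulr0n add0r offc; ring.
rewrite c11 a1c a1 !M2E G00 mulr1n.
have -> : - (sg%:C * (phase ip)^*%C * (Num.sqrt X1)%:C) * - (sg%:C * phase ip * (Num.sqrt X1)%:C)
    = sg%:C ^+ 2 * ((phase ip)^*%C * phase ip) * ((Num.sqrt X1)%:C * (Num.sqrt X1)%:C) by ring.
rewrite S// ph -rmorphXn sg2 !mul1r -!rmorphM -rmorphD dg; congr (_%:C).
Qed.

Lemma eigcoef_diag : a l l != 0.
Proof.
have [m0 _ _ _ _] := eig; have [a0 a1] := aE; have d0 := gap_gt0; have n := n12.
have S x : 0 < x -> (Num.sqrt x)%:C != 0.
  move=> x0; have : Num.sqrt x != 0 by rewrite lt0r_neq0// sqrtr_gt0.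
  by apply: contra => /eqP[->].
have sgC : sg%:C != 0 :> R[i].
  have : sg != 0 by rewrite signr_eq0.
  by apply: contra => /eqP[->].
have ph0 : phase ip != 0.
  by apply/eqP => p0; move: ph; rewrite p0 mulr0 => /esym/eqP; rewrite oner_eq0.
have [l0|l1] : l = 0 \/ l = 1 by elim/ord2P: (l); [left|right].
  have s1 : sg = 1 by rewrite /sg l0 expr0.
  rewrite [X in a l X]l0 a0; apply: S; rewrite /X0; apply: divr_gt0; last exact: mulr_gt0.
  by rewrite s1 mul1r /m s1; move: n d0; lra.
have s1 : sg = -1 by rewrite /sg l1 expr1.
rewrite [X in a l X]l1 a1 oppr_eq0 !mulf_neq0//; apply: S.
rewrite /X1; apply: divr_gt0; last exact: mulr_gt0.
by rewrite s1 /m s1; move: n d0; lra.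
Qed.

Let G00 : Gram phi 0 0 = n1%:C. Proof. by rewrite mxE inner_norm2. Qed.
Let G11 : Gram phi 1 1 = n2%:C. Proof. by rewrite mxE inner_norm2. Qed.
Let G10 : Gram phi 1 0 = ip. Proof. by rewrite mxE. Qed.
Let G01 : Gram phi 0 1 = ip^*%C.
Proof. by rewrite mxE (inner_conj (L2phi 0) (L2phi 1)). Qed.

(** As [slope_mx] is [alpha0 L (G - m)] with [G] the Gram matrix, this is the
    difference between the other eigenvalue of [G] and [m]. *)
Lemma polar_det_slope : polar_det slope_mx (alpha0%:C *: Gram phi) = (sg * d)%:C.
Proof.
have [m0 LE g _ _] := eig; have mn : m != 0 by rewrite lt0r_neq0.
have -> : sg * d = n1 + n2 - 2 * m by rewrite /m; field.
have -> : n1 + n2 - 2 * m = alpha0 * ((- alpha0^-1) * (n1 + n2)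
    + 2 * (alpha0 * L) * (n1 * n2 - normc ip ^+ 2)).
  by rewrite -g LE; field; rewrite alpha0_n0 mn.
rewrite polar_detZr /polar_det /slope_mx !M2E G00 G11 G10 G01 !mulr1n !mulr0n.
move: (conj_mul ip); move: (n1) (n2) (L) (ip) => x1 x2 L0 z ii.
have {}ii : (normc z)%:C * (normc z)%:C = z^*%C * z by rewrite ii -rmorphM.
rewrite !(rmorphM, rmorphD, rmorphB, rmorphN, rmorph_nat)/= ii.
by ring.
Qed.

Lemma trace_slope : Re (\tr slope_mx) != 0.
Proof.
have [m0 LE g _ _] := eig; have mn : m != 0 by rewrite lt0r_neq0.
have -> : Re (\tr slope_mx) = sg * d / (alpha0 * m).
  have -> : sg * d = n1 + n2 - 2 * m by rewrite /m; field.
  rewrite /mxtrace sum2 /slope_mx !M2E G00 G11 !mulr1n !reimE LE.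
  by field; rewrite alpha0_n0 mn.
have dn : d != 0 by rewrite lt0r_neq0 ?gap_gt0.
have sgn : sg != 0 by rewrite signr_eq0.
apply: mulf_neq0; first exact: mulf_neq0.
by rewrite invr_eq0 mulf_neq0.
Qed.

End Eigenbasis.

(** * The scattering amplitude near the double eigenvalue *)

Lemma derive1_quotient (R : realType) (f : R -> R) (a : R) : derivable f a 1 ->
  (f x - f a) / (x - a) @[x --> a^'] --> derive1 f a.
Proof.
move=> df.
have q : h^-1 *: (f (h + a) - f a) @[h --> 0^'] --> derive1 f a.
  have -> : (fun h => h^-1 *: (f (h + a) - f a))
      = (fun h => h^-1 *: ((f \o shift a) (h *: 1) - f a)).
    by apply/funext => h /=; rewrite /shift /= [h *: 1]mulr1.
  by rewrite derive1E; exact: df.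
have s : x - a @[x --> a^'] --> (0 : R)^'.
  rewrite -(subrr a); apply: (@continuous_injective_withinNx _ _ (fun x : R => x - a)).
    by apply: cvgB; [exact: cvg_id|exact: cvg_cst].
  by move=> y /addIr.
have := cvg_comp _ _ s q; apply: cvg_trans; apply: near_eq_cvg; near=> x => /=.
by rewrite subrK mulrC.
Unshelve. all: end_near. Qed.

Section Amplitude.
Variables (R : realType).
Local Notation M2 := 'M[R[i]]_2.

(** With [B = C + i D] this is [tr (adj B * D * (adj B)^* * D)], which reduces by
    Cayley-Hamilton because [adj D * D] is scalar. *)
Lemma cofactor_quartic (C D : M2) : hermitian2 C -> hermitian2 D ->
  let B := C + 'i%C *: D in
  Re (\sum_j \sum_k \sum_j' \sum_k'
    cofactor B j k * (cofactor B j' k')^*%C * D k' k * D j j')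
  = Im (\det B) ^+ 2 - 2 * Re (\det B) * Re (\det D).
Proof.
move=> hC hD B; have [b00 b01 b10 b11] := cofactor2 B.
have [E1 E2 E3 Im0] := det_hermitian2 hC hD; have [_ _ _ Im0'] := det_hermitian2 hD hC.
suff -> : \sum_j \sum_k \sum_j' \sum_k'
    cofactor B j k * (cofactor B j' k')^*%C * D k' k * D j j'
    = polar_det C D ^+ 2 - 2%:R * (\det C - \det D) * \det D.
  rewrite /B E1 E2 expr2 mulr_natl mulr2n; move: E3 Im0 Im0'.
  by move: (polar_det C D) (\det C) (\det D) => T c e hT hc he;
    rewrite !reimE hT hc he; ring.
have ii : ('i%C : R[i]) * 'i%C = -1 by rewrite -expr2 sqr_i.
have iC : ('i%C : R[i])^*%C = - 'i%C by apply: complex_ext; rewrite !reimE /= ?oppr0.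
have cB j k : (B j k)^*%C = C k j - 'i%C * D k j.
  by rewrite /B !M2E conjcD conjcM iC -hC -hD mulNr.
have cN (z : R[i]) : (- z)^*%C = - z^*%C by exact: rmorphN.
rewrite !sum2 b00 b01 b10 b11 !cN !cB !det2 /polar_det /B !M2E.
move: ii; move: ('i%C : R[i]) => w ii.
move: (C 0 0) (C 0 1) (C 1 0) (C 1 1) (D 0 0) (D 0 1) (D 1 0) (D 1 1) => *.
ring: ii.
Qed.

Variables (FT : (R3 R -> R[i]) -> (R3 R -> R[i])) (u : 'I_2 -> R3 R -> R[i]).
Hypothesis u_E : forall j, classE FT (u j).
Local Notation fib j l := (fiber FT (u j) l).

Lemma DmxE alpha (l : R) j k : 0 <= l ->
  Dmx FT u alpha l j k = (alpha * pi)%:C * inner (surface R) (fib k l) (fib j l).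
Proof. by move=> l0; rewrite mxE eta_ge0. Qed.

Lemma hermitian_Dmx alpha l : hermitian2 (Dmx FT u alpha l).
Proof.
move=> j k; have E a b : Dmx FT u alpha l a b
    = (alpha * pi)%:C * Defs.eta FT (u b) (u a) l by rewrite mxE.
refine (etrans (E k j) (esym (etrans (congr1 (@conjc R) (E j k)) _))).
rewrite conjcM (eta_conj l (u_E k) (u_E j)); congr (_ * _).
by apply: complex_ext; rewrite !reimE ?oppr0.
Qed.

Lemma BmxE alpha l : Bmx FT u alpha l = Cmx FT u alpha l + 'i%C *: Dmx FT u alpha l.
Proof. by []. Qed.

Definition amplitude_coef alpha l (p : 'I_2 * 'I_2) : R[i] :=
  - ((2 * pi * alpha)%:C * 'i%C / Fdet FT u alpha l) * cofactor (Bmx FT u alpha l) p.1 p.2.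

Lemma stationary_amplitude alpha l f :
  stationary_scattering FT u alpha l f - f
  = \sum_p (amplitude_coef alpha l p * inner (surface R) f (fib p.1 l)) *: fib p.2 l.
Proof.
rewrite /stationary_scattering [LHS]addrAC subrr add0r.
rewrite pair_bigA /= -scaleNr scaler_sumr; apply: eq_bigr => p _.
by rewrite scalerA /amplitude_coef mulrA.
Qed.

(** The inner products of the fibers are the entries of [D], up to a factor which
    also occurs in the coefficients of the amplitude. *)
Lemma hs_sqr_amplitude alpha l : 0 <= l ->
  hermitian2 (Cmx FT u alpha l) ->
  Re (hs_sqr (surface R) (amplitude_coef alpha l) (fun p => fib p.1 l) (fun p => fib p.2 l))
  = 4 * (F2 FT u alpha l ^+ 2 - 2 * F1 FT u alpha l * Re (\det (Dmx FT u alpha l)))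
    / (F1 FT u alpha l ^+ 2 + F2 FT u alpha l ^+ 2).
Proof.
move=> l0 hC; have hD := hermitian_Dmx alpha l.
set F := Fdet FT u alpha l.
have -> : hs_sqr (surface R) (amplitude_coef alpha l) (fun p => fib p.1 l) (fun p => fib p.2 l)
  = (4 / (Re F ^+ 2 + Im F ^+ 2))%:C * \sum_j \sum_k \sum_j' \sum_k'
    cofactor (Bmx FT u alpha l) j k * (cofactor (Bmx FT u alpha l) j' k')^*%C
      * Dmx FT u alpha l k' k * Dmx FT u alpha l j j'.
  rewrite /hs_sqr [X in _ * X]pair_bigA mulr_sumr; apply: eq_bigr => -[j k] _ /=.
  rewrite [X in _ * X]pair_bigA mulr_sumr; apply: eq_bigr => -[j' k'] _ /=.
  rewrite !DmxE// /amplitude_coef -/F /=.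
  move: (cofactor _ j k) (cofactor _ j' k') (inner _ _ _) (inner _ _ _) => c c' x y.
  have K : (2 * pi * alpha)%:C * 'i%C / F * ((2 * pi * alpha)%:C * 'i%C / F)^*%C
      = (4 / (Re F ^+ 2 + Im F ^+ 2))%:C * ((alpha * pi)%:C * (alpha * pi)%:C).
    have mul_conj (z : R[i]) : z * z^*%C = (normc z ^+ 2)%:C.
      by apply: complex_ext; rewrite !reimE ?normc_sqr; ring.
    rewrite mul_conj !Normc.normcM Normc.normcV normc_real normc_i.
    rewrite mulr1 exprMn exprVn normc_sqr real_normK ?num_real// -!rmorphM/=.
    by congr (_%:C); ring.
  move: ((2 * pi * alpha)%:C * 'i%C / F) K => q K.
  have -> : (- q * c')^*%C = - (q^*%C * c'^*%C).
    by rewrite conjcM (_ : (- q)^*%C = - q^*%C) ?mulNr//; exact: rmorphN.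
  transitivity (q * q^*%C * (c * c'^*%C * x * y)); first by ring.
  by rewrite K; ring.
rewrite reimE ReZ ImZ mul0r subr0 (cofactor_quartic hC hD).
by rewrite -/(Fdet FT u alpha l) -/F /F1 /F2 -/F; ring.
Qed.

End Amplitude.

#[local] Opaque Defs.fiberD Defs.inner Defs.norm2 Cmx Dmx Bmx Cpencil Dpencil Zmx gamma Defs.eta cofactor determinant
  slope eigcoef.

Section LimitingCoefficients.
Variable R : realType.
Implicit Types h s n L g p a : R.

Let realC_neq0 (x : R) : x != 0 -> x%:C != 0.
Proof. by apply: contra => /eqP[->]. Qed.

Lemma hi_neq0 h s : s != 0 -> h%:C + 'i%C * s%:C != 0.
Proof.
move=> s0; apply/eqP => /(congr1 (@complex.Im R)) /eqP; rewrite !reimE /= !mul1r mul0r !add0r.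
by rewrite (negPf s0).
Qed.

(** The right-hand side is the product of the limits of the factors in
    [rescaled_coef], with [g] the signed gap and [p = pi]. *)
Lemma breit_wigner_coef h s n L g p a (b : R[i]) :
  s != 0 -> n != 0 -> L != 0 -> g != 0 -> p != 0 -> a != 0 ->
  - (2%:R * 'i%C) * (s%:C / (h%:C + 'i%C * s%:C)) / (n ^+ 2)%:C * b
  = - ((2 * p * a)%:C * 'i%C) * (L ^+ 2)%:C * ((g / a)%:C * b)
    * ('i%C + (h / s)%:C)^-1 * ((g * L ^+ 2 * p * n ^+ 2)%:C)^-1.
Proof.
move=> s0 /realC_neq0 n1 /realC_neq0 L1 /realC_neq0 g1 /realC_neq0 p1 /realC_neq0 a1.
have hs := hi_neq0 h s0; have s1 := realC_neq0 s0.
have -> : 'i%C + (h / s)%:C = (h%:C + 'i%C * s%:C) / s%:C.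
  by rewrite rmorphM fmorphV mulrDl mulfK// addrC.
rewrite invfM invrK !(rmorphM, fmorphV, rmorphXn, rmorph_nat)/=.
move: hs; move: (h%:C + 'i%C * s%:C) => w w0.
by field; rewrite n1 L1 g1 p1 a1 w0.
Qed.

Lemma sum22 (f : 'I_2 -> 'I_2 -> R[i]) :
  \sum_j \sum_k f j k = f 0 0 + f 0 1 + (f 1 0 + f 1 1).
Proof. by rewrite !sum2. Qed.

(** A coefficient of the amplitude relative to the fibers of the eigenfunctions,
    as a product of factors which have limits: [x] stands for [lam - lam0], [t]
    for [alpha - alpha0] and [f] for the value of [F2] on the branch. *)
Lemma rescaled_coef (K Fv c : R[i]) (x t f : R) : t != 0 -> f != 0 ->
  - K * ((x / t) ^+ 2)%:C * ((t^-1)%:C * c) * (Fv / f%:C)^-1 * (f%:C / t%:C ^+ 3)^-1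
  = - (K / Fv) * c * (x ^+ 2)%:C.
Proof.
move=> /realC_neq0 t0 /realC_neq0 f0.
rewrite !invfM !invrK !(rmorphM, fmorphV, rmorphXn)/=.
move: t0 f0; move: (t%:C) (f%:C) (x%:C) (Fv^-1) => {}t {}f {}x w t0 f0.
by field; rewrite t0 f0.
Qed.

(** The limit of the amplitude, written in the fibers of the two eigenfunctions,
    is the Breit-Wigner operator of their combination. *)
Lemma rank_one_cancel n (b z0 z1 f0 f1 a0 a1 c0 c1 : R[i]) : n != 0 ->
  0 = b / (n ^+ 2)%:C * (c0 * a0) * z0 * f0 + b / (n ^+ 2)%:C * (c0 * a1) * z0 * f1
    + (b / (n ^+ 2)%:C * (c1 * a0) * z1 * f0 + b / (n ^+ 2)%:C * (c1 * a1) * z1 * f1)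
    + - b * ((n^-1)%:C * (c0 * z0 + c1 * z1)) * ((n^-1)%:C * (a0 * f0 + a1 * f1)).
Proof.
move=> /realC_neq0 n0; rewrite !(fmorphV, rmorphXn)/=; move: n0; move: n%:C => v v0.
by field.
Qed.

End LimitingCoefficients.

Section Resonances.
Variables (R : realType) (FT : (R3 R -> R[i]) -> (R3 R -> R[i])).
Hypothesis FT_unitary : unitary_op (leb3 R) FT.
Variables (u phi : 'I_2 -> R3 R -> R[i]) (alpha0 lam0 : R).
Hypotheses (lam00 : 0 < lam0) (u_E : forall j, classE FT (u j))
  (u_0 : forall j, norm2 (surface R) (fiber FT (u j) lam0) = 0)
  (gamma0 : forall j k : 'I_2,
     (j == k)%:R + alpha0%:C * gamma (Defs.eta FT (u j) (u k)) lam0 = 0)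
  (Phi : forall j, is_Phi FT (u j) lam0 (phi j))
  (split : inner (leb3 R) (phi 0) (phi 1) <> 0 \/
     norm2 (leb3 R) (phi 0) <> norm2 (leb3 R) (phi 1))
  (label : norm2 (leb3 R) (phi 0) <= norm2 (leb3 R) (phi 1)).
Variables (i1 i2 : R) (I0 : i1 < alpha0 < i2) (lam : R -> R) (l : 'I_2) (h : R).
Local Notation L := (slope phi alpha0 l).
Local Notation F := (alpha0^').
Local Notation tau alpha := (alpha - alpha0).
Local Notation a := (eigcoef phi alpha0 (slope phi alpha0)).
Hypotheses (lam_derivable : derivable lam alpha0 1) (lam_alpha0 : lam alpha0 = lam0)
  (lam_slope : derive1 lam alpha0 = L)
  (lam_F1 : forall alpha, i1 < alpha < i2 -> F1 FT u alpha (lam alpha) = 0)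
  (lam_F2 : forall alpha, i1 < alpha < i2 -> alpha <> alpha0 ->
     F2 FT u alpha (lam alpha) <> 0).

Definition lamh alpha := lam alpha + h * kappa FT u phi l alpha (lam alpha).
Definition width : R := norm2 (leb3 R) (a l l *: phi l) ^+ 2.
Local Notation s := width.
Local Notation f2 alpha := (F2 FT u alpha (lam alpha)).

Let alpha00 : alpha0 != 0. Proof. exact: alpha0_neq0 gamma0. Qed.

Let L2phi j : L2 (leb3 R) (phi j). Proof. by case: (phi_E Phi j). Qed.

Let n10 : 0 < norm2 (leb3 R) (phi 0) ^+ 2.
Proof. by have [] := Gram_pos FT_unitary lam00 u_E u_0 gamma0 Phi. Qed.

Let gram : normc (inner (leb3 R) (phi 0) (phi 1)) ^+ 2
    < norm2 (leb3 R) (phi 0) ^+ 2 * norm2 (leb3 R) (phi 1) ^+ 2.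
Proof. by have [] := Gram_pos FT_unitary lam00 u_E u_0 gamma0 Phi. Qed.

Let nl : norm2 (leb3 R) (phi l) ^+ 2 != 0.
Proof.
apply: lt0r_neq0; elim/ord2P: l => //; apply: lt_le_trans n10 _.
by rewrite ler_pXn2r// nnegrE norm2_ge0.
Qed.

Let all_neq0 : a l l != 0.
Proof. exact: eigcoef_diag. Qed.

Lemma width_gt0 : 0 < s.
Proof.
rewrite /width norm2Z// exprMn lt_def mulr_ge0 ?sqr_ge0// andbT mulf_neq0// expf_neq0//.
by apply: contra_neq all_neq0 => /Normc.eq0_normc.
Qed.

Let cofM : cofactor (slope_mx phi alpha0 l) l l
  = ((-1) ^+ l * gap phi / alpha0 * normc (a l l) ^+ 2)%:C.
Proof.
have E := cofactor_slope alpha00 L2phi n10 gram label split l l l.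
refine (etrans E _); apply: complex_ext; rewrite !reimE ?normc_sqr; ring.
Qed.

Let normc_all : normc (a l l) != 0.
Proof. by apply: contra_neq all_neq0 => /Normc.eq0_normc. Qed.

Let sg_gap : (-1) ^+ l * gap phi != 0 :> R.
Proof.
apply: mulf_neq0; first by rewrite signr_eq0.
by rewrite lt0r_neq0// gap_gt0.
Qed.

Let cofM0 : Re (cofactor (slope_mx phi alpha0 l) l l) != 0.
Proof.
rewrite cofM ReZ; apply: mulf_neq0; last by rewrite expf_neq0.
by apply: mulf_neq0; rewrite ?invr_eq0.
Qed.

Let lam_cvg : (lam alpha - lam0) / tau alpha @[alpha --> F] --> L.
Proof. by rewrite -lam_slope -lam_alpha0; exact: derive1_quotient. Qed.

Let near_I : \forall alpha \near F, i1 < alpha < i2 /\ alpha <> alpha0.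
Proof.
have /andP[Ia Ib] := I0.
have Ha : \forall alpha \near F, i1 < alpha by exact: (cvg_alpha (lt_nbhsr Ia)).
have Hb : \forall alpha \near F, alpha < i2 by exact: (cvg_alpha (lt_nbhsl Ib)).
apply: filterS3 Ha Hb (near_tau alpha0) => alpha -> ->.
by rewrite subr_eq0 => /eqP.
Qed.

Lemma f2_neq0 : \forall alpha \near F, f2 alpha != 0.
Proof. by apply: filterS near_I => alpha [Ia an]; apply/eqP; exact: lam_F2. Qed.

(** The asymptotics of pencils for the matrices of the model. The ratio [h / s]
    arises because [alpha0] times the diagonal cofactor of [slope_mx] times
    [||phi_l||^2] is the signed gap times [s]. *)
Lemma resonance_limits :
  [/\ (lamh alpha - lam0) / tau alpha @[alpha --> F] --> L,
      mcvg F (fun alpha => ((tau alpha)^-1)%:C *: Bmx FT u alpha (lamh alpha))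
        (slope_mx phi alpha0 l),
      ccvg F (fun alpha => Fdet FT u alpha (lamh alpha) / (f2 alpha)%:C)
        ('i%C + (h / s)%:C),
      ccvg F (fun alpha => \det (Dmx FT u alpha (lamh alpha)) / (f2 alpha)%:C) 0 &
      ccvg F (fun alpha => (f2 alpha)%:C / (tau alpha)%:C ^+ 3)
        (polar_det (slope_mx phi alpha0 l) ((alpha0 * L ^+ 2)%:C *: Zmx FT phi lam0)) ]
  /\ \forall alpha \near F, hermitian2 (Cmx FT u alpha (lamh alpha)).
Proof.
have [P P_lip [r r0 CE]] := Cmx_pencil FT_unitary lam00 u_E u_0 gamma0 Phi.
have DE := Dmx_pencil lam00 u_E u_0 Phi.
have Z_lip := Zmx_lip lam00 Phi.
have Z_pos := Zmx_pos Phi.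
pose C := Cpencil alpha0 lam0 (Gram phi) P.
pose D := Dpencil lam0 (Zmx FT phi).
have C_herm alpha x : `|x - lam0| < r -> hermitian2 (C alpha x).
  by move=> xr; have [E H] := CE alpha x xr; rewrite /C -E.
have BE alpha x : `|x - lam0| < r -> C alpha x + 'i%C *: D alpha x = Bmx FT u alpha x.
  move=> xr; have [E _] := CE alpha x xr; rewrite BmxE.
  exact: (congr2 (fun X Y => X + 'i%C *: Y) (esym E) (esym (DE alpha x))).
have lam_near : \forall alpha \near F, `|lam alpha - lam0| < r.
  exact: near_small r0 (cvg_path lam_cvg).
have BF alpha : `|lam alpha - lam0| < r ->
    \det (C alpha (lam alpha) + 'i%C *: D alpha (lam alpha)) = Fdet FT u alpha (lam alpha).
  by move=> xr; exact: (congr1 (fun X => \det X) (BE alpha _ xr)).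
have F1z : \forall alpha \near F,
    Re (\det (C alpha (lam alpha) + 'i%C *: D alpha (lam alpha))) = 0.
  apply: filterS2 lam_near near_I => alpha lr [Ia _].
  exact: (etrans (congr1 (@complex.Re R) (BF alpha lr)) (lam_F1 Ia)).
have f2E : \forall alpha \near F,
    Im (\det (C alpha (lam alpha) + 'i%C *: D alpha (lam alpha))) = f2 alpha.
  by apply: filterS lam_near => alpha lr; exact: (congr1 (@complex.Im R) (BF alpha lr)).
have F2n : \forall alpha \near F,
    Im (\det (C alpha (lam alpha) + 'i%C *: D alpha (lam alpha))) != 0.
  by apply: filterS2 f2E f2_neq0 => alpha ->.
have trM := trace_slope alpha00 L2phi n10 gram label split l.
pose y alpha := lam alpha + h * (Im (\det (C alpha (lam alpha) + 'i%C *: D alpha (lam alpha)))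
  / (alpha * Re (cofactor (C alpha (lam alpha)) l l) * norm2 (leb3 R) (phi l) ^+ 2)).
have yE : \forall alpha \near F, y alpha = lamh alpha.
  apply: filterS2 f2E lam_near => alpha E lr; have [E' _] := CE alpha _ lr.
  exact: (congr2 (fun f c => lam alpha + h * (f / (alpha * Re (cofactor c l l)
    * norm2 (leb3 R) (phi l) ^+ 2))) E (esym E')).
have slope1 : (y alpha - lam0) / tau alpha @[alpha --> F] --> L.
  exact: (shifted_slope alpha00 P_lip Z_lip Z_pos r0 C_herm lam_cvg F2n h nl cofM0).
have B1 := B_slope (Gram phi) alpha00 P_lip Z_lip slope1.
have F1' := det_ratio alpha00 P_lip Z_lip Z_pos r0 C_herm lam_cvg F1z F2n h nl cofM0.
have D1 := detD_ratio alpha00 P_lip Z_lip Z_pos r0 C_herm lam_cvg F1z F2n trM h nl cofM0.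
have F3 := F2_cvg3 alpha00 P_lip Z_lip Z_pos r0 C_herm lam_cvg.
have y_near : \forall alpha \near F, `|y alpha - lam0| < r.
  exact: near_small r0 (cvg_path slope1).
split; last first.
  apply: filterS2 y_near yE => alpha yr E; have [_ H] := CE alpha _ yr.
  by rewrite -E.
split.
- by apply: near_eq_cvgr slope1; apply: filterS yE => alpha ->.
- apply: near_eq_mcvg B1; apply: filterS2 y_near yE => alpha yr E.
  exact: (congr1 (fun X => _ *: X) (etrans (BE alpha _ yr) (congr1 (Bmx FT u alpha) E))).
- have -> : (h / s)%:C = (h / (alpha0 * Re (cofactor (slope_mx phi alpha0 l) l l)
      * norm2 (leb3 R) (phi l) ^+ 2))%:C
      * polar_det (slope_mx phi alpha0 l) (alpha0%:C *: Gram phi).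
    rewrite polar_det_slope// -rmorphM; congr (_%:C).
    rewrite cofM ReZ /width norm2Z// exprMn.
    have := sg_gap; move: ((-1) ^+ l * gap phi) => g g0.
    move: nl; move: (norm2 (leb3 R) (phi l) ^+ 2) => n n0.
    by field; rewrite g0 n0 alpha00 normc_all.
  apply: near_eq_ccvg F1'; apply: filterS3 y_near yE f2E => alpha yr E Ef.
  exact: (congr2 (fun X f => \det X / f%:C) (etrans (BE alpha _ yr) (congr1 (Bmx FT u alpha) E)) Ef).
- apply: near_eq_ccvg D1; apply: filterS2 yE f2E => alpha E Ef.
  exact: (congr2 (fun X f => \det X / f%:C)
    (etrans (esym (DE alpha _)) (congr1 (Dmx FT u alpha) E)) Ef).
- apply: near_eq_ccvg F3; apply: filterS f2E => alpha Ef.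
  exact: (congr1 (fun f => f%:C / _) Ef).
Qed.

Variables (j1 j2 : R) (S : R -> R -> (R3 R -> R[i]) -> (R3 R -> R[i]))
  (e : nat -> R3 R -> R[i]).
Hypotheses (J0 : j1 < lam0 < j2) (J_pos : 0 < j1)
  (S_stationary : forall alpha x : R, i1 < alpha < i2 -> alpha <> alpha0 ->
     j1 < x < j2 -> forall f, L2 (surface R) f ->
     S alpha x f = stationary_scattering FT u alpha x f %[ae surface R])
  (e_basis : orthonormal_basis (surface R) e).
Local Notation fib v x := (fiber FT v x).

Let L2e n : L2 (surface R) (e n). Proof. by case: e_basis. Qed.

Let lamh_small : lamh alpha - lam0 @[alpha --> F] --> (0 : R).
Proof. by have [[H _ _ _ _] _] := resonance_limits; exact: cvg_path H. Qed.

Let lamh_cvg : lamh alpha @[alpha --> F] --> lam0.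
Proof.
have H : lamh alpha - lam0 + lam0 @[alpha --> F] --> 0 + lam0.
  by apply: cvgD; [exact: lamh_small|exact: cvg_cst].
by rewrite add0r in H; apply: near_eq_cvgr H; near=> alpha; rewrite subrK.
Unshelve. all: end_near. Qed.

Let near_J : \forall alpha \near F, j1 < lamh alpha < j2.
Proof.
have /andP[Ja Jb] := J0.
have Ha : \forall alpha \near F, j1 < lamh alpha by exact: (lamh_cvg (lt_nbhsr Ja)).
have Hb : \forall alpha \near F, lamh alpha < j2 by exact: (lamh_cvg (lt_nbhsl Jb)).
by apply: filterS2 Ha Hb => alpha -> ->.
Qed.

Let lamh_gt0 : \forall alpha \near F, 0 < lamh alpha.
Proof. by apply: filterS near_J => alpha /andP[+ _]; exact: lt_trans. Qed.

Let amplitude_ae : \forall alpha \near F, forall n,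
  amplitude (S alpha (lamh alpha)) (e n) = \sum_p (amplitude_coef FT u alpha (lamh alpha) p
     * inner (surface R) (e n) (fib (u p.1) (lamh alpha))) *: fib (u p.2) (lamh alpha)
  %[ae surface R].
Proof.
apply: filterS2 near_I near_J => alpha [Ia an] Jl n.
rewrite -stationary_amplitude; apply: filterS (S_stationary Ia an Jl (L2e n)) => om E _.
by rewrite /amplitude !ptE E.
Qed.

Let hs_amplitude : \forall alpha \near F,
  hs_norm (surface R) e (amplitude (S alpha (lamh alpha)))
  = (Num.sqrt (4 * (F2 FT u alpha (lamh alpha) ^+ 2
       - 2 * F1 FT u alpha (lamh alpha) * Re (\det (Dmx FT u alpha (lamh alpha))))
     / (F1 FT u alpha (lamh alpha) ^+ 2 + F2 FT u alpha (lamh alpha) ^+ 2)))%:E.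
Proof.
have [_ herm] := resonance_limits.
apply: filterS3 amplitude_ae lamh_gt0 herm => alpha A l0 hC.
rewrite -(hs_sqr_amplitude u_E (ltW l0) hC).
apply: hs_norm_finite_rank => // p; exact: L2_fiber (u_E _) (ltW l0).
Qed.

(** After division of numerator and denominator by the square of [F2] on the
    branch, every term of the formula for the Hilbert-Schmidt norm has a limit. *)
Lemma cross_section_cvg :
  cross_section e (S alpha (lamh alpha)) (lamh alpha) @[alpha --> F]
    --> (4 * pi / lam0 * (s ^+ 2 / (h ^+ 2 + s ^+ 2)))%:E.
Proof.
have s0 := width_gt0; have sn : s != 0 by rewrite lt0r_neq0.
have [[_ _ [A B] [D _] _] _] := resonance_limits.
rewrite !reimE /= !add0r ?addr0 in A B.
pose f alpha := Re (Fdet FT u alpha (lamh alpha) / (f2 alpha)%:C).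
pose g alpha := Im (Fdet FT u alpha (lamh alpha) / (f2 alpha)%:C).
pose r alpha := Re (\det (Dmx FT u alpha (lamh alpha)) / (f2 alpha)%:C).
have fg0 : (h / s) ^+ 2 + 1 ^+ 2 != 0.
  by rewrite lt0r_neq0// ltr_wpDl ?sqr_ge0// expr1n.
pose q alpha := 4 * (g alpha ^+ 2 - 2 * f alpha * r alpha) / (f alpha ^+ 2 + g alpha ^+ 2).
have qE : 4 * (1 ^+ 2 - 2 * (h / s) * 0) / ((h / s) ^+ 2 + 1 ^+ 2)
    = 4 * (s ^+ 2 / (h ^+ 2 + s ^+ 2)).
  have hs : h ^+ 2 + s ^+ 2 != 0.
    by rewrite lt0r_neq0// ltr_wpDl ?sqr_ge0// exprn_gt0.
  by rewrite mulr0 subr0 expr1n; field; rewrite sn hs.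
have q_cvg : q alpha @[alpha --> F] --> 4 * (s ^+ 2 / (h ^+ 2 + s ^+ 2)).
  rewrite -qE; apply: cvgM.
    apply: cvgM; first exact: cvg_cst.
    apply: cvgB; first exact: cvgM.
    by apply: cvgM => //; apply: cvgM => //; exact: cvg_cst.
  by apply: cvgV => //; apply: cvgD; exact: cvgM.
have q0 : \forall alpha \near F, 0 < q alpha.
  have q_gt0 : 0 < 4 * (s ^+ 2 / (h ^+ 2 + s ^+ 2)).
    have s2 : 0 < s ^+ 2 by rewrite exprn_gt0.
    have hs2 : 0 < h ^+ 2 + s ^+ 2 by rewrite ltr_wpDl ?sqr_ge0.
    by rewrite mulr_gt0// divr_gt0.
  exact: (q_cvg _ (lt_nbhsr q_gt0)).
have qF : \forall alpha \near F, 4 * (F2 FT u alpha (lamh alpha) ^+ 2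
       - 2 * F1 FT u alpha (lamh alpha) * Re (\det (Dmx FT u alpha (lamh alpha))))
     / (F1 FT u alpha (lamh alpha) ^+ 2 + F2 FT u alpha (lamh alpha) ^+ 2) = q alpha.
  apply: filterS f2_neq0 => alpha; rewrite /q /f /g /r /F1 /F2.
  move: (Im (Fdet FT u alpha (lam alpha))) (Fdet FT u alpha (lamh alpha)) => y X y0.
  rewrite -fmorphV !reimE !mulr0 !subr0 add0r.
  have -> : (Re X * y^-1) ^+ 2 + (Im X * y^-1) ^+ 2 = (Re X ^+ 2 + Im X ^+ 2) * y ^- 2.
    by field.
  rewrite invfM invrK; move: (_^-1) => w; field.
  exact: y0.
have lim : (pi / lamh alpha) * q alpha @[alpha --> F]
    --> 4 * pi / lam0 * (s ^+ 2 / (h ^+ 2 + s ^+ 2)).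
  have -> : 4 * pi / lam0 * (s ^+ 2 / (h ^+ 2 + s ^+ 2))
      = (pi / lam0) * (4 * (s ^+ 2 / (h ^+ 2 + s ^+ 2))) by ring.
  apply: cvgM => //; apply: cvgM; first exact: cvg_cst.
  by apply: cvgV => //; rewrite lt0r_neq0.
have E : \forall alpha \near F, cross_section e (S alpha (lamh alpha)) (lamh alpha)
    = ((pi / lamh alpha) * q alpha)%:E.
  apply: filterS3 hs_amplitude q0 qF => alpha H q0 qF.
  by rewrite /cross_section H qF -EFin_expe sqr_sqrtr ?(ltW q0)// -EFinM.
have lim' : ((pi / lamh alpha) * q alpha)%:E @[alpha --> F]
    --> (4 * pi / lam0 * (s ^+ 2 / (h ^+ 2 + s ^+ 2)))%:E.
  by apply: cvg_EFin => //; near=> alpha.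
by apply: cvg_trans lim'; apply: near_eq_cvg; apply: filterS E => alpha ->.
Unshelve. all: end_near. Qed.

Local Notation innS := (inner (surface R)).
Local Notation psi := (eigvec phi alpha0 (slope phi alpha0) l).
Local Notation psi0 := (fib psi lam0).
Local Notation N := (norm2 (surface R) psi0).
Hypothesis psi0_neq0 : N <> 0.
Let psihat : R3 R -> R[i] := a l 0 *: fib (phi 0) lam0 + a l 1 *: fib (phi 1) lam0.

Let L2phi0 j : L2 (surface R) (fib (phi j) lam0).
Proof. by apply: L2_fiber (phi_E Phi j) _; exact: ltW. Qed.

Let L2psihat : L2 (surface R) psihat.
Proof. by apply: L2D; apply: L2Z. Qed.

Let psi_E : classE FT psi.
Proof.
rewrite /eigvec sum2; apply: (classED FT_unitary); apply: (classEZ FT_unitary);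
  exact: phi_E.
Qed.

Let L2psi0 : L2 (surface R) psi0.
Proof. by apply: L2_fiber psi_E _; exact: ltW. Qed.

Let psi0E : psi0 = psihat %[ae surface R].
Proof.
have E1 := fiber_lin FT_unitary (a l 0) (phi_E Phi 0)
  (classEZ FT_unitary (a l 1) (phi_E Phi 1)) lam00.
have E2 := fiberZ FT_unitary (a l 1) (phi_E Phi 1) lam00.
rewrite /eigvec sum2; apply: filterS2 E1 E2 => om E1 E2 _.
by rewrite E1// /psihat !ptE E2.
Qed.

Let inner_psihat f : L2 (surface R) f -> innS f psi0
  = (a l 0)^*%C * innS f (fib (phi 0) lam0) + (a l 1)^*%C * innS f (fib (phi 1) lam0).
Proof.
move=> Lf.
have -> : innS f psi0 = innS f psihat by exact: (inner_ae_r Lf L2psi0 L2psihat psi0E).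
rewrite /psihat (innerDr (L2Z _ (L2phi0 0)) (L2Z _ (L2phi0 1)) Lf).
by rewrite (innerZr _ Lf (L2phi0 0)) (innerZr _ Lf (L2phi0 1)).
Qed.

Let norm_psihat : (N ^+ 2)%:C = \sum_j \sum_k
  (a l j)^*%C * a l k * innS (fib (phi k) lam0) (fib (phi j) lam0).
Proof.
have P j : innS psi0 (fib (phi j) lam0) = a l 0 * innS (fib (phi 0) lam0) (fib (phi j) lam0)
    + a l 1 * innS (fib (phi 1) lam0) (fib (phi j) lam0).
  have -> : innS psi0 (fib (phi j) lam0) = innS psihat (fib (phi j) lam0).
    exact: (inner_ae_l L2psi0 L2psihat (L2phi0 j) psi0E).
  by rewrite /psihat (inner_lin _ (L2phi0 0) (L2Z _ (L2phi0 1)) (L2phi0 j))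
    (innerZl _ (L2phi0 1) (L2phi0 j)).
have E := etrans (esym (inner_norm2 L2psi0)) (etrans (inner_psihat L2psi0)
  (congr2 (fun x y => _ * x + _ * y) (P 0) (P 1))).
have alg (b0 b1 c0 c1 z00 z01 z10 z11 : R[i]) :
    c0 * (b0 * z00 + b1 * z10) + c1 * (b0 * z01 + b1 * z11)
    = c0 * b0 * z00 + c0 * b1 * z10 + (c1 * b0 * z01 + c1 * b1 * z11) by ring.
refine (etrans E (etrans (alg _ _ _ _ _ _ _ _) _)).
exact: (esym (sum22 (fun j k => (a l j)^*%C * a l k
  * innS (fib (phi k) lam0) (fib (phi j) lam0)))).
Qed.

(** The leading coefficient of [F2] along the branch is proportional to the
    squared norm of the fibre of the eigenvector. *)
Let f3E : polar_det (slope_mx phi alpha0 l) ((alpha0 * L ^+ 2)%:C *: Zmx FT phi lam0)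
  = ((-1) ^+ l * gap phi * L ^+ 2 * pi * N ^+ 2)%:C.
Proof.
have Z j k : Zmx FT phi lam0 j k = pi%:C * innS (fib (phi k) lam0) (fib (phi j) lam0).
  by rewrite ZmxE eta_ge0// ltW.
have cof j k : cofactor (slope_mx phi alpha0 l) j k
    = ((-1) ^+ l * gap phi / alpha0)%:C * ((a l j)^*%C * a l k).
  by apply: cofactor_slope.
have a0C : alpha0%:C != 0 by apply: contra alpha00 => /eqP[->].
rewrite polar_detZr polar_det_cofactor [RHS]rmorphM /= norm_psihat !mulr_sumr.
apply: eq_bigr => j _; rewrite !mulr_sumr; apply: eq_bigr => k _; rewrite cof Z.
move: (innS _ _) ((-1) ^+ l * gap phi) (a l j) (a l k) => z g b c.
move: (slope phi alpha0 l) => L0; rewrite !(rmorphM, fmorphV, rmorphXn)/=.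
by field.
Qed.

Let coef0 (p : 'I_2 * 'I_2) : R[i] :=
  - (2%:R * 'i%C) * (s%:C / (h%:C + 'i%C * s%:C)) / (N ^+ 2)%:C
  * ((a l p.1)^*%C * a l p.2).

(* The fibers of [u j] are [lam - lam0] times those of [phi j], whence the factor
   [(lam - lam0) ^ 2]. *)
Let coef alpha (p : 'I_2 * 'I_2) : R[i] :=
  amplitude_coef FT u alpha (lamh alpha) p * ((lamh alpha - lam0) ^+ 2)%:C.

Let coef_cvg p : ccvg F (fun alpha => coef alpha p) (coef0 p).
Proof.
have [[slope1 Bs Fs _ F3] _] := resonance_limits.
have sn : s != 0 by rewrite lt0r_neq0// width_gt0.
have N0 : N != 0 by apply/eqP.
have Ln := slope_neq0 alpha00 n10 gram label split l.
have pin : (pi : R) != 0 by rewrite lt0r_neq0// pi_gt0.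
have hs0 : 'i%C + (h / s)%:C != 0 :> R[i].
  by apply/eqP => /(congr1 (@complex.Im R)) /eqP; rewrite !reimE addr0 /= oner_eq0.
have f30 : ((-1) ^+ l * gap phi * L ^+ 2 * pi * N ^+ 2)%:C != 0.
  have : (-1) ^+ l * gap phi * L ^+ 2 * pi * N ^+ 2 != 0.
    exact: mulf_neq0 (mulf_neq0 (mulf_neq0 sg_gap (expf_neq0 2 Ln)) pin) (expf_neq0 2 N0).
  by apply: contra => /eqP[->].
rewrite f3E in F3.
have lim : ccvg F (fun alpha => - ((2 * pi * alpha)%:C * 'i%C)
    * (((lamh alpha - lam0) / tau alpha) ^+ 2)%:C
    * cofactor (((tau alpha)^-1)%:C *: Bmx FT u alpha (lamh alpha)) p.1 p.2
    * (Fdet FT u alpha (lamh alpha) / (f2 alpha)%:C)^-1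
    * ((f2 alpha)%:C / (tau alpha)%:C ^+ 3)^-1)
  (- ((2 * pi * alpha0)%:C * 'i%C) * (L ^+ 2)%:C * cofactor (slope_mx phi alpha0 l) p.1 p.2
    * ('i%C + (h / s)%:C)^-1 * (((-1) ^+ l * gap phi * L ^+ 2 * pi * N ^+ 2)%:C)^-1).
  apply: ccvgM; last exact: ccvgV.
  apply: ccvgM; last exact: ccvgV.
  apply: ccvgM; last exact: mcvg_cofactor.
  apply: ccvgM; last by apply: ccvg_real; exact: cvgM.
  have -> : - ((2 * pi * alpha0)%:C * 'i%C) = (2 * pi * alpha0)%:C * - 'i%C by rewrite mulrN.
  have -> : (fun alpha => - ((2 * pi * alpha)%:C * 'i%C))
      = (fun alpha => (2 * pi * alpha)%:C * - 'i%C :> R[i]).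
    by apply/funext => alpha; rewrite mulrN.
  apply: ccvgM; last exact: ccvg_cst.
  apply: ccvg_real; apply: cvgM; first exact: cvg_cst.
  exact: cvg_alpha.
have -> : coef0 p = - ((2 * pi * alpha0)%:C * 'i%C) * (L ^+ 2)%:C
    * cofactor (slope_mx phi alpha0 l) p.1 p.2 * ('i%C + (h / s)%:C)^-1
    * (((-1) ^+ l * gap phi * L ^+ 2 * pi * N ^+ 2)%:C)^-1.
  have cof j k : cofactor (slope_mx phi alpha0 l) j k
      = ((-1) ^+ l * gap phi / alpha0)%:C * ((a l j)^*%C * a l k).
    by apply: cofactor_slope.
  refine (etrans _ (congr1 (fun X => _ * X * _ * _) (esym (cof _ _)))).
  exact: breit_wigner_coef sn N0 Ln sg_gap pin alpha00.
apply: near_eq_ccvg lim; apply: filterS2 (near_tau alpha0) f2_neq0 => alpha t0 y0.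
refine (etrans (congr1 (fun X => _ * X * _ * _) (cofactorZ2 _ _ _ _)) _).
exact: rescaled_coef t0 y0.
Qed.

Let lamh_neq0 : \forall alpha \near F, lamh alpha != lam0.
Proof.
have [[slope1 _ _ _ _] _] := resonance_limits.
have Ln := slope_neq0 alpha00 n10 gram label split l.
have nL : 0 < `|L| by rewrite normr_gt0.
move/cvgrPdist_lt : slope1 => /(_ _ nL); apply: filterS => alpha.
by apply: contraTneq => ->; rewrite subrr mul0r subr0 ltxx.
Qed.

Let bw := - (2%:R * 'i%C) * (s%:C / (h%:C + 'i%C * s%:C)) : R[i].
Let psin : R3 R -> R[i] := (N^-1)%:C *: psi0.

(* The difference between the amplitude and the Breit-Wigner operator is itself an
   operator of finite rank, whose last summand, indexed by [inr], is the latter. *)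
Let c_ alpha (p : 'I_2 * 'I_2 + 'I_1) : R[i] :=
  match p with inl q => coef alpha q | inr _ => - bw end.
Let c0 (p : 'I_2 * 'I_2 + 'I_1) : R[i] :=
  match p with inl q => coef0 q | inr _ => - bw end.
Let x_ (x : R) (p : 'I_2 * 'I_2 + 'I_1) : R3 R -> R[i] :=
  match p with inl q => fib (phi q.1) x | inr _ => psin end.
Let y_ (x : R) (p : 'I_2 * 'I_2 + 'I_1) : R3 R -> R[i] :=
  match p with inl q => fib (phi q.2) x | inr _ => psin end.

Let L2psin : L2 (surface R) psin. Proof. exact: L2Z. Qed.

Let L2x x p : 0 <= x -> L2 (surface R) (x_ x p).
Proof. by move=> x0; case: p => [q|q] //=; apply: L2_fiber (phi_E Phi _) x0. Qed.

Let L2y x p : 0 <= x -> L2 (surface R) (y_ x p).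
Proof. by move=> x0; case: p => [q|q] //=; apply: L2_fiber (phi_E Phi _) x0. Qed.

Let sumE (V : nmodType) (f : 'I_2 * 'I_2 + 'I_1 -> V) :
  \sum_p f p = \sum_q f (inl q) + f (inr ord0).
Proof. by rewrite big_sumType /= big_ord1. Qed.

Let hs_difference : \forall alpha \near F,
  hs_norm (surface R) e
    (fun f => amplitude (S alpha (lamh alpha)) f - breit_wigner h s psi0 f)
  = (Num.sqrt (Re (hs_sqr (surface R) (c_ alpha) (x_ (lamh alpha)) (y_ (lamh alpha)))))%:E.
Proof.
apply: filterS3 amplitude_ae lamh_gt0 lamh_neq0 => alpha A l0 ln.
apply: (hs_norm_finite_rank e_basis) => [p|p|n]; [exact: L2x (ltW l0)|exact: L2y (ltW l0)|].
have x0 : (lamh alpha - lam0)%:C != 0.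
  by rewrite -subr_eq0 in ln; apply: contra ln => /eqP[->].
have fibu j : fib (u j) (lamh alpha)
    = (lamh alpha - lam0)%:C *: fib (phi j) (lamh alpha) %[ae surface R].
  have [_ /(_ _ (ltW l0) ln) E _] := Phi j; apply: filterS E => om E _.
  by rewrite ptE E// ptE mulrA fmorphV/= divff// mul1r.
have Lu j : L2 (surface R) (fib (u j) (lamh alpha)) by exact: L2_fiber (u_E j) (ltW l0).
have Lphi j : L2 (surface R) (fib (phi j) (lamh alpha)) by exact: L2_fiber (phi_E Phi j) (ltW l0).
have innu j : innS (e n) (fib (u j) (lamh alpha))
    = (lamh alpha - lam0)%:C * innS (e n) (fib (phi j) (lamh alpha)).
  rewrite -[in RHS](conjc_real (lamh alpha - lam0)) -innerZr//.
  by apply: inner_ae => //; [exact: L2Z|exact: aeW].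
apply: filterS3 (A n) (fibu 0) (fibu 1) => om E f0 f1 _.
have fu k : fib (u k) (lamh alpha) om = (lamh alpha - lam0)%:C * fib (phi k) (lamh alpha) om.
  by elim/ord2P: k; [rewrite f0|rewrite f1].
rewrite sumE fun_subE fun_addE E//; congr (_ + _).
  rewrite !fct_sumE; apply: eq_bigr.
  move=> p _.
  have alg (ac x z v : R[i]) : (ac * (x * z)) * (x * v) = (ac * x ^+ 2 * z) * v by ring.
  refine (etrans (congr2 (fun i v => (_ * i) * v) (innu p.1) (fu p.2)) _).
  by rewrite alg -rmorphXn.
have alg (b z v : R[i]) : - (b * z * v) = - b * z * v by ring.
exact: alg.
Qed.

Let limit_zero n : 0 = \sum_p (c0 p * innS (e n) (x_ lam0 p)) *: y_ lam0 p
  %[ae surface R].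
Proof.
have N0 : N != 0 by apply/eqP.
have Ep : innS (e n) psin = (N^-1)%:C * ((a l 0)^*%C * innS (e n) (fib (phi 0) lam0)
    + (a l 1)^*%C * innS (e n) (fib (phi 1) lam0)).
  refine (etrans (innerZr _ (L2e n) L2psi0) _).
  exact: (congr2 (fun x y => x * y) (conjc_real _) (inner_psihat (L2e n))).
apply: filterS psi0E => om E _.
have Eq : psin om = (N^-1)%:C * (a l 0 * fib (phi 0) lam0 om + a l 1 * fib (phi 1) lam0 om).
  exact: (congr1 (fun x => _ * x) (E I)).
have Es : \sum_q ((c0 (inl q) * innS (e n) (x_ lam0 (inl q))) *: y_ lam0 (inl q)) om
    = \sum_j \sum_k bw / (N ^+ 2)%:C * ((a l j)^*%C * a l k)
        * innS (e n) (fib (phi j) lam0) * fib (phi k) lam0 om.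
  exact: (esym (pair_bigA _ (fun j k => bw / (N ^+ 2)%:C * ((a l j)^*%C * a l k)
        * innS (e n) (fib (phi j) lam0) * fib (phi k) lam0 om))).
rewrite sumE fun_addE fct_sumE.
refine (etrans (rank_one_cancel bw (innS (e n) (fib (phi 0) lam0)) (innS (e n) (fib (phi 1) lam0))
  (fib (phi 0) lam0 om) (fib (phi 1) lam0 om) (a l 0) (a l 1) (a l 0)^*%C (a l 1)^*%C N0)
  (esym (congr2 +%R (etrans Es _) (congr2 (fun x y => - bw * x * y) Ep Eq)))).
exact: (sum22 (fun j k => bw / (N ^+ 2)%:C * ((a l j)^*%C * a l k)
  * innS (e n) (fib (phi j) lam0) * fib (phi k) lam0 om)).
Qed.

(** The Hilbert-Schmidt norm of the difference is continuous in its coefficients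
    and vectors, and the difference vanishes at the limit. *)
Lemma amplitude_cvg : hs_norm (surface R) e
    (fun f => amplitude (S alpha (lamh alpha)) f - breit_wigner h s psi0 f)
  @[alpha --> F] --> 0%E.
Proof.
have l00 := ltW lam00.
have Z : hs_norm (surface R) e (fun=> 0) = 0%E.
  rewrite (hs_norm_finite_rank e_basis (I := 'I_0) (c := fun=> 0) (x := fun=> 0) (y := fun=> 0)).
  - by rewrite /hs_sqr big_ord0 /= sqrtr0.
  - by case.
  - by case.
  - by move=> n; apply: aeW => om; rewrite big_ord0.
have Z0 := hs_norm_finite_rank e_basis (T := fun=> 0) (fun p => L2x p l00)
  (fun p => L2y p l00) limit_zero.
rewrite Z in Z0; rewrite {}Z0.
suff lim : Num.sqrt (Re (hs_sqr (surface R) (c_ alpha) (x_ (lamh alpha)) (y_ (lamh alpha))))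
    @[alpha --> F] --> Num.sqrt (Re (hs_sqr (surface R) c0 (x_ lam0) (y_ lam0))).
  have lim' : (Num.sqrt (Re (hs_sqr (surface R) (c_ alpha) (x_ (lamh alpha)) (y_ (lamh alpha)))))%:E
    @[alpha --> F] --> (Num.sqrt (Re (hs_sqr (surface R) c0 (x_ lam0) (y_ lam0))))%:E.
    by apply: cvg_EFin => //; near=> alpha.
  by apply: cvg_trans lim'; apply: near_eq_cvg; apply: filterS hs_difference => alpha ->.
suff [lim _] : ccvg F (fun alpha => hs_sqr (surface R) (c_ alpha) (x_ (lamh alpha)) (y_ (lamh alpha)))
    (hs_sqr (surface R) c0 (x_ lam0) (y_ lam0)).
  by apply: (continuous_cvg _ _ lim); exact: sqrt_continuous.
have c_cvg p : ccvg F (c_ ^~ p) (c0 p).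
  by case: p => [q|q]; [exact: coef_cvg|exact: ccvg_cst].
have fib_cvg j : norm2 (surface R) (fib (phi j) (lamh alpha) - fib (phi j) lam0)
    @[alpha --> F] --> (0 : R).
  have H := @smooth_fibers_cvg _ _ _ _ 0 lam0 (smooth_fibersP (phi_E Phi j)) lam00.
  exact: (cvg_comp _ _ lamh_cvg H).
have psin_cvg : norm2 (surface R) (psin - psin) @[alpha --> F] --> (0 : R).
  by rewrite subrr norm2_0; exact: cvg_cst.
have xcvg p : norm2 (surface R) (x_ (lamh alpha) p - x_ lam0 p) @[alpha --> F] --> (0 : R).
  by case: p => [q|q] /=; [exact: fib_cvg|exact: psin_cvg].
have ycvg p : norm2 (surface R) (y_ (lamh alpha) p - y_ lam0 p) @[alpha --> F] --> (0 : R).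
  by case: p => [q|q] /=; [exact: fib_cvg|exact: psin_cvg].
have nx p : \forall alpha \near F, L2 (surface R) (x_ (lamh alpha) p).
  by apply: filterS lamh_gt0 => alpha /ltW; exact: L2x.
have ny p : \forall alpha \near F, L2 (surface R) (y_ (lamh alpha) p).
  by apply: filterS lamh_gt0 => alpha /ltW; exact: L2y.
apply: ccvg_sum => p; apply: ccvg_sum => q.
apply: ccvgM; [apply: ccvgM; [apply: ccvgM|]|].
- exact: c_cvg.
- by apply: ccvg_conj; exact: c_cvg.
- by apply: inner_cvg; [exact: ny|exact: ny|exact: L2y|exact: L2y|exact: ycvg|exact: ycvg].
- by apply: inner_cvg; [exact: nx|exact: nx|exact: L2x|exact: L2x|exact: xcvg|exact: xcvg].
Unshelve. all: end_near. Qed.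

End Resonances.

Unset Implicit Arguments.
Set Strict Implicit.
Set Printing Implicit Defensive.

Theorem theorem8p2 (R : realType)
    (FT : (R3 R -> R[i]) -> (R3 R -> R[i]))
    (HFT : fourier_transform FT)
    (* the perturbation *)
    (u : 'I_2 -> R3 R -> R[i])
    (Hu : forall j, classE FT (u j))
    (Hu_orth : inner (leb3 R) (u 0) (u 1) = 0)
    (* the double embedded eigenvalue lam0 of H_alpha0 *)
    (alpha0 lam0 : R)
    (Hlam0 : 0 < lam0)
    (Hu0 : forall j, norm2 (surface R) (fiber FT (u j) lam0) = 0)
    (Hgamma : forall j k : 'I_2,
        (j == k)%:R + alpha0%:C * gamma (eta FT (u j) (u k)) lam0 = 0)
    (phi : 'I_2 -> R3 R -> R[i])
    (Hphi : forall j, is_Phi FT (u j) lam0 (phi j))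
    (* splitting of the eigenvalue, and the choice of labels *)
    (Hsplit : inner (leb3 R) (phi 0) (phi 1) <> 0 \/
              norm2 (leb3 R) (phi 0) <> norm2 (leb3 R) (phi 1))
    (Hlabel : norm2 (leb3 R) (phi 0) <= norm2 (leb3 R) (phi 1))
    (* the paths, with I = ]i1, i2[ and J = ]j1, j2[ *)
    (i1 i2 j1 j2 : R)
    (HI : i1 < alpha0 < i2)
    (HJ : j1 < lam0 < j2)
    (HJpos : 0 < j1)
    (lam : 'I_2 -> R -> R)
    (Hlam_distinct : exists alpha, i1 < alpha < i2 /\ lam 0 alpha <> lam 1 alpha)
    (Hlam_smooth : forall j (n : nat) (alpha : R), i1 < alpha < i2 ->
        derivable (derive1n n (lam j)) alpha 1)
    (Hlam_J : forall j alpha, i1 < alpha < i2 -> j1 < lam j alpha < j2)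
    (Hlam_alpha0 : forall j, lam j alpha0 = lam0)
    (Hlam_slope : forall j, derive1 (lam j) alpha0 = slope phi alpha0 j)
    (Hlam_zeros : forall alpha x : R, i1 < alpha < i2 -> j1 <= x <= j2 ->
        (F1 FT u alpha x = 0 <-> x = lam 0 alpha \/ x = lam 1 alpha))
    (* nondegeneracy along the paths *)
    (HF2 : forall j alpha, i1 < alpha < i2 -> alpha <> alpha0 ->
        F2 FT u alpha (lam j alpha) <> 0)
    (* the scattering matrix, and its stationary representation on J *)
    (S : R -> R -> (R3 R -> R[i]) -> (R3 R -> R[i]))
    (HS : forall alpha, i1 < alpha < i2 -> alpha <> alpha0 ->
        scattering_matrix FT u alpha (S alpha))
    (HS_stationary : forall alpha x : R,
        i1 < alpha < i2 -> alpha <> alpha0 -> j1 < x < j2 ->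
        forall f, L2 (surface R) f ->
          S alpha x f = stationary_scattering FT u alpha x f
            %[ae surface R])
    (* the additional hypothesis *)
    (Hu' : forall l, norm2 (surface R) (fiber' FT (u l) lam0) <> 0)
    (* an orthonormal basis of L^2(S^2), used to compute the
       Hilbert-Schmidt norm *)
    (e : nat -> R3 R -> R[i])
    (He : orthonormal_basis (surface R) e)
    (l : 'I_2) (h : R) :
  let a := eigcoef phi alpha0 (fun j => derive1 (lam j) alpha0) in
  let psi := eigvec phi alpha0 (fun j => derive1 (lam j) alpha0) l in
  let s := norm2 (leb3 R) (a l l *: phi l) ^+ 2 in
  let lamh alpha := lam l alpha + h * kappa FT u phi l alpha (lam l alpha) in
  (norm2 (surface R) (fiber FT psi lam0) <> 0 ->
   hs_norm (surface R) e
     (fun f => amplitude (S alpha (lamh alpha)) f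
               - breit_wigner h s (fiber FT psi lam0) f)
     @[alpha --> alpha0^'] --> 0%E) /\
  cross_section e (S alpha (lamh alpha)) (lamh alpha)
    @[alpha --> alpha0^'] --> (4 * pi / lam0 * (s ^+ 2 / (h ^+ 2 + s ^+ 2)))%:E.
Proof.
have slopeE : (fun j => derive1 (lam j) alpha0) = slope phi alpha0.
  by apply/funext => j; exact: Hlam_slope.
rewrite slopeE => a psi s lamh.
have F1z alpha : i1 < alpha < i2 -> F1 FT u alpha (lam l alpha) = 0.
  move=> Ia; have /andP[/ltW Ja /ltW Jb] := Hlam_J l alpha Ia.
  apply: (Hlam_zeros alpha (lam l alpha) Ia _).2; first by rewrite Ja.
  by elim/ord2P: (l); [left|right].
have FTu : unitary_op (leb3 R) FT by case: HFT.
split.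
  move=> psi0.
  exact: (amplitude_cvg FTu Hlam0 Hu Hu0 Hgamma Hphi Hsplit Hlabel HI h
    (Hlam_smooth l 0 alpha0 HI) (Hlam_alpha0 l) (Hlam_slope l) F1z (HF2 l)
    HJ HJpos HS_stationary He psi0).
exact: (cross_section_cvg FTu Hlam0 Hu Hu0 Hgamma Hphi Hsplit Hlabel HI
    (Hlam_smooth l 0 alpha0 HI) (Hlam_alpha0 l) (Hlam_slope l) F1z (HF2 l)
    HJ HJpos HS_stationary He).
Qed.
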